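(* Let $\Bbbk$ be a commutative ring and $n$ a positive integer. For every pair of objects $(\underline{\tau},\underline{\sigma})$ of the category of pruned trees $\Omega_n^{epi}$, the morphism of dg-modules $$\iota: K(\Omega_n^{epi})(\underline{\tau},\underline{\sigma})\rightarrow B(\Omega_n^{epi})(\underline{\tau},\underline{\sigma}),\qquad \iota\{u\}=\sum_{\substack{u=u_1\cdots u_d\\ \deg u_1=\dots=\deg u_d=1}}\mathrm{sgn}(u_1)\cdots\mathrm{sgn}(u_d)\,\{\underline{\tau}_0\xleftarrow{u_1}\cdots\xleftarrow{u_d}\underline{\tau}_d\},$$ is a weak equivalence, i.e. it induces an isomorphism in homology.
   Context: Category of pruned trees. Write $\underline{\mathsf r}=\{1<\dots<r\}$. An object $\underline{\tau}$ of $\Omega_n^{epi}$ is a sequence of weakly increasing surjections $\underline{\mathsf t}_0\xrightarrow{\tau_1}\underline{\mathsf t}_1\xrightarrow{\tau_2}\cdots\xrightarrow{\tau_n}\underline{\mathsf t}_n=\underline{\mathsf 1}$ (a planar tree; $\underline{\mathsf t}_i$ is the ordered set of vertices of level $i$, the root is at level $n$, and $\underline{\mathsf t}_0$ is the set of leaves). A morphism $u:\underline{\tau}\to\underline{\sigma}$ is a sequence of surjections $u:\underline{\mathsf t}_i\to\underline{\mathsf s}_i$, $0\le i\le n$, commuting with the maps $\tau_i,\sigma_i$, and such that $u:\underline{\mathsf t}_i\to\underline{\mathsf s}_i$ is weakly increasing on each fiber $\tau_{i+1}^{-1}(x)$, $x\in\underline{\mathsf t}_{i+1}$. Composition is levelwise.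 The degree of an object is $\deg(\underline{\tau})=t_0+\dots+t_{n-1}$, and $\deg(u)=\deg(\underline{\tau})-\deg(\underline{\sigma})$ for $u:\underline{\tau}\to\underline{\sigma}$. Signs. A morphism $u:\underline{\tau}\to\underline{\sigma}$ of degree $1$ merges exactly two vertices $x_i,x_j$, consecutive in one fiber $\tau_{k+1}^{-1}(b)$ at some level $k<n$, and is bijective on all other vertices. Assign a symbol of degree $1$ to each vertex of level $<n$, and order the vertices of a tree by depth-first order from the root (from bottom to top, then left to right: each vertex precedes everything above it, and subtrees are listed from left to right). Then $\mathrm{sgn}(u)$ is the product of two Koszul signs: the sign of the permutation of degree $1$ symbols bringing $x_i\otimes x_j$ ($x_i$ preceding $x_j$) to the front of the ordered tensor of the vertices of $\underline{\tau}$, the other symbols keeping their order; and, after replacing $x_i\otimes x_j$ by one symbol $x_{ij}$ of degree $1$, the sign of the permutation putting the resulting tensor in the depth-first order of the vertices of $\underline{\sigma}$. dg-modules are $\mathbb Z$-graded with differential lowering degree by $1$. Bar construction. $B(\Omega_n^{epi})(\underline{\tau},\underline{\sigma})$ is the dg-module which in degree $d$ is the free $\Bbbk$-module on the $d$-tuples of composable morphisms $\{\underline{\tau}_0\xleftarrow{u_1}\cdots\xleftarrow{u_d}\underline{\tau}_d\}$ with all $u_i\neq\mathrm{id}$, $\underline{\tau}_d=\underline{\tau}$, $\underline{\tau}_0=\underline{\sigma}$, with differential $\partial\{\underline{\tau}_0\xleftarrow{u_1}\cdots\xleftarrow{u_d}\underline{\tau}_d\}=\sum_{i=1}^{d-1}(-1)^i\{\underline{\tau}_0\xleftarrow{u_1}\cdots\xleftarrow{u_iu_{i+1}}\cdots\xleftarrow{u_d}\underline{\tau}_d\}$.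 Koszul construction. $K(\Omega_n^{epi})(\underline{\tau},\underline{\sigma})=\bigoplus_{u:\underline{\tau}\to\underline{\sigma}}\Bbbk\{u\}$ (sum over the morphisms $u$ of $\Omega_n^{epi}$), with $\{u\}$ in degree $\deg(u)$ and zero differential. *)

(* Defs.v *)
From HB Require Import structures.
From mathcomp Require Import all_boot all_algebra.

Set Implicit Arguments.
Unset Strict Implicit.
Unset Printing Implicit Defensive.

Import GRing.Theory.

(* The levels i and i.+1 of a tree whose levels are 0, ..., n. *)
Definition lo n (i : 'I_n) : 'I_n.+1 := widen_ord (leqnSn n) i.
Definition up n (i : 'I_n) : 'I_n.+1 := lift ord0 i.

Definition surjb (aT rT : finType) (f : aT -> rT) : bool :=
  [forall y, exists x, f x == y].

Definition wincrb a b (f : 'I_a -> 'I_b) : bool :=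
  [forall x : 'I_a, forall y : 'I_a, (x <= y) ==> (f x <= f y)].

Definition edges n (t : {ffun 'I_n.+1 -> nat}) :=
  {dffun forall i : 'I_n, {ffun 'I_(t (lo i)) -> 'I_(t (up i))}}.

Definition is_tree n (p : {t : {ffun 'I_n.+1 -> nat} & edges t}) : bool :=
  (tag p ord_max == 1) &&
  [forall i : 'I_n, wincrb (tagged p i) && surjb (tagged p i)].

(* The objects of Omega_n^epi. *)
Record tree n := Tree {
  tree_val : {t : {ffun 'I_n.+1 -> nat} & edges t};
  _ : is_tree tree_val }.

HB.instance Definition _ n := [isSub for @tree_val n].
HB.instance Definition _ n := [Countable of tree n by <:].

(* lev tau i is t_i, and edge tau i, for i < n, is the map tau_{i+1} from the
   level i to the level i+1. *)
Definition lev n (tau : tree n) (i : 'I_n.+1) : nat := tag (tree_val tau) i.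

Definition edge n (tau : tree n) (i : 'I_n) :
  'I_(lev tau (lo i)) -> 'I_(lev tau (up i)) := tagged (tree_val tau) i.

Definition deg n (tau : tree n) : nat := \sum_(i < n) lev tau (lo i).

Definition maps n (tau sigma : tree n) :=
  {dffun forall i : 'I_n.+1, {ffun 'I_(lev tau i) -> 'I_(lev sigma i)}}.

Definition is_hom n (tau sigma : tree n) (u : maps tau sigma) : bool :=
  [&& [forall i, surjb (u i)],
      [forall i : 'I_n, forall x,
         u (up i) (edge x) == edge (u (lo i) x)]
    & [forall i : 'I_n, forall x : 'I_(lev tau (lo i)),
       forall y : 'I_(lev tau (lo i)),
         (edge x == edge y) && (x <= y) ==> (u (lo i) x <= u (lo i) y)]].

Record hom n (tau sigma : tree n) := Hom {
  hom_val : maps tau sigma;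
  _ : is_hom hom_val }.

HB.instance Definition _ n (tau sigma : tree n) :=
  [isSub for @hom_val n tau sigma].
HB.instance Definition _ n (tau sigma : tree n) :=
  [Finite of hom tau sigma by <:].

Definition hom_fun n (tau sigma : tree n) (u : hom tau sigma) :
  forall i, 'I_(lev tau i) -> 'I_(lev sigma i) := fun i => hom_val u i.
Coercion hom_fun : hom >-> Funclass.

Section Category.
Variable n : nat.
Implicit Types tau rho sigma : tree n.

Lemma hom_surj tau sigma (u : hom tau sigma) i y : exists x, u i x = y.
Proof.
case: u => u; rewrite /hom_fun /= => /and3P[/forallP/(_ i)/forallP/(_ y)/existsP[x /eqP <-] _ _].
by exists x.
Qed.

Lemma hom_edge tau sigma (u : hom tau sigma) (i : 'I_n)
    (x : 'I_(lev tau (lo i))) :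
  u (up i) (edge x) = edge (u (lo i) x).
Proof.
by case: u => u; rewrite /hom_fun /= => /and3P[_ /forallP/(_ i)/forallP/(_ x)/eqP -> _].
Qed.

Lemma hom_mono tau sigma (u : hom tau sigma) (i : 'I_n)
    (x y : 'I_(lev tau (lo i))) :
  edge x = edge y -> x <= y -> u (lo i) x <= u (lo i) y.
Proof.
move=> exy xy; case: u => u; rewrite /hom_fun /= => /and3P[_ _ /forallP/(_ i)].
by move=> /forallP/(_ x)/forallP/(_ y); rewrite exy eqxx xy.
Qed.

Definition id_maps tau : maps tau tau :=
  [ffun i => [ffun x : 'I_(lev tau i) => x]].

Lemma id_is_hom tau : is_hom (id_maps tau).
Proof.
apply/and3P; split.
- apply/forallP => i; apply/forallP => y; apply/existsP; exists y.
  by rewrite !ffunE.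
- by apply/forallP => i; apply/forallP => x; rewrite !ffunE.
- apply/forallP => i; apply/forallP => x; apply/forallP => y.
  by rewrite !ffunE; apply/implyP => /andP[].
Qed.

Definition id_hom tau : hom tau tau := Hom (id_is_hom tau).

Definition comp_maps tau rho sigma (u : hom rho sigma) (v : hom tau rho) :
  maps tau sigma := [ffun i => [ffun x : 'I_(lev tau i) => u i (v i x)]].

Lemma comp_is_hom tau rho sigma (u : hom rho sigma) (v : hom tau rho) :
  is_hom (comp_maps u v).
Proof.
apply/and3P; split.
- apply/forallP => i; apply/forallP => y; apply/existsP.
  have [z <-] := hom_surj u y; have [x <-] := hom_surj v z.
  by exists x; rewrite !ffunE.
- by apply/forallP => i; apply/forallP => x; rewrite !ffunE !hom_edge.
- apply/forallP => i; apply/forallP => x; apply/forallP => y.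
  rewrite !ffunE; apply/implyP => /andP[/eqP exy xy].
  by apply: hom_mono; [rewrite -!hom_edge exy | exact: hom_mono].
Qed.

Definition comp_hom tau rho sigma (u : hom rho sigma) (v : hom tau rho) :
  hom tau sigma := Hom (comp_is_hom u v).

Lemma id_homE tau i x : id_hom tau i x = x.
Proof. by rewrite /hom_fun /= !ffunE. Qed.

Lemma comp_homE tau rho sigma (u : hom rho sigma) (v : hom tau rho) i x :
  comp_hom u v i x = u i (v i x).
Proof. by rewrite {1}/hom_fun /= !ffunE. Qed.

Lemma hom_ext tau sigma (u v : hom tau sigma) :
  (forall i x, u i x = v i x) -> u = v.
Proof.
by move=> uv; apply: val_inj; apply/ffunP => i; apply/ffunP => x; apply: uv.
Qed.

Lemma comp_homA tau rho rho' sigma (u : hom rho' sigma) (v : hom rho rho')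
    (w : hom tau rho) :
  comp_hom u (comp_hom v w) = comp_hom (comp_hom u v) w.
Proof. by apply: hom_ext => i x; rewrite !comp_homE. Qed.

(* Source and target may differ, so u is compared with the identity as a
   morphism with source tau and arbitrary target. *)
Definition is_id tau sigma (u : hom tau sigma) : bool :=
  Tagged (hom tau) u == Tagged (hom tau) (id_hom tau).

(* deg u; by hom_deg_le below the truncated subtraction is the actual one. *)
Definition hom_deg tau sigma (u : hom tau sigma) : nat := deg tau - deg sigma.

Lemma hom_section tau sigma (u : hom tau sigma) i :
  {g : 'I_(lev sigma i) -> 'I_(lev tau i) | cancel g (u i)}.
Proof.
have ex y : exists x, u i x == y by have [x <-] := hom_surj u y; exists x.
by exists (fun y => xchoose (ex y)) => y; apply/eqP/(xchooseP (ex y)).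
Qed.

Lemma hom_lev tau sigma (u : hom tau sigma) i : lev sigma i <= lev tau i.
Proof.
have [g gK] := hom_section u i.
by have := leq_card g (can_inj gK); rewrite !card_ord.
Qed.

Lemma hom_deg_le tau sigma (u : hom tau sigma) : deg sigma <= deg tau.
Proof. by apply: leq_sum => i _; apply: hom_lev. Qed.

Lemma lev_max tau : lev tau ord_max = 1.
Proof. by case: tau => t tP; have /andP[/eqP] := tP. Qed.

Lemma root_eq0 tau (x : 'I_(lev tau ord_max)) : x = 0 :> nat.
Proof.
by apply/eqP; rewrite -leqn0 -ltnS (leq_trans (ltn_ord x)) ?lev_max.
Qed.

Lemma edge_wincr tau i (x y : 'I_(lev tau (lo i))) :
  x <= y -> edge x <= edge y.
Proof.
case: tau x y => t tP x y xy; have /andP[_ /forallP/(_ i)/andP[]] := tP.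
by move=> /forallP/(_ x)/forallP/(_ y)/implyP/(_ xy).
Qed.

Lemma incr_ord_ge a (f : 'I_a -> 'I_a) :
  (forall x y : 'I_a, x < y -> f x < f y) -> forall x : 'I_a, x <= f x.
Proof.
move=> f_incr [k]; elim: k => [//|k IHk] ltka.
have := IHk (ltnW ltka); move=> /leq_ltn_trans; apply.
exact: f_incr.
Qed.

Lemma incr_ord_id a b (f : 'I_a -> 'I_b) : a = b ->
  (forall x y : 'I_a, x < y -> f x < f y) -> forall x, f x = x :> nat.
Proof.
move=> eab; case: _ / eab f => f f_incr x.
apply/eqP; rewrite eqn_leq incr_ord_ge // andbT.
have g_incr (y z : 'I_a) : y < z ->
    rev_ord (f (rev_ord y)) < rev_ord (f (rev_ord z)).
  move=> yz; rewrite /= ltn_sub2l ?ltnS ?ltn_ord //.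
    by apply: leq_ltn_trans (ltn_ord (f (rev_ord y))); apply: f_incr;
      rewrite /= ltn_sub2l // (leq_ltn_trans _ (ltn_ord z)).
  by apply: f_incr; rewrite /= ltn_sub2l // (leq_ltn_trans _ (ltn_ord z)).
have := incr_ord_ge g_incr (rev_ord x); rewrite rev_ordK /=.
by rewrite leq_sub2lE // ltnS.
Qed.

Lemma iso_val_id tau sigma (u : hom tau sigma) :
  (forall i, lev tau i = lev sigma i) -> forall i x, u i x = x :> nat.
Proof.
move=> elev i; have [m le_m] := ubnP (n - i).
elim: m => // m IHm in i le_m *.
have u_inj : injective (u i).
  have [g gK] := hom_section u i.
  have g_bij : bijective g.
    by apply: inj_card_bij (can_inj gK) _; rewrite !card_ord elev.
  have [h _ hK] := g_bij.
  by move=> x y; rewrite -(hK x) -(hK y) !gK => ->.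
have [-> x|/eqP i_neq] := i =P ord_max.
  by rewrite !root_eq0.
have lt_in : i < n by rewrite ltn_neqAle i_neq -ltnS ltn_ord.
pose j := Ordinal lt_in; have ei : i = lo j by apply: val_inj.
rewrite ei in le_m u_inj *; apply: incr_ord_id (elev _) _ => x y lt_xy.
have up_id : forall z, u (up j) z = z :> nat.
  by apply: IHm; rewrite /= /bump /= add1n subnS prednK ?subn_gt0 // in le_m *.
have := edge_wincr (ltnW lt_xy); rewrite leq_eqVlt => /orP[/eqP/val_inj exy|].
  rewrite ltn_neqAle hom_mono ?(ltnW lt_xy) // andbT.
  by apply: contraTneq lt_xy => /val_inj/u_inj ->; rewrite ltnn.
rewrite -up_id -[X in _ < X]up_id !hom_edge => lt_e.
by rewrite ltnNge; apply: contraL lt_e => le_u; rewrite -leqNgt edge_wincr.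
Qed.

Lemma iso_is_id tau sigma (u : hom tau sigma) :
  (forall i, lev tau i = lev sigma i) -> is_id u.
Proof.
move=> elev; have u_id := iso_val_id u elev.
case: tau sigma u elev u_id => [[t e] tP] [[t' e'] tP'] u elev u_id.
have et : t = t' by apply/ffunP.
case: _ / et e' tP' u {elev} u_id => e' tP' u u_id.
have ee : e = e'.
  apply/ffunP => i; apply/ffunP => x; apply: val_inj.
  have /(congr1 val) := hom_edge u x; rewrite /= u_id /edge /= => ->.
  by congr (val (e' i _)); apply: val_inj; rewrite /= u_id.
case: _ / ee tP' u u_id => tP' u u_id.
rewrite (bool_irrelevance tP' tP) in u u_id *.
rewrite /is_id (_ : u = id_hom _) //.
by apply: hom_ext => i x; rewrite id_homE; apply: val_inj; apply: u_id.
Qed.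

Lemma nonid_deg tau sigma (u : hom tau sigma) :
  ~~ is_id u -> deg sigma < deg tau.
Proof.
apply: contraNltn => le_deg; apply: iso_is_id => i.
have eqd : deg sigma = deg tau by apply/eqP; rewrite eqn_leq hom_deg_le.
have [->|/eqP i_neq] := i =P ord_max; first by rewrite !lev_max.
have lt_in : i < n by rewrite ltn_neqAle i_neq -ltnS ltn_ord.
have ei : i = lo (Ordinal lt_in) by apply: val_inj.
rewrite ei; set j := Ordinal lt_in; apply/eqP; rewrite eq_sym.
have := hom_lev u (lo j); rewrite leq_eqVlt => /orP[//|lt_lev].
move: eqd; rewrite /deg (bigD1 j) //= [RHS](bigD1 j) //= => eqd.
have : \sum_(k < n | k != j) lev sigma (lo k)
    <= \sum_(k < n | k != j) lev tau (lo k).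
  by apply: leq_sum => k _; apply: hom_lev.
by move=> /(leq_add lt_lev); rewrite addSn eqd ltnn.
Qed.

Definition nonid tau sigma := {u : hom tau sigma | ~~ is_id u}.

Lemma comp_nonid tau rho sigma (u : nonid rho sigma) (v : nonid tau rho) :
  ~~ is_id (comp_hom (val u) (val v)).
Proof.
have lt_deg := ltn_trans (nonid_deg (valP u)) (nonid_deg (valP v)).
rewrite /is_id; apply: contraTN lt_deg => /eqP e.
by rewrite -(congr1 (fun p => deg (tag p)) e) /= ltnn.
Qed.

Definition nonid_comp tau rho sigma (u : nonid rho sigma) (v : nonid tau rho) :
  nonid tau sigma :=
  exist (fun w : hom tau sigma => ~~ is_id w) _ (comp_nonid u v).

Lemma nonid_compA tau rho rho' sigma (u : nonid rho' sigma)
    (v : nonid rho rho') (w : nonid tau rho) :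
  nonid_comp u (nonid_comp v w) = nonid_comp (nonid_comp u v) w.
Proof. by apply: val_inj; apply: comp_homA. Qed.

End Category.

(* The trees that receive a morphism from tau.  There are finitely many of
   them, and they include every tree which occurs in a chain starting at tau. *)
Record quotient n (tau : tree n) := Quotient {
  quot_tree :> tree n;
  _ : [exists u : hom tau quot_tree, true] }.

HB.instance Definition _ n (tau : tree n) := [isSub for @quot_tree n tau].
HB.instance Definition _ n (tau : tree n) := [Countable of quotient tau by <:].

Section QuotientFinite.
Variables (n : nat) (tau : tree n).

Let bound : nat := \max_i lev tau i.

Let shapes : seq {ffun 'I_n.+1 -> nat} :=
  [seq [ffun i => f i : nat] | f : {ffun 'I_n.+1 -> 'I_bound.+1}].

Let trees : seq (tree n) :=
  pmap insub (flatten [seq [seq Tagged (@edges n) e | e : edges t]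
                      | t <- shapes]).

Let quots : seq (quotient tau) := undup (pmap insub trees).

Fact quots_enumP : Finite.axiom quots.
Proof.
apply: Finite.uniq_enumP => [|rho]; first exact: undup_uniq.
rewrite mem_undup inE mem_pmap_sub; have /existsP[u _] := valP rho.
rewrite mem_pmap_sub; case: rho u => [[[t e] eP] rhoP] /= u.
apply/flatten_mapP; exists t; last by apply/imageP; exists e.
apply/imageP; exists [ffun i => inord (t i)] => //.
apply/ffunP => i; rewrite !ffunE inordK // ltnS.
by apply: leq_trans (hom_lev u i) _; apply: leq_bigmax.
Qed.

HB.instance Definition _ := isFinite.Build (quotient tau) quots_enumP.

End QuotientFinite.

(* An element of chain d tau sigma is a tuple sigma = tau_0 <-u_1- tau_1 <- ...
   <-u_d- tau_d = tau of nonidentity morphisms.  For d > 0 it is given by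
   tau_1, u_1 and the chain u_2, ..., u_d.  The empty tuple, which exists only
   for sigma = tau, is represented by the identity morphism of tau. *)
Fixpoint chain n d (tau sigma : tree n) : finType :=
  if d is d'.+1 then
    {rho : quotient tau & (nonid rho sigma * chain d' tau rho)%type}
  else {u : hom tau sigma | is_id u}.

Section Chains.
Variables (n : nat) (tau : tree n).
Implicit Types sigma : tree n.

(* u_1 ... u_d *)
Fixpoint chain_comp d sigma : chain d tau sigma -> hom tau sigma :=
  match d return chain d tau sigma -> hom tau sigma with
  | 0 => fun c => val c
  | d'.+1 => fun c =>
      comp_hom (val (tagged c).1) (chain_comp (tagged c).2)
  end.

Fixpoint chain_deg1 d sigma : chain d tau sigma -> bool :=
  match d return chain d tau sigma -> bool with
  | 0 => fun=> true
  | d'.+1 => fun c =>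
      (hom_deg (val (tagged c).1) == 1) && chain_deg1 (tagged c).2
  end.

(* Replaces u_1, u_2 by u_1 u_2. *)
Definition chain_merge d sigma (c : chain d.+2 tau sigma) :
    chain d.+1 tau sigma :=
  let: existT rho1 (u1, c1) := c in
  let: existT rho2 (u2, c2) := c1 in
  Tagged (fun rho : quotient tau => (nonid rho sigma * chain d tau rho)%type)
    (nonid_comp u1 u2, c2).

(* Replaces u_{i+1}, u_{i+2} by u_{i+1} u_{i+2}, for i <= d. *)
Fixpoint chain_face d (i : nat) sigma :
    chain d.+2 tau sigma -> chain d.+1 tau sigma :=
  match d, i return chain d.+2 tau sigma -> chain d.+1 tau sigma with
  | d'.+1, i'.+1 => fun c =>
      let: existT rho (u, c') := c in
      Tagged (fun rho : quotient tau =>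
                (nonid rho sigma * chain d'.+1 tau rho)%type)
        (u, chain_face i' c')
  | _, _ => @chain_merge _ sigma
  end.

Lemma chain_faceC d i j sigma (c : chain d.+3 tau sigma) : j <= i <= d ->
  chain_face j (chain_face i.+1 c) = chain_face i (chain_face j c).
Proof.
elim: d i j sigma c => [|d IHd] i j sigma.
  rewrite leqn0 => + /andP[+ /eqP i0]; rewrite i0 leqn0 => + /eqP ->.
  case=> rho1 [u1 [rho2 [u2 [rho3 [u3 c]]]]] /=.
  by rewrite nonid_compA.
case: j => [|j] c => [_|].
  case: i => [|i] in c *.
    case: c => rho1 [u1 [rho2 [u2 [rho3 [u3 c]]]]] /=.
    by rewrite nonid_compA.
  by case: c => rho1 [u1 [rho2 [u2 [rho3 [u3 c]]]]].
case: i => [//|i] le_ji; case: c => rho1 [u1 c] /=.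
by rewrite IHd.
Qed.

End Chains.

Section Signs.
Variable n : nat.
Implicit Types tau sigma : tree n.

(* The vertex x of level k is encoded as (k, x). *)
Definition vertex : Type := nat * nat.

(* f k x, or 0 if k or x is out of range. *)
Definition nat_map m (a b : 'I_m -> nat) (f : forall i, 'I_(a i) -> 'I_(b i))
    (k x : nat) : nat :=
  oapp (fun i : 'I_m => oapp (fun y => f i y : nat) 0 (insub x)) 0 (insub k).

Definition nat_lev tau (k : nat) : nat := oapp (lev tau) 0 (insub k).

Definition on_vertex tau sigma (u : hom tau sigma) (v : vertex) : vertex :=
  (v.1, nat_map u v.1 v.2).

(* The depth-first enumeration of the subtree with root (k, x). *)
Fixpoint dfs tau (k x : nat) : seq vertex :=
  (k, x) ::
  if k is k'.+1 then
    flatten [seq dfs tau k' y | y <- iota 0 (nat_lev tau k')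
                              & nat_map (edge (tau := tau)) k' y == x]
  else [::].

(* The root, of level n, carries no symbol. *)
Definition symbols tau : seq vertex := behead (dfs tau n 0).

(* The number of inversions of the permutation that takes the word s, without
   repetition, to its rearrangement t; on symbols of degree 1 the Koszul sign
   is -1 to this power. *)
Definition inversions (T : eqType) (s t : seq T) : nat :=
  count (fun p => (index p.1 s < index p.2 s) && (index p.2 t < index p.1 t))
        [seq (a, b) | a <- s, b <- s].

Definition merged tau sigma (u : hom tau sigma) : seq (vertex * vertex) :=
  let s := symbols tau in
  [seq p <- [seq (a, b) | a <- s, b <- s]
     | (index p.1 s < index p.2 s) && (on_vertex u p.1 == on_vertex u p.2)].

(* sgn(u), meaningful if u has degree 1: exactly one pair is then merged. *)
Definition hom_sgn (R : pzRingType) tau sigma (u : hom tau sigma) : R :=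
  if merged u is [:: (a, b)] then
    let s := symbols tau in
    let rest := [seq v <- s | (v != a) && (v != b)] in
    ((-1) ^+ inversions s [:: a, b & rest] *
     (-1) ^+ inversions (map (on_vertex u) (a :: rest)) (symbols sigma))%R
  else 0%R.

End Signs.

Fixpoint chain_sgn (R : pzRingType) n (tau : tree n) d sigma :
    chain d tau sigma -> R :=
  match d return chain d tau sigma -> R with
  | 0 => fun=> 1%R
  | d'.+1 => fun c =>
      (hom_sgn R (val (tagged c).1) * chain_sgn R (tagged c).2)%R
  end.

Local Open Scope ring_scope.

(* dg-modules that vanish in negative degrees: the differential lowers the
   degree by 1, and every element of degree 0 is a cycle. *)
Record complex (R : pzRingType) := Complex {
  cmod :> nat -> lmodType R;
  cdiff : forall d, {linear cmod d.+1 -> cmod d};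
  cdiffK : forall d x, cdiff d (cdiff d.+1 x) = 0 }.

Arguments cdiff {R} c d.

Section Homology.
Variables (R : pzRingType).
Implicit Types C D : complex R.

Definition cycle C d : C d -> Prop :=
  match d return C d -> Prop with
  | 0 => fun=> True
  | d'.+1 => fun x => cdiff C d' x = 0
  end.

Definition homologous C d (x y : C d) : Prop :=
  exists w : C d.+1, x - y = cdiff C d w.

Definition chain_map C D (f : forall d, {linear C d -> D d}) : Prop :=
  forall d (x : C d.+1), f d (cdiff C d x) = cdiff D d (f d.+1 x).

(* The map induced by f on cycles modulo boundaries is injective and surjective
   in every degree. *)
Definition homology_iso C D (f : forall d, {linear C d -> D d}) : Prop :=
  forall d,
    (forall x y : C d, cycle x -> cycle y ->
       homologous (f d x) (f d y) -> homologous x y) /\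
    (forall z : D d, cycle z ->
       exists2 x : C d, cycle x & homologous (f d x) z).

Definition weak_equivalence C D (f : forall d, {linear C d -> D d}) : Prop :=
  chain_map f /\ homology_iso f.

End Homology.

Section FreeModule.
Variables (R : pzRingType) (T : finType).

Definition free : lmodType R := {ffun T -> R^o}.

Definition gen (t : T) : free := [ffun y => (y == t)%:R].

Definition lin_ext (V : lmodType R) (f : T -> V) (x : free) : V :=
  \sum_(t : T) (x : {ffun T -> R}) t *: f t.

Fact lin_ext_is_linear (V : lmodType R) (f : T -> V) : linear (lin_ext f).
Proof.
move=> a x y; rewrite /lin_ext scaler_sumr -big_split /=.
by apply: eq_bigr => t _; rewrite !ffunE scalerDl scalerA.
Qed.

HB.instance Definition _ (V : lmodType R) (f : T -> V) :=
  GRing.isLinear.Build R free V *:%R (lin_ext f) (lin_ext_is_linear f).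

Lemma lin_ext_gen (V : lmodType R) (f : T -> V) t : lin_ext f (gen t) = f t.
Proof.
rewrite /lin_ext (bigD1 t) //= ffunE eqxx scale1r big1 ?addr0 // => s st.
by rewrite ffunE (negPf st) scale0r.
Qed.

Lemma lin_ext_eq0 (V : lmodType R) (f : T -> V) x :
  (forall t, f t = 0) -> lin_ext f x = 0.
Proof. by move=> f0; apply: big1 => t _; rewrite f0 scaler0. Qed.

Lemma linear_lin_ext (V W : lmodType R) (f : T -> V) (g : {linear V -> W}) x :
  g (lin_ext f x) = lin_ext (g \o f) x.
Proof. by rewrite linear_sum; apply: eq_bigr => t _; rewrite linearZ. Qed.

End FreeModule.

Arguments gen {R T} t.

Section Constructions.
Variables (R : pzRingType) (n : nat) (tau sigma : tree n).

Definition bar_mod d : lmodType R := free R (chain d tau sigma).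

Definition bar_diff_gen d : chain d.+1 tau sigma -> bar_mod d :=
  match d return chain d.+1 tau sigma -> bar_mod d with
  | 0 => fun=> 0
  | d'.+1 => fun c => \sum_(i < d'.+1) (-1) ^+ i.+1 *: gen (chain_face i c)
  end.

Definition bar_diff d : {linear bar_mod d.+1 -> bar_mod d} :=
  lin_ext (@bar_diff_gen d).

Lemma alternating_sum0 (V : lmodType R) (a : nat -> nat -> V) m :
  (forall i j, (j <= i < m)%N -> a i.+1 j = a j i) ->
  \sum_(i < m.+1) \sum_(j < m) ((-1) ^+ (i + j)) *: a i j = 0.
Proof.
elim: m => [|m IHm] aC; first by rewrite big_ord1 big_ord0.
rewrite big_ord_recr /=.
under eq_bigr do rewrite big_ord_recr /=.
rewrite big_split /= IHm ?add0r => [|i j /andP[ji im]]; last first.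
  by apply: aC; rewrite ji ltnW.
rewrite -big_split big1 //= => i _.
rewrite aC ?(leq_ord i) ?leqnn // -scalerDl addSn exprS mulN1r [(m + i)%N]addnC.
by rewrite subrr scale0r.
Qed.

Lemma bar_diffK d x : bar_diff d (bar_diff d.+1 x) = 0.
Proof.
rewrite /bar_diff /= linear_lin_ext; apply: lin_ext_eq0 => c.
case: d c {x} => [|d] c; rewrite [LHS]linear_sum.
  by apply: big1 => i _; rewrite linearZ /= lin_ext_gen scaler0.
pose a i j : bar_mod d.+1 :=
  gen (chain_face j (chain_face i (c : chain d.+3 tau sigma))).
rewrite -[RHS](@alternating_sum0 _ a d.+1) => [|i j ji]; last first.
  by rewrite /a chain_faceC.
apply: eq_bigr => i _; rewrite linearZ /= lin_ext_gen /= scaler_sumr.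
apply: eq_bigr => j _.
by rewrite scalerA -exprD addSn addnS !exprS !mulN1r opprK.
Qed.

Definition bar : complex R := Complex bar_diffK.

Definition koszul_mod d : lmodType R :=
  free R {u : hom tau sigma | hom_deg u == d}.

Definition koszul_diff d : {linear koszul_mod d.+1 -> koszul_mod d} := \0.

Lemma koszul_diffK d x : koszul_diff d (koszul_diff d.+1 x) = 0.
Proof. by []. Qed.

Definition koszul : complex R := Complex koszul_diffK.

(* The factorizations of u into morphisms of degree 1 are the chains of length
   d = deg u. *)
Definition incl_gen d (u : {u : hom tau sigma | hom_deg u == d}) : bar d :=
  \sum_(c : chain d tau sigma | (chain_comp c == val u) && chain_deg1 c)
    chain_sgn R c *: gen c.

Definition incl d : {linear koszul d -> bar d} := lin_ext (@incl_gen d).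

End Constructions.

(* Main.v *)
Require Import Defs.
From mathcomp Require Import all_boot all_algebra.
Require Import Defs.
Set Implicit Arguments.
Unset Strict Implicit.
Unset Printing Implicit Defensive.

(* A factorization of u : tau -> sigma through rho is determined by the relation
   "v x and v y are siblings and v x <= v y" on the vertices of tau, where
   v : tau -> rho; refinement of factorizations is inclusion of relations.
   Geometrically, the factorizations of u are the strata of a convex cone (one
   coordinate per vertex, increasing along siblings that u identifies).  Moving
   the first vertex x0 of a collapsed class to the left stays in the cone, so
   the strata are matched by comparing the descendants of x0 with the other
   vertices: the words that record the relative positions of the two families
   are lattice paths, and a path is matched with the one where its first corner
   is cut off.  An inversion count makes this matching acyclic, so the Koszul
   complex of a nonidentity morphism is exact; on intervals of degree 2 the
   matching leaves exactly two intermediate factorizations, whose signs are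
   opposite.  Since the Koszul construction is concentrated in the top degree,
   an induction on the degree, peeling off the first morphism of a chain, then
   computes the homology of the bar construction. *)

(** * Compatible preorders on the vertices and their matching *)

(** The corner to cut must be recoverable from both members of a matched pair. Taking it on the
    level farthest from the root secures this: among the children of the block that is cut, no
    vertex of [A] precedes a vertex of the other family with the same image under [u], so the two
    sets of children can be shuffled back in only one way, and fusing undoes cutting. The complex
    that the matching makes exact has the pairs (w, v) with w v = u as its basis. It meets the bar
    construction as follows: once the first morphism of a chain is fixed, the tails of a cycle can
    by induction be taken to be images of Koszul elements, and what remains of the cycle condition
    is the differential of this complex. Pruned trees have no isomorphisms besides identities.
    Factorizations therefore correspond to preorders strictly, and not only up to isomorphism, which
    is why they can be compared and counted through their relations. *)

Section Relations.
Variables (V : finType) (par : V -> V) (lvl : V -> nat).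
Variables (le0 : rel V) (uo : V -> nat).
(* V is the set of vertices of tau, le0 x y means that x and y are siblings with
   x <= y, and uo x is the position of u x in its level. *)
Implicit Types (R : rel V) (x y z a b c d : V).

Definition eqv R x y := R x y && R y x.

(** These conditions characterize the relations of the factorizations of [u]: see [valid_rel_of]
    and, for the converse, [realize]. [valid_le0] expresses that the inner factor is monotone on
    fibers, [valid_uo] that the outer one is. *)
Record valid R : Prop := Valid {
  valid_lvl : forall x y, R x y -> lvl x = lvl y;
  valid_par : forall x y, R x y -> eqv R (par x) (par y);
  valid_total : forall x y, lvl x = lvl y -> eqv R (par x) (par y) ->
    R x y || R y x;
  valid_trans : forall y x z, R x y -> R y z -> R x z;
  valid_le0 : forall x y, le0 x y -> R x y;
  valid_uo : forall x y, R x y -> uo x <= uo y }.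

Hypothesis le0_refl : reflexive le0.
Hypothesis le0_par : forall x y, le0 x y -> par x = par y.

(** [A] stands for [x0] together with its descendants, where [x0] is the leftmost of several
    siblings with the same image under [u], and [y0] is another of these siblings. Being leftmost is
    [x0_first]; it is what allows [A] to move to the left. *)
Variables (A : pred V) (x0 y0 : V).
Hypothesis A_x0 : A x0.
Hypothesis A_up : forall x, A x -> x != x0 -> A (par x).
Hypothesis A_down : forall x, A (par x) -> A x.
Hypothesis A_le : forall x, A x -> lvl x <= lvl x0.
Hypothesis A_top : forall x, A x -> lvl x = lvl x0 -> x = x0.
Hypothesis A_lvl : forall x, A x -> lvl (par x) = (lvl x).+1.
Hypothesis lvl_child : forall x y, A y -> lvl (par x) = lvl y -> (lvl x).+1 = lvl y.
Hypothesis x0_first : forall x, ~~ A x -> le0 x x0 -> uo x = uo x0 -> False.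
Hypothesis y0A : ~~ A y0.
Hypothesis x0y0 : le0 x0 y0.
Hypothesis uo_y0 : uo x0 = uo y0.

Lemma valid_refl R x : valid R -> R x x.
Proof. by move=> vR; apply: valid_le0. Qed.

Lemma eqv_sym R x y : eqv R x y = eqv R y x.
Proof. by rewrite /eqv andbC. Qed.

Lemma eqv_refl R x : valid R -> eqv R x x.
Proof. by move=> vR; rewrite /eqv valid_refl. Qed.

Lemma eqv_trans R y x z : valid R -> eqv R x y -> eqv R y z -> eqv R x z.
Proof.
move=> vR /andP[xy yx] /andP[yz zy].
by rewrite /eqv (valid_trans vR xy yz) (valid_trans vR zy yx).
Qed.

Lemma eqv_uo R x y : valid R -> eqv R x y -> uo x = uo y.
Proof.
by move=> vR /andP[xy yx]; apply/eqP; rewrite eqn_leq !(valid_uo vR).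
Qed.

Lemma A_same_lvl c z : A c -> A z -> lvl c = lvl z ->
  c = z \/ A (par c) /\ A (par z).
Proof.
move=> Ac Az e; have [cx|cx] := eqVneq c x0.
  by left; rewrite cx (A_top Az) // -e cx.
have [zx|zx] := eqVneq z x0.
  by left; rewrite zx (A_top Ac) // e zx.
by right; split; apply: A_up.
Qed.

(* With s the elements of A and t the others, a corner is a step "s t" of the
   word of R around (a, b), or the block {a, b} that cuts such a step off. *)
Definition corner R a b := [&& A a, ~~ A b, R a b, uo a == uo b,
  [forall z, [&& A z, R a z & R z b] ==> R z a] &
  [forall z, [&& ~~ A z, R a z & R z b] ==> R b z]].

Lemma cornerP R a b : reflect
  [/\ A a, ~~ A b, R a b, uo a = uo b &
    (forall z, A z -> R a z -> R z b -> R z a) /\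
    (forall z, ~~ A z -> R a z -> R z b -> R b z)] (corner R a b).
Proof.
apply: (iffP and5P) => [[-> -> -> /eqP -> /andP[h1 h2]]|[-> -> -> -> [h1 h2]]].
  split=> //; split=> z zA az zb.
    by move: h1 => /forallP/(_ z)/implyP; apply; rewrite zA az.
  by move: h2 => /forallP/(_ z)/implyP; apply; rewrite zA az.
split=> //; apply/andP; split; apply/forallP => z; apply/implyP.
  by case/and3P; apply: h1.
by case/and3P; apply: h2.
Qed.

(** If (a, b) is no corner, an element in between violates one of the two conditions. It replaces
    the endpoint of its own family, and the interval shrinks. Its image is that of the endpoints
    because [uo] is monotone. *)
Lemma corner_exists R a b : valid R -> A a -> ~~ A b -> R a b -> uo a = uo b ->
  exists c d, corner R c d /\ lvl c = lvl a.
Proof.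
move=> vR; have [m] := ubnP #|[set z | R a z & R z b]|.
elim: m => // m IHm in a b *; rewrite ltnS => le_m Aa Ab ab uab.
have lt_card c d : R a c -> R c d -> R d b -> ~~ (R c a && R b d) ->
    #|[set z | R c z & R z d]| < m.
  move=> ac cd db ncd; apply: leq_trans le_m; apply: proper_card.
  rewrite properE; apply/andP; split.
    apply/subsetP => z; rewrite !inE => /andP[cz zd].
    by rewrite (valid_trans vR ac) // (valid_trans vR _ db).
  apply/negP => /subsetP sub; move/negP: ncd; apply.
  have ha : a \in [set z | R a z & R z b] by rewrite inE valid_refl.
  have hb : b \in [set z | R a z & R z b] by rewrite inE ab valid_refl.
  by move: (sub _ ha) (sub _ hb); rewrite !inE => /andP[-> _] /andP[_ ->].
have between z : R a z -> R z b -> uo z = uo a.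
  move=> /(valid_uo vR) az /(valid_uo vR) zb; apply/eqP.
  by rewrite eqn_leq az uab zb.
have [cor|] := boolP (corner R a b); first by exists a, b.
rewrite /corner Aa Ab ab uab eqxx /= negb_and => /orP[] /forallPn[z];
  rewrite negb_imply => /andP[/and3P[Az az zb] nz].
  have nz' : ~~ (R z a && R b b) by rewrite (negPf nz).
  have [|c [d [cd lc]]] := IHm z b (lt_card _ _ az zb (valid_refl _ vR) nz') Az Ab zb.
    by rewrite between.
  by exists c, d; split=> //; rewrite lc -(valid_lvl vR az).
have nz' : ~~ (R a a && R b z) by rewrite (negPf nz) andbF.
have [|c [d [cd lc]]] := IHm a z (lt_card _ _ (valid_refl _ vR) az zb nz') Aa Az az.
  by rewrite between.
by exists c, d.
Qed.

(** The level is the leading digit; the rank of the pair only breaks ties, so that the minimum is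
    unique. Small levels are those far from the root. *)
Definition corner_key (p : V * V) : nat := lvl p.1 * #|{: V * V}| + enum_rank p.

Lemma key_inj p q : corner_key p = corner_key q -> p = q.
Proof.
move=> /(congr1 (modn^~ #|{: V * V}|)).
by rewrite /corner_key !modnMDl !modn_small // => /val_inj/enum_rank_inj.
Qed.

Lemma key_lvl p q : corner_key p <= corner_key q -> lvl p.1 <= lvl q.1.
Proof.
apply: contraTT; rewrite -!ltnNge /corner_key => lt.
apply: leq_trans (leq_addr _ _).
apply: (@leq_trans ((lvl q.1).+1 * #|{: V * V}|)).
  by rewrite mulSn addnC ltn_add2r.
by rewrite leq_mul2r lt orbT.
Qed.

Definition chosen R a b :=
  corner R a b && [forall p, corner R p.1 p.2 ==> (corner_key (a, b) <= corner_key p)].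

Lemma chosenP R a b : reflect
  (corner R a b /\ forall c d, corner R c d -> corner_key (a, b) <= corner_key (c, d))
  (chosen R a b).
Proof.
apply: (iffP andP) => -[cab h]; split=> //.
  by move=> c d cd; move/forallP/(_ (c, d))/implyP: h; apply.
by apply/forallP => -[c d]; apply/implyP; apply: h.
Qed.

Lemma chosen_uniq R a b c d : chosen R a b -> chosen R c d -> (a, b) = (c, d).
Proof.
move=> /chosenP[ab mab] /chosenP[cd mcd]; apply: key_inj; apply/eqP.
by rewrite eqn_leq mab ?mcd.
Qed.

Lemma chosen_exists R : valid R -> exists a b, chosen R a b.
Proof.
move=> vR; have [c [d [cd _]]] := corner_exists vR A_x0 y0A (valid_le0 vR x0y0) uo_y0.
have cd' : corner R (c, d).1 (c, d).2 by [].
have [[a b] ab mab] := arg_minnP (P := fun p => corner R p.1 p.2) corner_key cd'.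
by exists a, b; apply/chosenP; split=> // c' d' cd''; apply: mab (c', d') cd''.
Qed.

(** Applied to the children of the class of [a], whose level is smaller: among those with equal
    image, none in [A] precedes one outside [A]. *)
Lemma chosen_lvl R a b c d : valid R -> chosen R a b -> A c -> ~~ A d ->
  R c d -> uo c = uo d -> lvl a <= lvl c.
Proof.
move=> vR /chosenP[_ mab] Ac Ad cd ucd.
have [c' [d' [cd' <-]]] := corner_exists vR Ac Ad cd ucd.
exact: (key_lvl (mab _ _ cd')).
Qed.

(** Breaking only mixed classes, with the part in [A] first, creates no corner, since a mixed pair
    inside a class already counted as one. Hence a chosen corner that is still a corner after such a
    refinement is still chosen. *)
Lemma corner_sub R1 R2 c d : valid R1 -> valid R2 -> subrel R2 R1 ->
  (forall x y, A x = A y -> eqv R1 x y -> R2 x y) ->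
  (forall x y, A x -> ~~ A y -> eqv R1 x y -> R2 x y) ->
  corner R2 c d -> corner R1 c d.
Proof.
move=> v1 v2 sub same cross /cornerP[Ac Ad cd ucd [hA hB]].
have lcd := valid_lvl v1 (sub _ _ cd).
have [pcd pdc] := andP (valid_par v2 cd).
have sub_par x y : A (par x) = A (par y) -> R1 x y -> eqv R2 (par x) (par y).
  move=> e /(valid_par v1) pxy; rewrite /eqv !same //.
  by rewrite eqv_sym.
apply/cornerP; split=> //; first exact: sub.
split=> z Az cz zd; have lcz := valid_lvl v1 cz.
  have [<-|[Apc Apz]] := A_same_lvl Ac Az lcz; first exact: valid_refl.
  have pcz : eqv R2 (par c) (par z) by apply: sub_par => //; rewrite Apc.
  have /orP[cz2|/sub//] := valid_total v2 lcz pcz.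
  have pzd : eqv R2 (par z) (par d).
    by apply: eqv_trans (valid_par v2 cd) => //; rewrite eqv_sym.
  have /orP[zd2|dz2] := valid_total v2 (valid_lvl v1 zd) pzd.
    by apply: (sub); apply: hA.
  by apply: (sub); apply: hA => //; apply: cross => //; rewrite /eqv zd sub.
have Apz : A (par z) = A (par d).
  by rewrite (negPf (contra (@A_down z) Az)) (negPf (contra (@A_down d) Ad)).
have pzd : eqv R2 (par z) (par d) by apply: sub_par.
have /orP[zd2|/sub//] := valid_total v2 (valid_lvl v1 zd) pzd.
have pcz : eqv R2 (par c) (par z).
  by apply: eqv_trans (valid_par v2 cd) _ => //; rewrite eqv_sym.
have /orP[cz2|zc2] := valid_total v2 lcz pcz; apply: (sub); apply: hB => //.
by apply: cross => //; rewrite /eqv cz sub.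
Qed.

(** Cuts the class of [a] with its part in [A] first. The last clause is then forced: children of
    the two parts have lost their common parent. *)
Definition split_at R a : rel V := fun x y =>
  [&& R x y, ~~ [&& ~~ A x, A y, eqv R a x & eqv R a y] &
      ~~ [&& eqv R a (par x), eqv R a (par y) & A (par x) != A (par y)]].

(* The children of the new block are ordered by u and, on a tie, with A last,
   which creates no corner. *)
Definition merge_at R a b : rel V := fun x y =>
  [|| R x y, eqv R b x && eqv R a y,
      [&& eqv R a (par x), eqv R b (par y) & uo x < uo y] |
      [&& eqv R b (par x), eqv R a (par y) & uo x <= uo y]].

(** A vertex and its parent belong to different families only at [x0], and [x0], being nearest to
    the root within [A], is no child of the class of an element of [A]. *)
Lemma child_side R a x : valid R -> A a -> eqv R a (par x) ->
  (lvl x).+1 = lvl a /\ A (par x) = A x.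
Proof.
move=> vR Aa /andP[ax _]; have lx := lvl_child Aa (esym (valid_lvl vR ax)).
split=> //; apply/idP/idP => [/A_down //|Ax]; apply: A_up => //.
apply: contraTneq (A_le Aa) => xx0; rewrite -ltnNge -lx.
by rewrite xx0.
Qed.

(** * Cutting a merged corner *)

Section Split.
Variables (R : rel V) (a b : V).
Hypothesis vR : valid R.
Hypothesis ab_chosen : chosen R a b.
Hypothesis ba : R b a.

Let Aa : A a. Proof. by have /chosenP[/cornerP[]] := ab_chosen. Qed.
Let Ab : ~~ A b. Proof. by have /chosenP[/cornerP[]] := ab_chosen. Qed.
Let ab : R a b. Proof. by have /chosenP[/cornerP[]] := ab_chosen. Qed.
Let uab : uo a = uo b. Proof. by have /chosenP[/cornerP[]] := ab_chosen. Qed.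

Lemma split_sub : subrel (split_at R a) R.
Proof. by move=> x y /and3P[]. Qed.

Lemma split_total x y : lvl x = lvl y -> eqv R (par x) (par y) ->
  ~~ [&& eqv R a (par x), eqv R a (par y) & A (par x) != A (par y)] ->
  split_at R a x y || split_at R a y x.
Proof.
move=> lxy pxy nc; have nc' : ~~ [&& eqv R a (par y), eqv R a (par x) & A (par y) != A (par x)].
  by rewrite andbCA eq_sym.
rewrite /split_at nc nc' !andbT.
have [/and4P[nAx Ay ax ay]|_] := boolP [&& ~~ A x, A y, eqv R a x & eqv R a y].
  rewrite Ay (negPf nAx) /= andbF andbT /=; have /andP[rax rxa] := ax.
  by have /andP[ray rya] := ay; apply: valid_trans rya rax.
have [/and4P[nAy Ax ay ax]|_] := boolP [&& ~~ A y, A x, eqv R a y & eqv R a x].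
  rewrite andbT andbF orbF; have /andP[rax rxa] := ax.
  by have /andP[ray rya] := ay; apply: valid_trans rxa ray.
by rewrite !andbT; apply: (valid_total vR).
Qed.

Lemma split_same x y : A x = A y -> eqv R x y -> split_at R a x y.
Proof.
move=> Axy /andP[xy yx]; rewrite /split_at xy Axy; apply/and3P; split=> //.
  by apply/negP => /and4P[/negPf->].
apply/negP => /and3P[apx apy nA].
have lxy := valid_lvl vR xy.
have lpx : lvl (par x) = lvl a by rewrite (valid_lvl vR (andP apx).1).
have [Ax|nAx] := boolP (A x).
  have [exy|[px py]] := A_same_lvl Ax (etrans (esym Axy) Ax) lxy.
    by rewrite exy eqxx in nA.
  by rewrite px py in nA.
rewrite (negPf (contra (@A_down x) nAx)) in nA.
rewrite Axy in nAx.
by rewrite (negPf (contra (@A_down y) nAx)) in nA.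
Qed.

(** Such a pair could be lost only among the children of the class of [a], on a level that
    [chosen_lvl] excludes. *)
Lemma split_cross x y : A x -> ~~ A y -> eqv R x y -> split_at R a x y.
Proof.
move=> Ax Ay xy; have /andP[rxy ryx] := xy; rewrite /split_at rxy Ax /=.
apply/negP => /and3P[apx _ _].
have := chosen_lvl vR ab_chosen Ax Ay rxy (eqv_uo vR xy).
by rewrite (valid_lvl vR (andP apx).1) (A_lvl Ax) ltnn.
Qed.

Lemma split_eqv x y : eqv (split_at R a) x y =
  eqv R x y && ~~ [&& eqv R a x, eqv R a y & A x != A y].
Proof.
have [|xy] := boolP (eqv R x y); last first.
  by apply/negP => /andP[/split_sub r1 /split_sub r2]; case/negP: xy; apply/andP.
move=> xy; have yx : eqv R y x by rewrite eqv_sym.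
have [e|ne] := eqVneq (A x) (A y).
  by rewrite /eqv !split_same ?e //= !andbF.
rewrite /= andbT.
have [Ax|Ax] := boolP (A x).
  have Ay : ~~ A y by move: ne; rewrite Ax; case: (A y).
  rewrite /eqv split_cross //= /split_at Ax Ay /= (andP yx).1 /=.
  rewrite [X in _ && X](_ : _ = true) ?andbT; first by rewrite andbC.
  apply/negP => /and3P[_ apx _].
  have := chosen_lvl vR ab_chosen Ax Ay (andP xy).1 (eqv_uo vR xy).
  by rewrite (valid_lvl vR (andP apx).1) (A_lvl Ax) ltnn.
have Ay : A y by move: ne; rewrite (negPf Ax); case: (A y).
rewrite /eqv (split_cross Ay Ax yx) andbT /split_at Ax Ay /= (andP xy).1 /=.
rewrite [X in _ && X](_ : _ = true) ?andbT //.
apply/negP => /and3P[_ apx _].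
have := chosen_lvl vR ab_chosen Ay Ax (andP yx).1 (eqv_uo vR yx).
by rewrite (valid_lvl vR (andP apx).1) (A_lvl Ay) ltnn.
Qed.

Lemma split_valid : valid (split_at R a).
Proof.
split=> [x y /split_sub/(valid_lvl vR)|x y|x y lxy|y x z xy yz|x y xy|
         x y /split_sub/(valid_uo vR)] //.
- by case/and3P=> xy _ h; rewrite split_eqv (valid_par vR).
- by rewrite split_eqv => /andP[pxy h]; apply: split_total.
- have [rxy rxy1 rxy2] := and3P xy; have [ryz ryz1 ryz2] := and3P yz.
  have rxz := valid_trans vR rxy ryz.
  rewrite /split_at rxz /=; apply/andP; split; apply/negP.
    case/and4P=> nAx Az /andP[ax xa] /andP[az za].
    have ay : eqv R a y.
      by rewrite /eqv (valid_trans vR ax rxy) (valid_trans vR ryz za).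
    have [Ay|nAy] := boolP (A y).
      by case/negP: rxy1; rewrite nAx Ay ay /eqv ax xa.
    by case/negP: ryz1; rewrite nAy Az ay /eqv az za.
  case/and3P=> apx apz nA.
  have apy : eqv R a (par y) by apply: eqv_trans apx (valid_par vR rxy).
  move: rxy2 ryz2; rewrite apx apz apy /= !negbK => /eqP e1 /eqP e2.
  by rewrite e1 e2 eqxx in nA.
(* Here [x0] must be leftmost: if a vertex outside [A] stands to the left of a sibling in [A], that
   sibling is [x0], against [x0_first]. *)
- have rxy := valid_le0 vR xy; have pxy := le0_par xy.
  rewrite /split_at rxy pxy eqxx !andbF /= andbT; apply/negP => /and4P[nAx Ay ax ay].
  have [yx0|yx0] := eqVneq y x0; last first.
    by case/negP: nAx; apply: A_down; rewrite pxy; apply: A_up.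
  rewrite yx0 in xy ay; apply: (x0_first nAx xy).
  by rewrite -(eqv_uo vR ax) -(eqv_uo vR ay).
Qed.

Lemma split_chosen : chosen (split_at R a) a b.
Proof.
have /chosenP[cab mab] := ab_chosen.
apply/chosenP; split; last first.
  move=> c d cd; apply: mab; apply: corner_sub cd => //.
  - exact: split_valid.
  - exact: split_sub.
  - exact: split_same.
  - exact: split_cross.
apply/cornerP; split=> //; first by apply: split_cross; rewrite // /eqv ab.
have btw z : R a z -> R z b -> eqv R z a.
  by move=> az zb; rewrite /eqv az (valid_trans vR zb ba).
split=> z Az /split_sub az /split_sub zb.
  by apply: split_same; rewrite ?Aa //; apply: btw.
apply: split_same; first by rewrite (negPf Ab) (negPf Az).
by rewrite /eqv zb (valid_trans vR ba az).
Qed.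

Lemma split_unmerged : ~~ split_at R a b a.
Proof. by rewrite /split_at Ab Aa /eqv ab ba valid_refl // !andbF. Qed.

(** By [chosen_lvl], children of different families in the class of [a] compare by [uo], ties
    placing [A] last. This is the shuffle that [merge_at] restores. *)
Lemma split_merge x y : merge_at (split_at R a) a b x y = R x y.
Proof.
have eqa z : eqv (split_at R a) a z = eqv R a z && A z.
  by rewrite split_eqv eqv_refl // Aa; case: (eqv R a z); case: (A z).
have eqb z : eqv (split_at R a) b z = eqv R a z && ~~ A z.
  have e : eqv R b z = eqv R a z.
    by apply/idP/idP; apply: eqv_trans => //; rewrite /eqv ?ab ?ba.
  rewrite split_eqv (negPf Ab) e /eqv ab ba /=.
  by case: (R a z); case: (R z a); case: (A z).
rewrite /merge_at !eqa !eqb.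
have low p q : A p -> ~~ A q -> (lvl p).+1 = lvl a -> R p q -> uo p <> uo q.
  by move=> Ap Aq lp pq /(chosen_lvl vR ab_chosen Ap Aq pq); rewrite -lp ltnn.
apply/idP/idP; last first.
  move=> rxy; have uxy := valid_uo vR rxy.
  have [//|] := boolP (split_at R a x y); rewrite /split_at rxy /= negb_and !negbK.
  case/orP=> [/and4P[-> -> -> ->] //|/and3P[px py nA]]; rewrite px py /=.
  have [lx Apx] := child_side vR Aa px; have [ly Apy] := child_side vR Aa py.
  rewrite Apx Apy in nA *; case: (boolP (A x)) nA => [Ax|nAx].
    rewrite /= eq_sym eqb_id => nAy; rewrite nAy /= ltn_neqAle uxy !andbT.
    by apply/orP; right; apply/orP; left; apply/eqP; apply: low.
  by rewrite eq_sym eqbF_neg negbK => ->; rewrite uxy !orbT.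
case/or4P=> [/split_sub //|||].
- case/andP=> /andP[ax _] /andP[ay _].
  by apply: (valid_trans vR (andP ax).2 (andP ay).1).
- case/and3P=> /andP[px _] /andP[py _] lt.
  have [lx Apx] := child_side vR Aa px; have [ly Apy] := child_side vR Aa py.
  have /orP[//|/(valid_uo vR)] : R x y || R y x.
    apply: (valid_total vR); first by apply: succn_inj; rewrite lx.
    by apply: eqv_trans py => //; rewrite eqv_sym.
  by rewrite leqNgt lt.
case/and3P=> /andP[px nAx] /andP[py Ay] le.
have [lx Apx] := child_side vR Aa px; have [ly Apy] := child_side vR Aa py.
rewrite Apx in nAx; rewrite Apy in Ay.
have /orP[//|yx] : R x y || R y x.
  apply: (valid_total vR); first by apply: succn_inj; rewrite lx.
  by apply: eqv_trans py => //; rewrite eqv_sym.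
case: (low y x) => //; apply/eqP.
by rewrite eqn_leq le (valid_uo vR).
Qed.

End Split.

(** * Fusing an unmerged corner *)

Section Merge.
Variables (R : rel V) (a b : V).
Hypothesis vR : valid R.
Hypothesis ab_chosen : chosen R a b.
Hypothesis nba : ~~ R b a.

Let Aa : A a. Proof. by have /chosenP[/cornerP[]] := ab_chosen. Qed.
Let Ab : ~~ A b. Proof. by have /chosenP[/cornerP[]] := ab_chosen. Qed.
Let ab : R a b. Proof. by have /chosenP[/cornerP[]] := ab_chosen. Qed.
Let uab : uo a = uo b. Proof. by have /chosenP[/cornerP[]] := ab_chosen. Qed.
Let lab : lvl a = lvl b. Proof. exact: valid_lvl ab. Qed.

Let before_a z : A z -> R a z -> R z b -> R z a.
Proof. by have /chosenP[/cornerP[_ _ _ _ [h _]] _] := ab_chosen; apply: h. Qed.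
Let after_b z : ~~ A z -> R a z -> R z b -> R b z.
Proof. by have /chosenP[/cornerP[_ _ _ _ [_ h]] _] := ab_chosen; apply: h. Qed.

(** As long as [a] and [b] are apart, the class of [a] lies in [A] and that of [b] outside: an
    exception would, by the corner conditions, identify [a] with [b]. *)
Let clsa z : eqv R a z -> A z.
Proof.
case/andP=> az za; apply/idPn => nAz; case/negP: nba.
by apply: (valid_trans vR _ za); apply: after_b => //; apply: valid_trans za ab.
Qed.

Let clsb z : eqv R b z -> ~~ A z.
Proof.
case/andP=> bz zb; apply/negP => Az; case/negP: nba.
by apply: (valid_trans vR bz); apply: before_a => //; apply: valid_trans ab bz.
Qed.

Lemma merge_sub : subrel R (merge_at R a b).
Proof. by move=> x y xy; rewrite /merge_at xy. Qed.

Lemma eqv_ab x : ~~ (eqv R a x && eqv R b x).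
Proof. by apply/negP => /andP[/clsa ax /clsb]; rewrite ax. Qed.

Let child_b x : eqv R b (par x) -> (lvl x).+1 = lvl a /\ ~~ A x.
Proof.
move=> bx; have lx := lvl_child Aa (etrans (esym (valid_lvl vR (andP bx).1)) (esym lab)).
split=> //; apply: contra (clsb bx) => Ax; apply: A_up => //.
apply: contraTneq (A_le Aa) => xx0; rewrite -ltnNge -lx.
by rewrite xx0.
Qed.

Let child_a x : eqv R a (par x) -> (lvl x).+1 = lvl a /\ A x.
Proof.
move=> ax; have [lx e] := child_side vR Aa ax; split=> //.
by rewrite -e; apply: clsa.
Qed.

Let eqv_abF x : eqv R a x -> eqv R b x -> False.
Proof. by move=> ax bx; have := eqv_ab x; rewrite ax bx. Qed.

Let eqv_lvl c x : eqv R c x -> lvl x = lvl c.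
Proof. by case/andP=> /(valid_lvl vR). Qed.

Let not_child_a x : lvl x = lvl a -> eqv R a (par x) -> False.
Proof. by move=> lx /child_a[+ _]; rewrite lx => /esym/n_Sn. Qed.

Let not_child_b x : lvl x = lvl a -> eqv R b (par x) -> False.
Proof. by move=> lx /child_b[+ _]; rewrite lx => /esym/n_Sn. Qed.

Let rel_childF x y : R x y -> eqv R a (par x) -> eqv R b (par y) -> False.
Proof.
move=> /(valid_par vR) pxy ax bx; apply: (eqv_abF ax).
by apply: eqv_trans bx _ => //; rewrite eqv_sym.
Qed.

Let rel_childF' x y : R x y -> eqv R b (par x) -> eqv R a (par y) -> False.
Proof.
move=> /(valid_par vR) pxy bx ay; apply: (eqv_abF ay).
exact: eqv_trans bx pxy.
Qed.

(** Only the classes of [a] and [b] are joined. A child of one never becomes equivalent to a child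
    of the other, because one of the two comparisons of [uo] in [merge_at] is strict. *)
Lemma merge_eqv x y : eqv (merge_at R a b) x y =
  [|| eqv R x y, eqv R a x && eqv R b y | eqv R b x && eqv R a y].
Proof.
have half p q : eqv R a p -> eqv R b q -> merge_at R a b p q && merge_at R a b q p.
  move=> ap bq; rewrite /merge_at ap bq !orbT andbT.
  by rewrite (valid_trans vR (andP ap).2) // (valid_trans vR ab (andP bq).1).
apply/idP/idP; last first.
  case/or3P=> [/andP[xy yx]|/andP[]|/andP[]]; first by rewrite /eqv !merge_sub.
    exact: half.
  by move=> bx ay; rewrite eqv_sym; apply: half.
case/andP=> /or4P[xy|/andP[bx ay] _|/and3P[ax bx u]|/and3P[bx ax u]].
- case/or4P=> [yx|/andP[-> ->]|/and3P[ay bx _]|/and3P[by_ ax _]];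
    rewrite ?orbT //; first by rewrite /eqv xy yx.
    by case: (rel_childF' xy bx ay).
  by case: (rel_childF xy ax by_).
- by rewrite bx ay !orbT.
- case/or4P=> [yx|/andP[by_ ax']|/and3P[ay _ _]|/and3P[_ _]].
  + by case: (rel_childF' yx bx ax).
  + by case: (not_child_b (etrans (eqv_lvl by_) (esym lab)) bx).
  + by case: (eqv_abF ay bx).
  + by rewrite leqNgt u.
case/or4P=> [yx|/andP[by_ ax']|/and3P[_ _]|/and3P[bx' _ _]].
- by case: (rel_childF yx ax bx).
- by case: (not_child_a (etrans (eqv_lvl by_) (esym lab)) ax).
- by rewrite ltnNge u.
by case: (eqv_abF ax bx').
Qed.

Lemma merge_valid : valid (merge_at R a b).
Proof.
have pab := valid_par vR ab.
split=> [x y|x y|x y lxy|y x z|x y xy|x y].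
- case/or4P=> [/(valid_lvl vR)//|/andP[bx ay]|/and3P[ax bx _]|/and3P[bx ax _]].
  + by rewrite (eqv_lvl bx) (eqv_lvl ay).
  + by apply: succn_inj; rewrite (child_a ax).1 (child_b bx).1.
  + by apply: succn_inj; rewrite (child_a ax).1 (child_b bx).1.
- rewrite merge_eqv.
  case/or4P=> [/(valid_par vR)->//|/andP[bx ay]|/and3P[-> -> _]|/and3P[-> -> _]];
    rewrite ?orbT //.
  apply/orP; left; apply: eqv_trans (valid_par vR (andP bx).2) _ => //.
  by apply: eqv_trans (valid_par vR (andP ay).1) => //; rewrite eqv_sym.
- rewrite merge_eqv => /or3P[/(valid_total vR lxy)/orP[]|/andP[ax bx]|/andP[bx ax]].
  + by move=> /merge_sub->.
  + by move=> /merge_sub->; rewrite orbT.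
  + have [lt|le] := ltnP (uo x) (uo y).
      by rewrite /merge_at ax bx lt !orbT.
    by rewrite orbC /merge_at ax bx le !orbT.
  + have [lt|le] := ltnP (uo y) (uo x).
      by rewrite orbC /merge_at ax bx lt !orbT.
    by rewrite /merge_at ax bx le !orbT.
- move=> /or4P[xy|/andP[bx ay]|/and3P[ax bx u]|/and3P[bx ax u]].
  + case/or4P=> [yz|/andP[by_ az]|/and3P[ay bz u]|/and3P[by_ az u]].
    * by apply: merge_sub; apply: valid_trans xy yz.
    (* Here [x] precedes [b] and is comparable with [a]: either it precedes [a], or it lies between
       [a] and [b], where the corner conditions place it in the class of one of them. *)
    * have xb := valid_trans vR xy (andP by_).2.
      have pax : eqv R (par a) (par x).
        by apply: eqv_trans pab _ => //; rewrite eqv_sym; apply: valid_par.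
      have lax : lvl a = lvl x by rewrite (valid_lvl vR xb).
      have /orP[ax|xa] := valid_total vR lax pax; last first.
        by apply: merge_sub; apply: valid_trans xa (andP az).1.
      have [Ax|nAx] := boolP (A x).
        by apply: merge_sub; apply: valid_trans (before_a Ax ax xb) (andP az).1.
      by rewrite /merge_at az /eqv xb after_b ?orbT.
    * apply/or4P; apply: Or43; rewrite bz (leq_ltn_trans (valid_uo vR xy) u) !andbT.
      by apply: eqv_trans ay _ => //; rewrite eqv_sym; apply: valid_par.
    * apply/or4P; apply: Or44; rewrite az (leq_trans (valid_uo vR xy) u) !andbT.
      by apply: eqv_trans by_ _ => //; rewrite eqv_sym; apply: valid_par.
  + case/or4P=> [yz|/andP[by_ _]|/and3P[py _ _]|/and3P[py _ _]].
    * have az := valid_trans vR (andP ay).1 yz.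
      have pbz : eqv R (par b) (par z).
        by apply: eqv_trans (valid_par vR az) => //; rewrite eqv_sym.
      have lbz : lvl b = lvl z by rewrite -(valid_lvl vR az).
      have bz_case : R b z || R z b := valid_total vR lbz pbz.
      have [bz|nbz] := boolP (R b z).
        by apply: merge_sub; apply: valid_trans (andP bx).2 bz.
      rewrite (negPf nbz) /= in bz_case.
      have [Az|nAz] := boolP (A z); last by rewrite after_b in nbz.
      by rewrite /merge_at bx /eqv az before_a ?orbT.
    * by case: (eqv_abF ay by_).
    * by case: (not_child_a (eqv_lvl ay) py).
    * by case: (not_child_b (eqv_lvl ay) py).
  + case/or4P=> [yz|/andP[by_ _]|/and3P[py _ _]|/and3P[_ az u']].
    * apply/or4P; apply: Or43; rewrite ax (leq_trans u (valid_uo vR yz)) !andbT.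
      by apply: eqv_trans bx _ => //; apply: valid_par.
    * by case: (not_child_b (etrans (eqv_lvl by_) (esym lab)) bx).
    * by case: (eqv_abF py bx).
    * have pxz : eqv R (par x) (par z) by apply: eqv_trans az => //; rewrite eqv_sym.
      have lxz : lvl x = lvl z by apply: succn_inj; rewrite (child_a ax).1 (child_a az).1.
      have /orP[/merge_sub//|/(valid_uo vR)] := valid_total vR lxz pxz.
      by rewrite leqNgt (leq_trans u u').
  case/or4P=> [yz|/andP[by_ _]|/and3P[_ az u']|/and3P[py _ _]].
  + apply/or4P; apply: Or44; rewrite bx (leq_trans u (valid_uo vR yz)) !andbT.
    by apply: eqv_trans ax _ => //; apply: valid_par.
  + by case: (not_child_a (etrans (eqv_lvl by_) (esym lab)) ax).
  + have pxz : eqv R (par x) (par z) by apply: eqv_trans az => //; rewrite eqv_sym.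
    have lxz : lvl x = lvl z by apply: succn_inj; rewrite (child_b bx).1 (child_b az).1.
    have /orP[/merge_sub//|/(valid_uo vR)] := valid_total vR lxz pxz.
    by rewrite leqNgt (leq_ltn_trans u u').
  + by case: (eqv_abF ax py).
- by apply: merge_sub; apply: valid_le0.
case/or4P=> [/(valid_uo vR)//|/andP[bx ay]|/and3P[_ _ /ltnW//]|/and3P[]//].
by rewrite -(eqv_uo vR bx) -(eqv_uo vR ay) uab.
Qed.

Let same_lvl x y : lvl x = lvl a -> merge_at R a b x y ->
  R x y \/ eqv R b x /\ eqv R a y.
Proof.
move=> lx /or4P[->|/andP[-> ->]|/and3P[ax _ _]|/and3P[bx _ _]]; [by left|by right| |].
  by case: (not_child_a lx ax).
by case: (not_child_b lx bx).
Qed.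

Lemma merge_chosen : chosen (merge_at R a b) a b.
Proof.
have /chosenP[cab mab] := ab_chosen; have vM := merge_valid.
apply/chosenP; split.
  apply/cornerP; split=> //; first exact: merge_sub.
  have aF z : merge_at R a b a z -> R a z.
    by case/same_lvl=> // -[/andP[ba _]]; case/negP: nba.
  split=> z Az az zb; have lz := esym (valid_lvl vM az).
    case: (same_lvl lz zb) => [zb'|[bz _]]; last by rewrite (negPf (clsb bz)) in Az.
    by apply: merge_sub; apply: before_a => //; apply: aF.
  case: (same_lvl lz zb) => [zb'|[/andP[bz _] _]]; last exact: merge_sub.
  by apply: merge_sub; apply: after_b => //; apply: aF.
move=> c d /cornerP[Ac Ad cd ucd [hA hB]]; rewrite leqNgt; apply/negP => lt.
(* A corner of smaller key is impossible on a smaller level, where the tie rule adds no pair with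
   [A] first and equal images; on the level of [a] it would have been a corner of [R] already. *)
have /= := key_lvl (ltnW lt); rewrite leq_eqVlt => /orP[/eqP lc|]; last first.
  move=> ltl; have rcd : R c d.
    case/or4P: cd => [//|/andP[bc _]|/and3P[_ _]|/and3P[bc _ _]].
    - by rewrite (eqv_lvl bc) lab ltnn in ltl.
    - by rewrite ucd ltnn.
    - by have [_] := child_b bc; rewrite Ac.
  by have := chosen_lvl vR ab_chosen Ac Ad rcd ucd; rewrite leqNgt ltl.
have rcd : R c d.
  by case: (same_lvl lc cd) => // -[/clsb]; rewrite Ac.
have : corner R c d.
  apply/cornerP; split=> //; split=> z Az cz zd.
    have lz : lvl z = lvl a by rewrite -(valid_lvl vR cz).
    case: (same_lvl lz (hA z Az (merge_sub cz) (merge_sub zd))) => // -[/clsb].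
    by rewrite Az.
  have ld : lvl d = lvl a by rewrite -(valid_lvl vR rcd).
  case: (same_lvl ld (hB z Az (merge_sub cz) (merge_sub zd))) => // -[_ /clsa].
  by rewrite (negPf Az).
by move/mab; rewrite leqNgt lt.
Qed.

Lemma merge_merged : merge_at R a b b a.
Proof. by rewrite /merge_at !eqv_refl //= orbT. Qed.

Lemma merge_split x y : split_at (merge_at R a b) a x y = R x y.
Proof.
have eqa z : eqv (merge_at R a b) a z = eqv R a z || eqv R b z.
  have nba' : eqv R b a = false by rewrite /eqv (negPf nba).
  by rewrite merge_eqv eqv_refl //= nba' orbF.
rewrite /split_at !eqa; apply/idP/idP => [/and3P[]|xy].
  case/or4P=> [//|/andP[bx ay]|/and3P[ax bx u]|/and3P[bx ax u]].
  - by rewrite bx ay (clsa ay) (clsb bx) orbT.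
  - by rewrite ax bx (clsa ax) (negPf (clsb bx)) orbT.
  - by rewrite ax bx (clsa ax) (negPf (clsb bx)) orbT.
rewrite merge_sub //=; apply/andP; split; apply/negP.
  case/and4P=> nAx Ay /orP[/clsa|/andP[bx _]]; first by rewrite (negPf nAx).
  case/orP=> [/andP[_ ya]|/clsb]; last by rewrite Ay.
  by case/negP: nba; apply: valid_trans bx (valid_trans vR xy ya).
case/and3P=> /orP[ax|bx] /orP[ay|by_].
- by rewrite (clsa ax) (clsa ay).
- by case: (rel_childF xy ax by_).
- by case: (rel_childF' xy bx ay).
- by rewrite (negPf (clsb bx)) (negPf (clsb by_)).
Qed.

End Merge.

(** * The measure that makes the matching acyclic *)

Definition same_pairs R : {set V * V} :=
  [set p | (A p.1 == A p.2) && eqv R p.1 p.2].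

Definition inversion_pairs R : {set V * V} :=
  [set p | [&& A p.1, ~~ A p.2, R p.1 p.2, ~~ R p.2 p.1 & uo p.1 == uo p.2]].

(* Lexicographic, since #|inversion_pairs R| < #|{: V * V}|.+1. *)
Definition potential R : nat :=
  #|same_pairs R| * #|{: V * V}|.+1 + #|inversion_pairs R|.

Section Potential.
Variables (R1 R2 : rel V) (a b a2 b2 : V).
Hypothesis v1 : valid R1.
Hypothesis ab_chosen : chosen R1 a b.
Hypothesis ba : R1 b a.
Hypothesis v2 : valid R2.
Hypothesis R21 : subrel R2 R1.
(** [R2] cuts at most one class of [R1], and into two parts: any two separated pairs have their ends
    in the same two classes of [R2]. *)
Hypothesis cov : forall x y z t, eqv R1 x y -> ~~ eqv R2 x y ->
  eqv R1 z t -> ~~ eqv R2 z t ->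
  eqv R2 x z /\ eqv R2 y t \/ eqv R2 x t /\ eqv R2 y z.
Hypothesis ab2_chosen : chosen R2 a2 b2.
Hypothesis nba2 : ~~ R2 b2 a2.
Hypothesis neq : ~ (forall x y, R2 x y = split_at R1 a x y).

Let Aa : A a. Proof. by have /chosenP[/cornerP[]] := ab_chosen. Qed.
Let Ab : ~~ A b. Proof. by have /chosenP[/cornerP[]] := ab_chosen. Qed.
Let ab : R1 a b. Proof. by have /chosenP[/cornerP[]] := ab_chosen. Qed.
Let uab : uo a = uo b. Proof. by have /chosenP[/cornerP[]] := ab_chosen. Qed.

Let eqv21 x y : eqv R2 x y -> eqv R1 x y.
Proof. by case/andP=> /R21 xy /R21 yx; apply/andP. Qed.

(** The old inversions survive by [chosen_lvl], and (a, b) is a new one. *)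
Lemma inversion_pairs_split : inversion_pairs R1 \proper inversion_pairs (split_at R1 a).
Proof.
rewrite properE; apply/andP; split; last first.
  apply/subsetPn; exists (a, b); last by rewrite inE /= ba !andbF.
  rewrite inE /= Aa Ab uab eqxx (split_unmerged v1 ab_chosen) // andbT andbT /=.
  by apply: (split_cross v1 ab_chosen) => //; rewrite /eqv ab.
apply/subsetP => -[x y]; rewrite !inE /= => /and5P[Ax Ay xy nyx /eqP uxy].
rewrite Ax Ay uxy eqxx andbT /= /split_at xy Ax (negPf nyx) /= andbT.
apply/negP => /and3P[apx _ _].
have := chosen_lvl v1 ab_chosen Ax Ay xy uxy.
by rewrite (valid_lvl v1 (andP apx).1) (A_lvl Ax) ltnn.
Qed.

(** [split_at] keeps every equivalent pair within a family, so [R2] cannot have more of them. If it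
    has as many, it cuts by family only. When no separated pair has [A] first, [R2] has no inversion
    that [R1] lacks. When one has, [R2] either spares the class of [a] and is then an upper element,
    or equals [split_at R1 a]; both are excluded. *)
Lemma potential_lt : potential R2 < potential (split_at R1 a).
Proof.
have sub : same_pairs R2 \subset same_pairs (split_at R1 a).
  apply/subsetP => -[x y]; rewrite !inE /= => /andP[/eqP e /eqv21 exy].
  by rewrite e eqxx /eqv !(split_same _ v1) // eqv_sym.
have bound R : #|inversion_pairs R| < #|{: V * V}|.+1 by rewrite ltnS max_card.
have [lt|ge] := ltnP #|same_pairs R2| #|same_pairs (split_at R1 a)|.
  rewrite /potential; apply: leq_trans (leq_addr _ _).
  apply: leq_trans (_ : #|same_pairs R2|.+1 * #|{: V * V}|.+1 <= _).
    by rewrite mulSn addnC ltn_add2r.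
  by rewrite leq_mul2r lt orbT.
have esame : same_pairs R2 = same_pairs (split_at R1 a).
  by apply/eqP; rewrite eqEcard sub.
have same x y : A x = A y -> eqv R1 x y -> eqv R2 x y.
  move=> e exy; have : (x, y) \in same_pairs R2.
    rewrite esame inE /= e eqxx /eqv !(split_same _ v1) //.
    by rewrite eqv_sym.
  by rewrite inE => /andP[].
rewrite /potential -esame ltn_add2l.
(* The mixed pairs that [R2] separates with [A] first. *)
pose D (p : V * V) := [&& A p.1, ~~ A p.2, eqv R1 p.1 p.2, ~~ eqv R2 p.1 p.2 & R2 p.1 p.2].
case: (pickP D) => [[p q]|noD]; last first.
  apply: leq_ltn_trans (proper_card inversion_pairs_split).
  apply/subset_leq_card/subsetP => -[x y]; rewrite !inE /=.
  case/and5P=> Ax Ay xy nyx uxy; rewrite Ax Ay R21 //= uxy andbT.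
  apply/negP => yx; have := noD (x, y).
  by rewrite /D /= Ax Ay xy /eqv (negPf nyx) andbF yx R21.
rewrite /D /= => /and5P[Ap Aq pq1 pq2 Rpq] {D}.
have cross x y : A x -> ~~ A y -> eqv R1 x y -> R2 x y.
  move=> Ax Ay xy; have [/andP[]//|nxy] := boolP (eqv R2 x y).
  case: (cov xy nxy pq1 pq2) => [[/andP[xp _] /andP[_ qy]]|[xq _]].
    exact: (valid_trans v2 xp (valid_trans v2 Rpq qy)).
  have px : eqv R2 p x.
    apply: same; first by rewrite Ap Ax.
    by apply: (eqv_trans v1 pq1); rewrite eqv_sym; apply: eqv21.
  by case/negP: pq2; apply: eqv_trans px xq.
(* If [a] and [b] stay together, (a, b) is still the chosen corner by [corner_sub] and is merged in
   [R2], against [nba2]. *)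
have [ab_2|nab] := boolP (eqv R2 a b).
  have /andP[ab2 ba2] := ab_2.
  have : chosen R2 a b.
    have /chosenP[_ mab] := ab_chosen; apply/chosenP; split; last first.
      move=> c d cd; apply: mab; apply: corner_sub cd => //.
      by move=> x y e xy; have /andP[] := same _ _ e xy.
    apply/cornerP; split=> //; split=> z Az az zb.
      exact: valid_trans zb ba2.
    exact: valid_trans ba2 az.
  by move/(chosen_uniq ab2_chosen) => [ea eb]; have := nba2; rewrite ea eb ba2.
have eqab : eqv R1 a b by rewrite /eqv ab.
have apart x y : A x -> ~~ A y -> eqv R1 a x -> eqv R1 a y -> ~~ eqv R2 x y.
  move=> Ax Ay ax ay; apply: contra nab => xy.
  apply: (eqv_trans v2 (same _ _ _ ax)); first by rewrite Aa Ax.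
  apply: (eqv_trans v2 xy); apply: same; first by rewrite (negPf Ay) (negPf Ab).
  by apply: eqv_trans eqab => //; rewrite eqv_sym.
have near x y : eqv R1 x y -> ~~ eqv R2 x y -> eqv R1 a x /\ eqv R1 a y.
  move=> xy nxy; case: (cov xy nxy eqab nab) => -[/eqv21 e1 /eqv21 e2].
    split; first by rewrite eqv_sym.
    by apply: (eqv_trans v1 eqab); rewrite eqv_sym.
  split; last by rewrite eqv_sym.
  by apply: (eqv_trans v1 eqab); rewrite eqv_sym.
case: neq => x y; apply/idP/idP => [xy|/and3P[xy n1 n2]].
  rewrite /split_at R21 //=; apply/andP; split; apply/negP.
    case/and4P=> Ax Ay ax ay; have yx : eqv R1 y x.
      by apply: eqv_trans ax => //; rewrite eqv_sym.
    by have := apart _ _ Ay Ax ay ax; rewrite /eqv xy cross.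
  case/and3P=> ax ay; have pxy := valid_par v2 xy.
  have [Ax|Ax] := boolP (A (par x)); have [Ay|Ay] := boolP (A (par y)) => // _.
    by have := apart _ _ Ax Ay ax ay; rewrite pxy.
  by have := apart _ _ Ay Ax ay ax; rewrite eqv_sym pxy.
have pxy : eqv R2 (par x) (par y).
  have pxy1 := valid_par v1 xy; apply: contraR n2 => npxy.
  have [-> ->] := near _ _ pxy1 npxy; apply: contra npxy => /eqP e.
  exact: same.
have /orP[//|yx] := valid_total v2 (valid_lvl v1 xy) pxy.
have xy1 : eqv R1 x y by rewrite /eqv xy R21.
have [|nxy] := boolP (eqv R2 x y); first by case/andP.
have [ax ay] := near _ _ xy1 nxy; rewrite ax ay !andbT in n1.
have [Ax|Ax] := boolP (A x); have [Ay|Ay] := boolP (A y).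
- by case/negP: nxy; apply: same => //; rewrite Ax Ay.
- exact: cross.
- by rewrite Ax Ay in n1.
by case/negP: nxy; apply: same => //; rewrite (negPf Ax) (negPf Ay).
Qed.

End Potential.

Lemma corner_ext R R' a b : R =2 R' -> corner R a b = corner R' a b.
Proof.
move=> e; rewrite /corner e; do 4!congr (_ && _).
by congr (_ && _); apply: eq_forallb => z; rewrite !e.
Qed.

Lemma chosen_ext R R' a b : R =2 R' -> chosen R a b = chosen R' a b.
Proof.
move=> e; rewrite /chosen (corner_ext _ _ e); congr (_ && _).
by apply: eq_forallb => p; rewrite (corner_ext _ _ e).
Qed.

Lemma potential_ext R R' : R =2 R' -> potential R = potential R'.
Proof.
move=> e; rewrite /potential.
have -> : same_pairs R = same_pairs R' by apply/setP => p; rewrite !inE /eqv !e.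
by have -> : inversion_pairs R = inversion_pairs R' by apply/setP => p; rewrite !inE !e.
Qed.

(** Marks the coarser member of a matched pair: both members have the same chosen corner, and only
    in this one do its ends form one class. *)
Definition merged_at_corner R := [exists p : V * V, chosen R p.1 p.2 && R p.2 p.1].

Lemma upperE R a b : chosen R a b -> merged_at_corner R = R b a.
Proof.
move=> ab; apply/existsP/idP => [[[c d] /= /andP[cd dc]]|ba].
  by case: (chosen_uniq ab cd) => -> ->.
by exists (a, b); rewrite /= ab.
Qed.

(** Recording both formulas makes each member determine the other. They are pointwise equalities
    because factorizations realize preorders only up to these. *)
Definition linked R R' := exists a b,
  [/\ chosen R a b, R b a, chosen R' a b, ~~ R' b a &
      R' =2 split_at R a /\ R =2 merge_at R' a b].

Lemma linked_upper R R' : linked R R' -> merged_at_corner R /\ ~~ merged_at_corner R'.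
Proof. by case=> a [b [ab ba ab' nba' _]]; rewrite (upperE ab) (upperE ab'). Qed.

Lemma linked_fun R R1 R2 : linked R R1 -> linked R R2 -> R1 =2 R2.
Proof.
case=> a [b [ab _ _ _ [e1 _]]] [a' [b' [ab' _ _ _ [e2 _]]]] x y.
by case: (chosen_uniq ab ab') e1 => -> _ ->; rewrite e2.
Qed.

Lemma linked_inj R R1 R2 : linked R1 R -> linked R2 R -> R1 =2 R2.
Proof.
case=> a [b [_ _ ab _ [_ e1]]] [a' [b' [_ _ ab' _ [_ e2]]]] x y.
by case: (chosen_uniq ab ab') e1 => -> -> ->; rewrite e2.
Qed.

Lemma linked_sub R R' : linked R R' -> subrel R' R.
Proof. by case=> a [b [_ _ _ _ [e _]]] x y; rewrite e => /split_sub. Qed.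

Lemma linked_down R : valid R -> merged_at_corner R ->
  exists2 R', valid R' & forall R'', R'' =2 R' -> linked R R''.
Proof.
move=> vR; have [a [b ab]] := chosen_exists vR; rewrite (upperE ab) => ba.
exists (split_at R a); first exact: split_valid ab.
move=> R'' e; exists a, b; split=> //.
- by rewrite (chosen_ext _ _ e); apply: split_chosen.
- by rewrite e; apply: split_unmerged ab ba.
by split=> // x y; rewrite -(split_merge vR ab ba) /merge_at /eqv !e.
Qed.

Lemma linked_up R' : valid R' -> ~~ merged_at_corner R' ->
  exists2 R, valid R & forall R'', R'' =2 R -> linked R'' R'.
Proof.
move=> vR; have [a [b ab]] := chosen_exists vR; rewrite (upperE ab) => nba.
exists (merge_at R' a b); first exact: merge_valid ab nba.
move=> R'' e; exists a, b; split=> //.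
- by rewrite (chosen_ext _ _ e); apply: merge_chosen.
- by rewrite e; exact: merge_merged.
by split=> // x y; rewrite -(merge_split vR ab nba) /split_at /eqv !e.
Qed.

Lemma linked_neq R R' : linked R R' ->
  exists a b, eqv R a b /\ ~~ eqv R' a b.
Proof.
case=> a [b [/chosenP[/cornerP[_ _ ab _ _] _] ba _ nba' _]].
by exists a, b; rewrite /eqv ab ba (negPf nba') andbF.
Qed.

Lemma linked_cover R R' x y z t : valid R -> linked R R' ->
  eqv R x y -> ~~ eqv R' x y -> eqv R z t -> ~~ eqv R' z t ->
  eqv R' x z /\ eqv R' y t \/ eqv R' x t /\ eqv R' y z.
Proof.
move=> vR [a [b [ab ba _ _ [e _]]]].
have eqvE p q : eqv R' p q = eqv (split_at R a) p q by rewrite /eqv !e.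
rewrite !eqvE !(split_eqv vR ab) => -> + -> +; rewrite /= !negbK.
case/and3P=> ax ay xy /and3P[az at_ zt].
have cls p q : eqv R a p -> eqv R a q -> eqv R p q.
  by move=> ap aq; apply: eqv_trans aq => //; rewrite eqv_sym.
rewrite (cls x z) // (cls y t) // (cls x t) // (cls y z) // ax ay az at_ /=.
by move: xy zt; case: (A x); case: (A y); case: (A z); case: (A t) => //=; auto.
Qed.

Lemma linked_potential R1 R0 R2 : valid R1 -> linked R1 R0 -> valid R2 ->
  subrel R2 R1 ->
  (forall x y z t, eqv R1 x y -> ~~ eqv R2 x y -> eqv R1 z t -> ~~ eqv R2 z t ->
    eqv R2 x z /\ eqv R2 y t \/ eqv R2 x t /\ eqv R2 y z) ->
  ~~ merged_at_corner R2 -> ~ (R2 =2 R0) -> potential R2 < potential R0.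
Proof.
move=> v1 [a [b [ab ba _ _ [e _]]]] v2 sub cov; have [c [d cd]] := chosen_exists v2.
rewrite (upperE cd) => ndc ne; rewrite (potential_ext e).
by apply: (potential_lt v1 ab ba v2 sub cov cd ndc) => eq; apply: ne => x y; rewrite e.
Qed.

End Relations.

(** * Factorizations as preorders *)

Section Vertices.
Variable n : nat.
Implicit Types tau rho sigma : tree n.

Definition vx tau := {k : 'I_n.+1 & 'I_(lev tau k)}.

Definition vertex_at tau k (x : 'I_(lev tau k)) : vx tau :=
  Tagged (fun k => 'I_(lev tau k)) x.

Definition lvl tau (x : vx tau) : nat := tag x.
Definition pos tau (x : vx tau) : nat := tagged x.

(* The root is its own parent. *)
Definition par tau (x : vx tau) : vx tau :=
  oapp (fun j : 'I_n => oapp (fun y => vertex_at (edge (i := j) y)) x (insub (pos x)))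
    x (insub (lvl x)).

Definition hmap tau sigma (u : hom tau sigma) (x : vx tau) : vx sigma :=
  vertex_at (u (tag x) (tagged x)).

Definition sib tau (x y : vx tau) : bool :=
  [&& lvl x == lvl y, par x == par y & pos x <= pos y].

Lemma vx_inj tau (x y : vx tau) : lvl x = lvl y -> pos x = pos y -> x = y.
Proof.
case: x y => [k x] [l y]; rewrite /lvl /pos /= => /val_inj e.
by case: _ / e y => y /val_inj ->.
Qed.

Lemma par_lo tau j (y : 'I_(lev tau (lo j))) : par (vertex_at y) = vertex_at (edge y).
Proof. by rewrite /par /lvl /pos /= (valK j) /= valK. Qed.

Variant vx_spec tau : vx tau -> Prop :=
  | VxLo j (y : 'I_(lev tau (lo j))) : vx_spec (vertex_at y)
  | VxRoot (y : 'I_(lev tau ord_max)) : vx_spec (vertex_at y).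

Lemma vxP tau (x : vx tau) : vx_spec x.
Proof.
case: x => k x; have [e|ne] := eqVneq k ord_max.
  by rewrite e in x *; constructor.
have lt : k < n by rewrite ltn_neqAle -ltnS ltn_ord andbT.
have e : k = lo (Ordinal lt) by apply: val_inj.
by rewrite e in x *; constructor.
Qed.

Lemma par_root tau (y : 'I_(lev tau ord_max)) : par (vertex_at y) = vertex_at y.
Proof. by rewrite /par insubF //= ltnn. Qed.

Lemma lvl_lt tau (x : vx tau) : lvl x < n -> lvl (par x) = (lvl x).+1.
Proof. by case/vxP: x => [j y _|y]; rewrite ?par_lo // /lvl /= ltnn. Qed.

Lemma lvl_le tau (x : vx tau) : lvl x <= n.
Proof. by rewrite -ltnS ltn_ord. Qed.

Lemma root_uniq tau (x y : vx tau) : lvl x = n -> lvl y = n -> x = y.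
Proof.
have root_pos z : lvl z = n -> pos z = 0 by case/vxP: z => [j z|z _] /=;
  [rewrite /lvl /= => e; have := ltn_ord j; rewrite e ltnn | exact: root_eq0].
by move=> ex ey; apply: vx_inj; rewrite ?ex ?ey // !root_pos.
Qed.

Lemma par_ge tau (x : vx tau) : lvl x = n -> par x = x.
Proof.
case/vxP: x => [j y|y _]; last exact: par_root.
by rewrite /lvl /= => e; have := ltn_ord j; rewrite e ltnn.
Qed.

Lemma lvl_par tau (x y : vx tau) : lvl x = lvl y -> lvl (par x) = lvl (par y).
Proof.
have := lvl_le x; rewrite leq_eqVlt => /orP[/eqP e exy|lt exy].
  by rewrite (root_uniq (etrans (esym exy) e) e).
by rewrite !lvl_lt // -exy.
Qed.

Lemma lvl_hmap tau sigma (u : hom tau sigma) x : lvl (hmap u x) = lvl x.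
Proof. by []. Qed.

Lemma hmap_par tau sigma (u : hom tau sigma) x : hmap u (par x) = par (hmap u x).
Proof.
case/vxP: x => [j y|y]; last by rewrite par_root par_ge.
by rewrite par_lo {1}/hmap /= hom_edge -par_lo.
Qed.

Lemma hmap_comp tau rho sigma (u : hom rho sigma) (v : hom tau rho) x :
  hmap (comp_hom u v) x = hmap u (hmap v x).
Proof. by rewrite /hmap /= comp_homE. Qed.

Lemma hmap_id tau x : hmap (id_hom tau) x = x.
Proof. by case: x => k x; rewrite /hmap /= id_homE. Qed.

Lemma hmap_ext tau sigma (u v : hom tau sigma) : hmap u =1 hmap v -> u = v.
Proof.
move=> e; apply: hom_ext => i x; apply: val_inj.
by have := congr1 (@pos sigma) (e (vertex_at x)).
Qed.

Lemma hmap_surj tau sigma (u : hom tau sigma) y : exists x, hmap u x = y.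
Proof.
case: y => k y; have [x ux] := hom_surj u y.
by exists (vertex_at x); rewrite /hmap /= ux.
Qed.

Lemma comp_hom_inj tau rho sigma (u u' : hom rho sigma) (v : hom tau rho) :
  comp_hom u v = comp_hom u' v -> u = u'.
Proof.
move=> e; apply: hmap_ext => y; have [x <-] := hmap_surj v y.
by rewrite -!hmap_comp e.
Qed.

Lemma comp_homid tau sigma (u : hom tau sigma) : comp_hom u (id_hom tau) = u.
Proof. by apply: hmap_ext => x; rewrite hmap_comp hmap_id. Qed.

Lemma comp_idhom tau sigma (u : hom tau sigma) : comp_hom (id_hom sigma) u = u.
Proof. by apply: hmap_ext => x; rewrite hmap_comp hmap_id. Qed.

Lemma sib_hmap tau sigma (u : hom tau sigma) x y : sib x y -> sib (hmap u x) (hmap u y).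
Proof.
case/and3P=> /eqP lxy /eqP pxy xy; rewrite /sib !lvl_hmap lxy eqxx -!hmap_par pxy eqxx /=.
case/vxP: x lxy pxy xy => [j x|x] lxy.
  case/vxP: y lxy => [k y|y] lxy.
    have e : j = k by apply: val_inj.
    case: _ / e y lxy => y lxy.
    rewrite !par_lo => /(congr1 (@pos tau)) /val_inj exy xy.
    exact: hom_mono.
  by move: lxy; rewrite /lvl /= => e; have := ltn_ord j; rewrite e ltnn.
move=> _ _; suff -> : y = vertex_at x by [].
by apply: root_uniq; rewrite -?lxy.
Qed.

Lemma sib_refl tau : reflexive (@sib tau).
Proof. by move=> x; rewrite /sib !eqxx /=. Qed.

Lemma sib_trans tau : transitive (@sib tau).
Proof.
move=> y x z /and3P[/eqP l1 /eqP p1 xy] /and3P[/eqP l2 /eqP p2 yz].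
by rewrite /sib l1 l2 p1 p2 !eqxx (leq_trans xy).
Qed.

Lemma sib_anti tau (x y : vx tau) : sib x y -> sib y x -> x = y.
Proof.
move=> /and3P[/eqP l1 _ xy] /and3P[_ _ yx]; apply: vx_inj => //.
by apply/eqP; rewrite eqn_leq xy.
Qed.

Definition rel_of tau rho (v : hom tau rho) : rel (vx tau) :=
  fun x y => sib (hmap v x) (hmap v y).

Lemma eqv_rel_of tau rho (v : hom tau rho) x y :
  eqv (rel_of v) x y = (hmap v x == hmap v y).
Proof.
apply/andP/eqP => [[xy yx]|e]; first exact: sib_anti.
by rewrite /rel_of e sib_refl.
Qed.

Lemma valid_rel_of tau rho sigma (w : hom rho sigma) (v : hom tau rho) :
  valid (@par tau) (@lvl tau) (@sib tau) (fun x => pos (hmap (comp_hom w v) x))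
    (rel_of v).
Proof.
split=> [x y|x y|x y lxy|y x z|x y|x y].
- by case/and3P=> /eqP.
- by case/and3P=> _ /eqP pxy _; rewrite eqv_rel_of !hmap_par pxy.
- rewrite eqv_rel_of !hmap_par => /eqP pxy.
  by rewrite /rel_of /sib !lvl_hmap lxy pxy !eqxx leq_total.
- exact: sib_trans.
- exact: sib_hmap.
by move/(sib_hmap w)/and3P=> [_ _]; rewrite !hmap_comp.
Qed.

Lemma is_id_ind tau (P : forall sigma, hom tau sigma -> Prop) :
  P tau (id_hom tau) -> forall sigma (u : hom tau sigma), is_id u -> P sigma u.
Proof.
move=> Pid sigma u /eqP e.
pose Q (p : {sigma & hom tau sigma}) := P (tag p) (tagged p).
by rewrite -[P sigma u]/(Q (Tagged _ u)) e.
Qed.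

(** The factor is [v] after a section of [v']; the inclusion makes it independent of the section and
    monotone on fibers. *)
Lemma rel_of_factor tau rho rho' (v : hom tau rho) (v' : hom tau rho') :
  subrel (rel_of v') (rel_of v) -> exists s, comp_hom s v' = v.
Proof.
move=> sub.
have wd i (x y : 'I_(lev tau i)) : v' i x = v' i y -> v i x = v i y.
  move=> e; have exy : hmap v' (vertex_at x) = hmap v' (vertex_at y).
    by rewrite /hmap /= e.
  apply: val_inj; apply: (congr1 (@pos rho) (x := hmap v (vertex_at x))
    (y := hmap v (vertex_at y))).
  by apply: sib_anti; apply: sub; rewrite /rel_of exy sib_refl.
pose g i := sval (hom_section v' i).
have gK i x : v' i (g i x) = x by apply: (svalP (hom_section v' i)).
pose s : maps rho' rho := [ffun i => [ffun y : 'I_(lev rho' i) => v i (g i y)]].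
have sE i x : s i (v' i x) = v i x by rewrite !ffunE; apply: wd; rewrite gK.
have sP : is_hom s.
  apply/and3P; split.
  - apply/forallP => i; apply/forallP => y; apply/existsP.
    by have [x <-] := hom_surj v y; exists (v' i x); rewrite sE.
  - apply/forallP => i; apply/forallP => y; rewrite -(gK _ y).
    by rewrite -hom_edge !sE hom_edge.
  apply/forallP => i; apply/forallP => x; apply/forallP => y.
  rewrite -(gK _ x) -(gK _ y) !sE; apply/implyP => /andP[/eqP exy xy].
  have : rel_of v' (vertex_at (g _ x)) (vertex_at (g _ y)).
    rewrite /rel_of /sib !lvl_hmap eqxx /= /pos /= xy andbT.
    by apply/eqP; rewrite -!hmap_par !par_lo /hmap /= !hom_edge exy.
  by case/sub/and3P.
exists (Hom sP); apply: hom_ext => i x; rewrite comp_homE.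
by rewrite {1}/hom_fun /= sE.
Qed.

(** Each map factors through the other, so the two targets have levels of equal size, and
    [iso_is_id] turns the comparison into an identity. *)
Lemma rel_of_inj tau rho rho' (v : hom tau rho) (v' : hom tau rho') :
  rel_of v =2 rel_of v' -> Tagged (hom tau) v = Tagged (hom tau) v'.
Proof.
move=> e.
have [s sv] : exists s, comp_hom s v' = v.
  by apply: rel_of_factor => x y; rewrite e.
have [t tv] : exists t, comp_hom t v = v'.
  by apply: rel_of_factor => x y; rewrite e.
have sid : is_id s.
  by apply: iso_is_id => i; apply/eqP; rewrite eqn_leq (hom_lev s) (hom_lev t).
rewrite -sv.
apply: (is_id_ind (P := fun rho s => Tagged (hom tau) (comp_hom s v') = Tagged (hom tau) v') _ sid).
by rewrite comp_idhom.
Qed.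

(** * Realizing a valid preorder by a tree *)

Lemma edge_surj tau i (z : 'I_(lev tau (up i))) : exists y, edge (i := i) y = z.
Proof.
case: tau z => t tP z; have /andP[_ /forallP/(_ i)/andP[_]] := tP.
by case/forallP/(_ z)/existsP=> y /eqP <-; exists y.
Qed.

(** Extends [R], which compares only vertices with equivalent parents, to a total preorder on a
    whole level; it becomes the planar order of the quotient tree. [k] is the distance to the
    root. *)
Fixpoint lex tau (R : rel (vx tau)) k (x y : vx tau) : bool :=
  if k is k'.+1 then
    if eqv R (par x) (par y) then R x y else lex R k' (par x) (par y)
  else true.

Section Realize.
Variables (tau sigma : tree n) (u : hom tau sigma) (R : rel (vx tau)).
Hypothesis vR : valid (@par tau) (@lvl tau) (@sib tau) (fun x => pos (hmap u x)) R.

Let Rrefl x : R x x.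
Proof. exact/(valid_refl (@sib_refl _) x vR). Qed.

Let par_lvl k (x : vx tau) : lvl x + k.+1 = n -> lvl (par x) + k = n.
Proof.
move=> e; rewrite lvl_lt ?addSnnS //.
by rewrite -e -[X in X < _]addn0 ltn_add2l.
Qed.

Lemma lex_eqv k x y : lvl x + k = n -> lvl y + k = n ->
  lex R k x y && lex R k y x = eqv R x y.
Proof.
elim: k x y => [|k IHk] x y lx ly /=.
  rewrite !addn0 in lx ly; by rewrite (root_uniq lx ly) /eqv Rrefl.
rewrite [eqv R (par y) _]eqv_sym; case: ifP => // nxy.
rewrite IHk ?par_lvl // nxy; apply/esym/negP => /andP[/(valid_par vR)].
by rewrite nxy.
Qed.

Lemma lex_total k x y : lvl x + k = n -> lvl y + k = n ->
  lex R k x y || lex R k y x.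
Proof.
elim: k x y => [|k IHk] x y lx ly //=.
rewrite [eqv R (par y) _]eqv_sym; case: ifP => nxy; last exact/IHk/par_lvl/ly/par_lvl.
by apply: (valid_total vR) => //; apply/eqP; rewrite -(eqn_add2r k.+1) lx ly.
Qed.

Lemma lex_trans k x y z : lvl x + k = n -> lvl y + k = n -> lvl z + k = n ->
  lex R k x y -> lex R k y z -> lex R k x z.
Proof.
elim: k x y z => [|k IHk] x y z lx ly lz //=.
have lpx := par_lvl lx; have lpy := par_lvl ly; have lpz := par_lvl lz.
case: (boolP (eqv R (par x) (par y))) => exy.
  case: (boolP (eqv R (par y) (par z))) => eyz.
    by rewrite (eqv_trans vR exy eyz) => xy yz; apply: (valid_trans vR xy yz).
  have -> : eqv R (par x) (par z) = false.
    apply: contraNF eyz => exz; apply: (eqv_trans vR _ exz).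
    by rewrite eqv_sym.
  by move=> _; apply: IHk => //; have := lex_eqv lpx lpy; rewrite exy => /andP[].
case: (boolP (eqv R (par y) (par z))) => eyz.
  have -> : eqv R (par x) (par z) = false.
    apply: contraNF exy => exz; apply: (eqv_trans vR exz).
    by rewrite eqv_sym.
  move=> xy _; apply: IHk xy _ => //.
  by have := lex_eqv lpy lpz; rewrite eyz => /andP[].
move=> xy yz; case: (boolP (eqv R (par x) (par z))) => exz; last exact: IHk xy yz.
case/negP: exy; rewrite -(lex_eqv lpx lpy) xy /=; apply: IHk yz _ => //.
by have := lex_eqv lpx lpz; rewrite exz => /andP[].
Qed.

Lemma lex_rel k x y : lvl x + k = n -> lvl y + k = n ->
  R x y = eqv R (par x) (par y) && lex R k x y.
Proof.
case: k => [|k] lx ly.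
  by rewrite !addn0 in lx ly; rewrite (root_uniq lx ly) Rrefl /eqv Rrefl.
by rewrite /=; case: ifP => // nxy; apply/negP => /(valid_par vR); rewrite nxy.
Qed.

Lemma lex_par k x y : lvl x + k.+1 = n -> lvl y + k.+1 = n ->
  lex R k.+1 x y -> lex R k (par x) (par y).
Proof.
move=> /par_lvl lx /par_lvl ly /=; case: ifP => // exy _.
by have := lex_eqv lx ly; rewrite exy => /andP[].
Qed.

End Realize.

End Vertices.

(** Count the elements strictly below [x], then close the gaps by taking the index of this count in
    the sorted list of its values. *)
Lemma preorder_rank (X : finType) (t : rel X) : total t -> transitive t ->
  exists m (f : X -> 'I_m), (forall y, exists x, f x = y) /\
    (forall x y, (f x <= f y) = t x y).
Proof.
move=> t_total t_trans.
pose g x := #|[pred z | ~~ t x z]|.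
have gE x y : (g x <= g y) = t x y.
  have [xy|nxy] := boolP (t x y).
    apply: subset_leq_card; apply/subsetP => z; rewrite !inE; apply: contra.
    exact: t_trans.
  apply/negbTE; rewrite -ltnNge; apply: proper_card.
  have yx : t y x by have := t_total x y; rewrite (negPf nxy).
  rewrite properE; apply/andP; split.
    apply/subsetP => z; rewrite !inE; apply: contra; exact: t_trans.
  apply/subsetPn; exists y; rewrite !inE // negbK.
  by have := t_total y y; rewrite orbb.
pose vals := sort leq (undup (codom g)).
have vals_mem x : g x \in vals by rewrite mem_sort mem_undup codom_f.
have vals_sorted : sorted ltn vals.
  by rewrite ltn_sorted_uniq_leq sort_uniq undup_uniq sort_sorted //; apply: leq_total.
have f_lt x : index (g x) vals < size vals by rewrite index_mem.
exists (size vals), (fun x => Ordinal (f_lt x)); split=> [y|x y] /=.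
  have := mem_nth 0 (ltn_ord y); rewrite mem_sort mem_undup => /codomP[x ex].
  exists x; apply: val_inj; rewrite /= -ex index_uniq //.
  by rewrite sort_uniq undup_uniq.
rewrite -gE leqNgt [RHS]leqNgt; congr (~~ _).
have lt_idx a b : a \in vals -> b \in vals -> a < b -> index a vals < index b vals.
  move=> av bv lt; rewrite ltnNge; apply: contraL lt => le; rewrite -leqNgt.
  rewrite -(nth_index 0 av) -(nth_index 0 bv).
  move: le; rewrite leq_eqVlt => /orP[/eqP->//|le].
  apply/ltnW; apply: (sorted_ltn_nth ltn_trans) => //; by rewrite inE index_mem.
apply/idP/idP => [|lt]; last exact: lt_idx.
apply: contraLR; rewrite -!leqNgt leq_eqVlt => /orP[/eqP->//|lt].
by apply/ltnW/lt_idx.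
Qed.

Section Realize.
Variables (n : nat) (tau sigma : tree n) (u : hom tau sigma).

(** Each level of the intermediate tree consists of the classes for [lex] of the same level of
    [tau]; [lex_par] makes its edges well defined and increasing. *)
Lemma realize (R : rel (vx tau)) :
  valid (@par n tau) (@lvl n tau) (@sib n tau) (fun x => pos (hmap u x)) R ->
  exists rho (w : hom rho sigma) (v : hom tau rho),
    comp_hom w v = u /\ rel_of v =2 R.
Proof.
move=> vR.
pose r i (x y : 'I_(lev tau i)) := lex R (n - i) (vertex_at x) (vertex_at y).
have li i (x : 'I_(lev tau i)) : lvl (vertex_at x) + (n - i) = n.
  by rewrite /lvl /= subnKC // -ltnS.
pose P i k := exists f : 'I_(lev tau i) -> 'I_k, (forall y, exists x, f x = y) /\
  (forall x y, (f x <= f y) = r i x y).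
have ex_m i : exists k, P i k.
  apply: preorder_rank => [x y|y x z]; first exact: (lex_total vR).
  exact: (lex_trans vR).
have [m mP] := fin_all_exists ex_m.
pose t := [ffun i => m i].
have ex_f i : P i (t i) by rewrite ffunE.
have [f fP] := fin_all_exists ex_f.
have ex_g i : exists g : 'I_(t i) -> 'I_(lev tau i), cancel g (f i).
  have sec y : exists x, f i x == y by have [x <-] := (fP i).1 y; exists x.
  by exists (fun y => xchoose (sec y)) => y; apply/eqP/(xchooseP (sec y)).
have [g gK] := fin_all_exists ex_g.
pose e : edges t := [ffun j => [ffun y => f (up j) (edge (g (lo j) y))]].
have f_eq i x y : (f i x == f i y) = eqv R (vertex_at x) (vertex_at y).
  rewrite -(lex_eqv vR (li _ x) (li _ y)) -[lex _ _ _ _]/(r i x y).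
  rewrite -[lex _ _ (vertex_at y) _]/(r i y x) -!(fP i).2.
  by rewrite -(inj_eq val_inj) eqn_leq.
have lex_up (j : 'I_n) (x y : 'I_(lev tau (lo j))) :
    r (lo j) x y -> r (up j) (edge x) (edge y).
  have ej : n - lo j = (n - up j).+1 by rewrite /= /bump /= add1n subnSK.
  rewrite /r ej -!par_lo; apply: (lex_par vR); rewrite -ej; exact: li.
have e_f j x : e j (f (lo j) x) = f (up j) (edge x).
  have -> : e j (f (lo j) x) = f (up j) (edge (g (lo j) (f (lo j) x))).
    have ej : e j = [ffun y => f (up j) (edge (g (lo j) y))] by apply: ffunE.
    by rewrite ej; apply: ffunE.
  apply: val_inj; apply/eqP.
  by rewrite eqn_leq !(fP _).2 !lex_up // -(fP _).2 gK.
have tP : is_tree (Tagged (@edges n) e).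
  apply/andP; split.
    rewrite /= eqn_leq; apply/andP; split.
      by have := leq_card _ (can_inj (gK ord_max)); rewrite !card_ord lev_max.
    have x1 : 'I_(lev tau ord_max) by rewrite lev_max; apply: ord0.
    by apply: leq_ltn_trans (ltn_ord (f ord_max x1)).
  apply/forallP => j; apply/andP; split.
    apply/forallP => x; apply/forallP => y; apply/implyP.
    rewrite -(gK _ x) -(gK _ y) /= !e_f !(fP _).2; exact: lex_up.
  apply/forallP => y; apply/existsP; have [z <-] := (fP (up j)).1 y.
  by have [x <-] := edge_surj z; exists (f (lo j) x); rewrite /= e_f.
pose rho : tree n := Tree tP.
have edgeE j x : edge (tau := rho) (f (lo j) x) = f (up j) (edge x) := e_f j x.
pose v : maps tau rho := [ffun i => [ffun x : 'I_(lev tau i) => f i x : 'I_(lev rho i)]].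
have vE i x : v i x = f i x.
  have vi : v i = [ffun x : 'I_(lev tau i) => f i x : 'I_(lev rho i)] by apply: ffunE.
  by rewrite vi; apply: ffunE.
have vP : is_hom v.
  apply/and3P; split.
  - apply/forallP => i; apply/forallP => y; apply/existsP.
    by have [x <-] := (fP i).1 y; exists x; rewrite vE.
  - by apply/forallP => j; apply/forallP => x; rewrite !vE edgeE.
  apply/forallP => j; apply/forallP => x; apply/forallP => y.
  apply/implyP => /andP[/eqP exy xy]; rewrite !vE (fP _).2.
  have : R (vertex_at x) (vertex_at y).
    apply: (valid_le0 vR); rewrite /sib /lvl /= !eqxx /= /pos /= xy andbT.
    by rewrite !par_lo exy.
  by rewrite (lex_rel vR (li _ x) (li _ y)) => /andP[].
have relE : rel_of (Hom vP) =2 R.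
  move=> x y; have [exy|nxy] := eqVneq (tag x) (tag y); last first.
    have nl : lvl x != lvl y by apply: contra nxy => /eqP/val_inj ->.
    rewrite /rel_of /sib !lvl_hmap (negPf nl) /=; apply/esym/negP.
    by move/(valid_lvl vR)/eqP; rewrite (negPf nl).
  have hvE (z : vx tau) : hmap (Hom vP) z = vertex_at (f (tag z) (tagged z) : 'I_(lev rho _)).
    by rewrite /hmap /hom_fun /= vE.
  have heq (z z' : vx tau) : tag z = tag z' ->
      (hmap (Hom vP) z == hmap (Hom vP) z') = eqv R z z'.
    case: z z' => [i z] [i' z'] /= ei; case: _ / ei z' => z'.
    rewrite -f_eq !hvE; apply/eqP/eqP => [/(congr1 (@pos n rho)) /= /val_inj //|-> //].
  have lxy : lvl x = lvl y by rewrite /lvl exy.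
  have lx : lvl x + (n - lvl x) = n by rewrite subnKC // lvl_le.
  rewrite (lex_rel vR lx (etrans (congr1 (addn^~ _) (esym lxy)) lx)).
  rewrite /rel_of /sib !lvl_hmap lxy eqxx -!hmap_par heq /=; last first.
    by apply/val_inj/lvl_par.
  congr (_ && _); rewrite !hvE; case: x y exy {lxy lx} => [i x] [i' y] /= ei.
  case: _ / ei y => y; exact: (fP i).2.
(* The outer factor needs no construction: [valid_uo] gives the inclusion of relations that
   [rel_of_factor] asks for. *)
have [w wv] : exists w, comp_hom w (Hom vP) = u.
  apply: rel_of_factor => x y; rewrite relE => xy.
  have lxy := valid_lvl vR xy.
  rewrite /rel_of /sib !lvl_hmap lxy eqxx (valid_uo vR) // andbT -!hmap_par.
  apply/eqP/vx_inj; first by rewrite !lvl_hmap; apply: lvl_par.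
  exact: (eqv_uo vR (valid_par vR xy)).
by exists rho, w, (Hom vP).
Qed.

End Realize.

(** * Morphisms of degree 1 and the choice of the pivot *)

Section UniqueCollision.
Variables (X Y : finType) (f : X -> Y).
Hypothesis f_surj : forall y, exists x, f x = y.

Definition collides p q := p != q /\ f p = f q /\
  forall x y, x != y -> f x = f y -> x = p /\ y = q \/ x = q /\ y = p.

Lemma card_collides : #|X| = #|Y|.+1 <-> exists p q, collides p q.
Proof.
split=> [eXY|[p [q [pq [fpq uniq]]]]].
  have sec y : exists x, f x == y by have [x <-] := f_surj y; exists x.
  pose g y := xchoose (sec y).
  have gK : cancel g f by move=> y; apply/eqP/(xchooseP (sec y)).
  have /cards1P[p ep] : #|~: [set g y | y in Y]| == 1.
    rewrite cardsCs setCK card_imset; last exact: can_inj gK.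
    by rewrite eXY subSnn.
  have pP x : (x == p) = (x \notin [set g y | y in Y]).
    by rewrite -in_setC ep inE.
  have gP x : x != p -> g (f x) = x.
    by rewrite pP negbK => /imsetP[y _ ->]; rewrite gK.
  have gp y : g y != p by rewrite pP negbK imset_f.
  exists p, (g (f p)); split; first by rewrite eq_sym.
  split=> [|x y xy fxy]; first by rewrite gK.
  have [ex|/gP ex] := eqVneq x p.
    by left; split=> //; rewrite -ex fxy gP // -ex eq_sym.
  have [ey|/gP ey] := eqVneq y p; first by right; split=> //; rewrite -ey -fxy ex.
  by rewrite -ex -ey fxy eqxx in xy.
have -> : #|Y| = #|[set~ p]|.
  rewrite -(card_in_imset (f := f)).
    rewrite -cardsT; congr #|pred_of_set _|; apply/esym/setP => y; rewrite inE.
    have [x <-] := f_surj y; have [->|xp] := eqVneq x p.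
      by rewrite fpq imset_f // !inE eq_sym.
    by rewrite imset_f // !inE.
  move=> x y; rewrite !inE => xp yp fxy; apply/eqP/idPn => xy.
  by case: (uniq x y xy fxy) => -[ex ey]; rewrite ?ex ?ey eqxx in xp yp.
by rewrite cardsC1 prednK //; apply/card_gt0P; exists p.
Qed.

End UniqueCollision.

Section Pivot.
Variable n : nat.
Implicit Types tau rho sigma : tree n.

Lemma card_vx tau : #|{: vx tau}| = (deg tau).+1.
Proof.
rewrite card_tagged sumnE big_map big_enum /= big_ord_recr /=.
rewrite card_ord lev_max addn1; congr _.+1; apply: eq_bigr => i _.
by rewrite card_ord.
Qed.

Lemma hom_deg1P tau sigma (u : hom tau sigma) :
  hom_deg u = 1 <-> exists p q, collides (hmap u) p q.
Proof.
have := card_collides (hmap_surj u); rewrite !card_vx /hom_deg => -[h1 h2].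
split=> [e|/h2[->]]; last exact: subSnn.
by apply: h1; rewrite -(subnK (hom_deg_le u)) e.
Qed.

(** The assumptions on [A], [x0] and [y0] under which preorders were matched, specialized to [u]. *)
Record pivot tau sigma (u : hom tau sigma) (A : pred (vx tau)) (x0 y0 : vx tau) : Prop := Pivot {
  pivot_x0 : A x0;
  pivot_up : forall x, A x -> x != x0 -> A (par x);
  pivot_down : forall x, A (par x) -> A x;
  pivot_le : forall x, A x -> lvl x <= lvl x0;
  pivot_top : forall x, A x -> lvl x = lvl x0 -> x = x0;
  pivot_lvl : forall x, A x -> lvl (par x) = (lvl x).+1;
  pivot_child : forall x y : vx tau, A y -> lvl (par x) = lvl y -> (lvl x).+1 = lvl y;
  pivot_first : forall x, ~~ A x -> sib x x0 ->
    pos (hmap u x) = pos (hmap u x0) -> False;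
  pivot_y0 : ~~ A y0;
  pivot_sib : sib x0 y0;
  pivot_pos : pos (hmap u x0) = pos (hmap u y0) }.

Lemma hmap_eq tau sigma (u : hom tau sigma) x y : lvl x = lvl y ->
  pos (hmap u x) = pos (hmap u y) -> hmap u x = hmap u y.
Proof. by move=> l p; apply: vx_inj. Qed.

(** Among the pairs that [u] identifies, take one nearest to the root: its parents are identified as
    well, hence equal by maximality of the level. *)
Lemma siblings_exist tau sigma (u : hom tau sigma) : deg sigma < deg tau ->
  exists x y, [/\ x != y, par x = par y & hmap u x = hmap u y].
Proof.
move=> lt; have /injectivePn[x1 [y1 xy1 e1]] : ~~ injectiveb (hmap u).
  apply: contraL lt => /injectiveP inj; rewrite -leqNgt -ltnS -!card_vx.
  exact: leq_card inj.
pose P (p : vx tau * vx tau) := (p.1 != p.2) && (hmap u p.1 == hmap u p.2).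
have P1 : P (x1, y1) by rewrite /P /= xy1 e1 eqxx.
have [[x y] /andP[/= xy /eqP e] max] := arg_maxnP (fun p => lvl p.1) P1.
exists x, y; split=> //; apply/eqP/idPn => nxy.
have lxy : lvl x = lvl y by have := congr1 (@lvl n sigma) e.
have lx : lvl x < n.
  rewrite ltn_neqAle lvl_le andbT; apply: contra xy => /eqP lx.
  by rewrite (root_uniq lx (etrans (esym lxy) lx)).
have : P (par x, par y) by rewrite /P /= nxy !hmap_par e eqxx.
by move/max; rewrite /= lvl_lt // ltnn.
Qed.

Lemma pivot_exists tau sigma (u : hom tau sigma) : deg sigma < deg tau ->
  exists A x0 y0, pivot u A x0 y0.
Proof.
move=> /(siblings_exist u)[x [y [xy pxy hxy]]].
pose S z := (par z == par x) && (hmap u z == hmap u x).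
have Sx : S x by rewrite /S !eqxx.
have [x0 /andP[/eqP px0 /eqP hx0] min] := arg_minnP (@pos n tau) Sx.
have [y0 [y0x0 py0 hy0]] : exists y0, [/\ y0 != x0, par y0 = par x & hmap u y0 = hmap u x].
  have [e|ne] := eqVneq x x0; last by exists x.
  by exists y; rewrite -e eq_sym -pxy hxy.
have lvlE z : hmap u z = hmap u x -> lvl z = lvl x.
  by move/(congr1 (@lvl n sigma)).
have lx0 : lvl x0 < n.
  rewrite ltn_neqAle lvl_le andbT; apply: contra y0x0 => /eqP l0.
  have l1 : lvl y0 = n by rewrite lvlE // -(lvlE x0).
  by rewrite (root_uniq l1 l0).
pose A z := fconnect (@par n tau) z x0.
have Aiter z : A z -> exists k, iter k (@par n tau) z = x0.
  by move=> Az; exists (findex (@par n tau) z x0); apply: iter_findex.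
have lvl_up z : lvl z <= lvl (par z).
  have := lvl_le z; rewrite leq_eqVlt => /orP[/eqP/par_ge->//|/lvl_lt->].
  exact: leqnSn.
have A_le z : A z -> lvl z <= lvl x0.
  move=> /Aiter[k <-]; elim: k z => //= k IHk z.
  by apply: leq_trans (IHk z) _; apply: lvl_up.
have A_up z : A z -> z != x0 -> A (par z).
  move=> /Aiter[[|k] /= e]; first by rewrite e eqxx.
  by move=> _; rewrite /A -e -iterS iterSr fconnect_iter.
have A_lvl z : A z -> lvl (par z) = (lvl z).+1.
  by move/A_le => le; rewrite lvl_lt // (leq_ltn_trans le).
have A_top z : A z -> lvl z = lvl x0 -> z = x0.
  move=> Az l; apply/eqP/idPn => /(A_up _ Az)/A_le.
  by rewrite A_lvl // l ltnn.
exists A, x0, y0; split=> //.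
- exact: connect0.
- by move=> z; apply: connect_trans; apply: fconnect1.
- move=> z t At e; have := lvl_le z; rewrite leq_eqVlt => /orP[/eqP lz|lz].
    have := A_le t At; rewrite -e par_ge // lz leqNgt lx0 //.
  by rewrite -e lvl_lt.
- move=> z nAz /and3P[/eqP lz /eqP pz lez] hz; case/negP: nAz.
  have Sz : S z by rewrite /S pz px0 eqxx -hx0 (hmap_eq lz hz) eqxx.
  suff -> : z = x0 by apply: connect0.
  by apply: vx_inj => //; apply/eqP; rewrite eqn_leq lez min.
- apply: contra y0x0 => Ay0; apply/eqP; apply: A_top => //.
  by rewrite !lvlE.
- by rewrite /sib px0 py0 !lvlE // !eqxx min // /S py0 hy0 !eqxx.
by rewrite hx0 hy0.
Qed.

End Pivot.

(** * Factorizations of a morphism and their matching *)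

Section Factorizations.
Variables (n : nat) (tau sigma : tree n).

Definition factorization := {rho : quotient tau & (hom rho sigma * hom tau rho)%type}.

Definition outer (t : factorization) : hom (tag t) sigma := (tagged t).1.
Definition inner (t : factorization) : hom tau (tag t) := (tagged t).2.
Definition composite (t : factorization) := comp_hom (outer t) (inner t).

(** The incidence relation of the Koszul complex: [s] passes from the inner factor to the outer one,
    so the preorder of [t'] is the finer one. *)
Definition covers (t t' : factorization) := exists s : hom (tag t') (tag t),
  [/\ hom_deg s = 1, comp_hom (outer t) s = outer t' & comp_hom s (inner t') = inner t].

Fact is_quotient (rho : tree n) (v : hom tau rho) : [exists u : hom tau rho, true].
Proof. by apply/existsP; exists v. Qed.

Definition quotient_of (rho : tree n) (v : hom tau rho) : quotient tau :=
  Quotient (is_quotient v).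

Definition factor (rho : tree n) (w : hom rho sigma) (v : hom tau rho) : factorization :=
  Tagged (fun rho : quotient tau => (hom rho sigma * hom tau rho)%type)
    (i := quotient_of v) (w, v).

Lemma factorization_inj t t' : composite t = composite t' ->
  rel_of (inner t) =2 rel_of (inner t') -> t = t'.
Proof.
case: t t' => [rho [w v]] [rho' [w' v']]; rewrite /composite /outer /inner /=.
move=> ec /rel_of_inj e.
have er : rho = rho' by apply: val_inj; apply: (congr1 tag e).
case: _ / er w' v' ec e => w' v' ec /eqP; rewrite eq_Tagged /= => /eqP ev.
by rewrite ev in ec *; rewrite (comp_hom_inj ec).
Qed.

Lemma realize_factor (u : hom tau sigma) R :
  valid (@par n tau) (@lvl n tau) (@sib n tau) (fun x => pos (hmap u x)) R ->
  exists t, composite t = u /\ rel_of (inner t) =2 R.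
Proof.
by move=> /realize[rho [w [v [e eR]]]]; exists (factor w v).
Qed.

Lemma covers_composite t t' : covers t t' -> composite t' = composite t.
Proof. by case=> s [_ ew ev]; rewrite /composite -ew -ev comp_homA. Qed.

Lemma covers_sub t t' : covers t t' -> subrel (rel_of (inner t')) (rel_of (inner t)).
Proof.
by case=> s [_ _ <-] x y; rewrite /rel_of !hmap_comp; apply: sib_hmap.
Qed.

Definition one_split (R R' : rel (vx tau)) := forall x y z w,
  eqv R x y -> ~~ eqv R' x y -> eqv R z w -> ~~ eqv R' z w ->
  eqv R' x z /\ eqv R' y w \/ eqv R' x w /\ eqv R' y z.

Lemma covers_one_split t t' : covers t t' -> one_split (rel_of (inner t)) (rel_of (inner t')).
Proof.
case=> s [/hom_deg1P[p [q [_ [_ uniq]]]] _ ev] x y z w; rewrite !eqv_rel_of.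
rewrite -ev !hmap_comp => /eqP sxy nxy /eqP szw nzw.
case: (uniq _ _ nxy sxy) (uniq _ _ nzw szw) => -[-> ->] [] [-> ->];
  by rewrite !eqxx; auto.
Qed.

(** Cutting one class in two means that the comparison map has a unique collision, that is, degree
    1. *)
Lemma one_split_covers t t' : composite t = composite t' ->
  subrel (rel_of (inner t')) (rel_of (inner t)) -> one_split (rel_of (inner t)) (rel_of (inner t')) ->
  (exists x y, eqv (rel_of (inner t)) x y /\ ~~ eqv (rel_of (inner t')) x y) ->
  covers t t'.
Proof.
move=> ec /rel_of_factor[s sv] tt' [a [b [sab nab]]].
exists s; split=> //; last first.
  by apply: (comp_hom_inj (v := inner t')); rewrite -comp_homA sv.
move: sab nab; rewrite !eqv_rel_of -sv !hmap_comp => /eqP sab nab.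
apply/hom_deg1P; exists (hmap (inner t') a), (hmap (inner t') b); split=> //.
split=> // x y; have [x' <-] := hmap_surj (inner t') x.
have [y' <-] := hmap_surj (inner t') y => nxy sxy.
have := tt' x' y' a b; rewrite !eqv_rel_of -sv !hmap_comp sab sxy !eqxx.
by case=> // -[/eqP-> /eqP->]; auto.
Qed.

Lemma factorization_matching : deg sigma < deg tau ->
  exists (up : pred factorization) (m : factorization -> factorization)
    (phi : factorization -> nat),
  [/\ forall t, up (m t) = ~~ up t, involutive m,
      forall t, composite (m t) = composite t,
      forall t, up t -> covers t (m t) &
      forall t t', up t -> ~~ up t' -> t' != m t -> covers t t' ->
        phi t' < phi (m t)].
Proof.
move=> lt; have [A /fin_all_exists[x0 /fin_all_exists[y0 piv]]] :=
  fin_all_exists (fun u : hom tau sigma => pivot_exists u lt).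
pose uo (u : hom tau sigma) (x : vx tau) := pos (hmap u x).
pose R t : rel (vx tau) := rel_of (inner t).
have vR t : valid (@par n tau) (@lvl n tau) (@sib n tau) (uo (composite t)) (R t).
  exact: valid_rel_of.
pose up t := merged_at_corner (@lvl n tau) (uo (composite t)) (A (composite t)) (R t).
pose lnk t t' := composite t = composite t' /\
  linked (@par n tau) (@lvl n tau) (uo (composite t)) (A (composite t)) (R t) (R t').
have lnk_up t t' : lnk t t' -> up t /\ ~~ up t'.
  by case=> e /linked_upper; rewrite /up -e.
have lnk_fun t t1 t2 : lnk t t1 -> lnk t t2 -> t1 = t2.
  move=> [e1 l1] [e2 l2]; apply: factorization_inj; first by rewrite -e1.
  exact: linked_fun l1 l2.
have lnk_inj t t1 t2 : lnk t1 t -> lnk t2 t -> t1 = t2.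
  move=> [e1 l1] [e2 l2]; apply: factorization_inj; first by rewrite e1.
  by rewrite e1 in l1; rewrite e2 in l2; apply: linked_inj l1 l2.
have down t : up t -> exists t', lnk t t'.
  move=> upt; have [] := piv (composite t) => h1 h2 h3 h4 h5 h6 h7 h8 h9 h10 h11.
  have [R' vR' lR'] : exists2 R', valid (@par n tau) (@lvl n tau) (@sib n tau) (uo (composite t)) R' &
      forall R'', R'' =2 R' -> linked (@par n tau) (@lvl n tau) (uo (composite t)) (A (composite t)) (R t) R''.
    by apply: (linked_down (@sib_refl _ _) _ h1 h2 h3 h4 h5 h6 h7 h8 h9 h10 h11 (vR t) upt) => x y /and3P[_ /eqP].
  have [t' [e eR]] := realize_factor vR'.
  by exists t'; split=> //; apply: lR'.
have upw t' : ~~ up t' -> exists t, lnk t t'.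
  move=> upt; have [] := piv (composite t') => h1 h2 h3 h4 h5 h6 h7 h8 h9 h10 h11.
  have [R' vR' lR'] : exists2 R', valid (@par n tau) (@lvl n tau) (@sib n tau) (uo (composite t')) R' &
      forall R'', R'' =2 R' -> linked (@par n tau) (@lvl n tau) (uo (composite t')) (A (composite t')) R'' (R t').
    by apply: (linked_up (@sib_refl _ _) h1 h2 h3 h4 h7 h9 h10 h11 (vR t') upt).
  have [t [e eR]] := realize_factor vR'.
  by exists t; split=> //; rewrite e; apply: lR'.
have mate t : exists t', if up t then lnk t t' else lnk t' t.
  by case: (boolP (up t)) => [/down|/upw].
have [m mP] := fin_all_exists mate.
have m_up t : up (m t) = ~~ up t.
  by have := mP t; case: ifP => _ /lnk_up[]; [move=> _ /negbTE | move=> ->].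
exists up, m, (fun t => potential (uo (composite t)) (A (composite t)) (R t)).
have m_comp t : composite (m t) = composite t.
  by have := mP t; case: ifP => _ [].
have lnk_covers t t' : lnk t t' -> covers t t'.
  move=> [e l]; apply: one_split_covers => //; first exact: linked_sub l.
    have [] := piv (composite t) => h1 h2 h3 h4 h5 h6 h7 h8 h9 h10 h11.
    by move=> x y z w; apply: (linked_cover (@sib_refl _ _) h2 h3 h5 h6 (vR t) l).
  exact: linked_neq l.
split=> // [t|t upt|t t' upt upt' ne tt'].
- have := mP t; have := mP (m t); rewrite m_up; case: (up t) => /= l1 l2.
    exact: lnk_inj l1 l2.
  exact: lnk_fun l1 l2.
- by apply: lnk_covers; have := mP t; rewrite upt.
have := mP t; rewrite upt => -[e l]; rewrite (covers_composite tt') -e.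
have [] := piv (composite t) => h1 h2 h3 h4 h5 h6 h7 h8 h9 h10 h11.
apply: (linked_potential (@sib_refl _ _) h1 h2 h3 h5 h6 h9 h10 h11 (vR t) l) => //.
- by have := vR t'; rewrite (covers_composite tt').
- exact: covers_sub.
- exact: covers_one_split.
- by move: upt'; rewrite /up (covers_composite tt').
move=> eR; case/eqP: ne; apply: factorization_inj => //.
by rewrite (covers_composite tt') e.
Qed.

End Factorizations.

(** * Koszul signs *)

Section Parity.
Variable T : eqType.
Implicit Types (s t r : seq T) (a b c : T).

Definition parity s t : bool := odd (inversions s t).

Definition precedes s a b : bool := index a s < index b s.

Lemma inversionsE s t : inversions s t =
  \sum_(a <- s) \sum_(b <- s) (precedes s a b && precedes t b a : nat).
Proof. by rewrite /inversions -sum1_count big_mkcond big_allpairs /=. Qed.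

Lemma precedesN s a b : a \in s -> b \in s -> a != b ->
  precedes s b a = ~~ precedes s a b.
Proof.
move=> sa sb ab; rewrite /precedes -leqNgt [RHS]leq_eqVlt.
by case: eqP => // e; case/eqP: ab; rewrite -(nth_index a sa) -(nth_index a sb) e.
Qed.

Lemma precedes_irr s a : precedes s a a = false.
Proof. exact: ltnn. Qed.

(* For distinct a and b, whether s and t order them differently is symmetric in
   a and b; hence the freedom in the choice of r. *)
Lemma parityE r s t : perm_eq r s -> perm_eq s t -> parity s t =
  \big[addb/false]_(a <- r) \big[addb/false]_(b <- r)
    (precedes r a b && (precedes s a b (+) precedes t a b)).
Proof.
move=> rs st; have odd_sum (I : Type) (l : seq I) (F : I -> nat) :
    odd (\sum_(i <- l) F i) = \big[addb/false]_(i <- l) odd (F i).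
  exact: (big_morph odd oddD).
pose chi a b := precedes s a b (+) precedes t a b.
have memr x : x \in r -> (x \in s) && (x \in t).
  by rewrite -(perm_mem st) -(perm_mem rs) andbb.
have chiC a b : a \in r -> b \in r -> chi a b = chi b a.
  move=> /memr/andP[sa ta] /memr/andP[sb tb]; have [->//|ab] := eqVneq a b.
  by rewrite /chi !(precedesN _ _ ab) // addbN addNb negbK.
rewrite /parity inversionsE.
have -> : \sum_(a <- s) \sum_(b <- s) (precedes s a b && precedes t b a : nat) =
    \sum_(a <- r) \sum_(b <- r) (precedes s a b && chi a b : nat).
  rewrite -(perm_big _ rs) /=; apply: eq_big_seq => a ra.
  rewrite -(perm_big _ rs) /=; apply: eq_big_seq => b rb.
  have [->|ab] := eqVneq a b; first by rewrite !precedes_irr.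
  have /andP[_ ta] := memr _ ra; have /andP[_ tb] := memr _ rb.
  by rewrite /chi (precedesN ta tb ab); case: (precedes s a b).
(* [F] counts the pairs that the two lists order alike, [G] those that they order oppositely.
   Exchanging [a] and [b] turns one [G] sum into the other. *)
have -> : \sum_(a <- r) \sum_(b <- r) (precedes s a b && chi a b : nat) =
    \sum_(a <- r) \sum_(b <- r) (precedes r a b && chi a b : nat).
  pose F p q a b : nat := [&& precedes p a b, precedes q a b & chi a b].
  pose G p q a b : nat := [&& precedes p a b, precedes q b a & chi a b].
  have split_sum p q : perm_eq r p -> perm_eq r q ->
      \sum_(a <- r) \sum_(b <- r) (precedes p a b && chi a b : nat) =
      \sum_(a <- r) \sum_(b <- r) F p q a b + \sum_(a <- r) \sum_(b <- r) G p q a b.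
    move=> rp rq; rewrite -big_split /=; apply: eq_big_seq => a ra.
    rewrite -big_split /=; apply: eq_big_seq => b rb; rewrite /F /G.
    have [->|ab] := eqVneq a b; first by rewrite !precedes_irr.
    rewrite (precedesN (s := q) _ _ ab) -?(perm_mem rq) //.
    by case: (precedes p a b) (precedes q a b) (chi a b) => [] [] [].
  rewrite (split_sum s r) // (split_sum r s) //; congr (_ + _).
    apply: eq_bigr => a _; apply: eq_bigr => b _; rewrite /F; congr (nat_of_bool _).
    by rewrite andbCA.
  rewrite exchange_big /=; apply: eq_big_seq => a ra; apply: eq_big_seq => b rb.
  by rewrite /G chiC // andbCA.
by rewrite odd_sum; apply: eq_bigr => a _; rewrite odd_sum; apply: eq_bigr => b _; rewrite oddb.
Qed.

(** With one reference list for all three parities, additivity holds pair by pair. *)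
Lemma parity_trans t s r : perm_eq s t -> perm_eq t r ->
  parity s r = parity s t (+) parity t r.
Proof.
move=> st tr; have sr := perm_trans st tr; have ts := st; rewrite perm_sym in ts.
rewrite (parityE (perm_refl s) st) (parityE (perm_refl s) sr) (parityE st tr).
rewrite -big_split /=; apply: eq_bigr => a _; rewrite -big_split /=.
apply: eq_bigr => b _.
by case: (precedes s a b) (precedes t a b) (precedes r a b) => [] [] [].
Qed.

Lemma parity_refl s : parity s s = false.
Proof. by rewrite (parityE (perm_refl s) (perm_refl s)); do 2!apply: big1 => ? _; rewrite addbb andbF. Qed.

Lemma parity_sym s t : perm_eq s t -> parity s t = parity t s.
Proof.
move=> st; have ts : perm_eq t s by rewrite perm_sym.
by move: (parity_trans st ts); rewrite parity_refl; do 2!case: parity.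
Qed.

Lemma parity_cons c s t : c \notin s -> perm_eq s t ->
  parity (c :: s) (c :: t) = parity s t.
Proof.
move=> cs st; have cst : perm_eq (c :: s) (c :: t) by rewrite perm_cons.
have prec r a b : a \in s -> b \in s -> precedes (c :: r) a b = precedes r a b.
  have ne x : x \in s -> (c == x) = false by apply: contraTF => /eqP <-.
  by move=> sa sb; rewrite /precedes /= !ne.
have prec0 r b : b \in s -> precedes (c :: r) c b.
  move=> sb; rewrite /precedes /= eqxx; case: eqP => // e.
  by rewrite e sb in cs.
rewrite (parityE (perm_refl _) cst) (parityE (perm_refl _) st) big_cons.
rewrite [X in X (+) _]big1_seq /= => [|b].
  apply: eq_big_seq => a sa; rewrite big_cons {1}/precedes [index c _]/= eqxx ltn0 /=.
  by apply: eq_big_seq => b sb; rewrite !prec.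
rewrite inE => /orP[/eqP->|sb]; first by rewrite precedes_irr.
by rewrite !prec0 // addbb andbF.
Qed.

Lemma parity_swap a b s : uniq [:: a, b & s] ->
  parity [:: a, b & s] [:: b, a & s] = true.
Proof.
move=> u; have := u; rewrite /= inE negb_or => /and3P[/andP[ab as_] bs us].
rewrite /parity /inversions; set l := [:: a, b & s].
rewrite (_ : count _ _ = count (pred1 (a, b)) [seq (x, y) | x <- l, y <- l]).
  rewrite count_uniq_mem ?allpairs_uniq //; last by case=> x y [x' y'].
  by rewrite allpairs_f // !inE eqxx ?orbT.
apply: eq_in_count => -[x y] /allpairsP[[x' y'] /= [lx ly [-> ->]]] {x y}.
rewrite xpair_eqE /l /=.
have ba : (b == a) = false by rewrite eq_sym; apply: negPf.
have sF z : z \in s -> (a == z = false) * (b == z = false) * (z == a = false) * (z == b = false).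
  move=> sz; have za : z != a by apply: contraNneq as_ => <-.
  have zb : z != b by apply: contraNneq bs => <-.
  by rewrite ![_ == z]eq_sym (negPf za) (negPf zb).
move: lx ly; rewrite !inE => /or3P[/eqP->|/eqP->|/sF sx] /or3P[/eqP->|/eqP->|/sF sy];
  rewrite ?eqxx ?(negPf ab) ?ba ?sx ?sy ?eqxx //=.
by rewrite !ltnS; case: ltngtP.
Qed.

End Parity.

Lemma parity_map (T T' : eqType) (f : T -> T') (s t : seq T) :
  uniq s -> perm_eq s t -> {in s &, injective f} ->
  parity (map f s) (map f t) = parity s t.
Proof.
move=> us st f_inj; congr odd.
have idx r : uniq r -> r =i s -> {in s, forall x, index (f x) (map f r) = index x r}.
  move=> ur rs x sx; have rx : x \in r by rewrite rs.
  rewrite -{1}(nth_index x rx) -(nth_map _ (f x)) ?index_mem // index_uniq //.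
    by rewrite size_map index_mem.
  by rewrite map_inj_in_uniq // => y z; rewrite !rs; apply: f_inj.
have ut : uniq t by rewrite -(perm_uniq st).
rewrite !inversionsE big_map; apply: eq_big_seq => a sa.
rewrite big_map; apply: eq_big_seq => b sb.
by rewrite /precedes !idx // => x; rewrite (perm_mem st).
Qed.

Lemma uniq_flatten_map (S T : eqType) (f : S -> seq T) (r : seq S) : uniq r ->
  {in r, forall y, uniq (f y)} ->
  {in r &, forall y z x, x \in f y -> x \in f z -> y = z} ->
  uniq (flatten (map f r)).
Proof.
elim: r => //= y r IHr /andP[yr ur] uf disj; rewrite cat_uniq uf ?mem_head //=.
apply/andP; split.
  apply/hasPn => x /flattenP[_ /mapP[z rz ->] xz]; apply/negP => xy.
  by move: yr; rewrite (disj y z _ _ x) ?mem_head ?inE ?rz ?orbT.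
apply: IHr => // [z rz|z t rz rt]; first by apply: uf; rewrite inE rz orbT.
by apply: disj; rewrite inE ?rz ?rt orbT.
Qed.

Lemma precedes_cat (T : eqType) (s t : seq T) a b : uniq (s ++ t) ->
  a \in s -> b \in t -> precedes (s ++ t) a b.
Proof.
move=> u sa tb; have sb : b \notin s.
  by move: u; rewrite cat_uniq => /and3P[_ /hasPn/(_ b tb)].
rewrite /precedes !index_cat sa (negPf sb).
by apply: leq_trans (leq_addr _ _); rewrite index_mem.
Qed.

Lemma precedes_split (T : eqType) (s : seq T) a b : b \in s -> precedes s a b ->
  exists s1 s2, [/\ s = s1 ++ s2, a \in s1 & b \in s2].
Proof.
move=> sb ab; have ia : index a s < size s by rewrite (leq_trans ab) // index_size.
exists (take (index b s) s), (drop (index b s) s); rewrite cat_take_drop; split=> //.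
  by rewrite in_take // -index_mem.
have ib : index b s < size s by rewrite index_mem.
by rewrite (drop_nth b ib) nth_index // mem_head.
Qed.

Lemma precedes_flatten (S T : eqType) (f : S -> seq T) (r : seq S) y z a b :
  uniq (flatten (map f r)) -> a \in f y -> b \in f z -> z \in r ->
  precedes r y z -> precedes (flatten (map f r)) a b.
Proof.
move=> u ay bz rz /(precedes_split rz)[r1 [r2 [er y1 z2]]].
rewrite er map_cat flatten_cat in u *; apply: precedes_cat => //.
  by apply/flattenP; exists (f y) => //; apply: map_f.
by apply/flattenP; exists (f z) => //; apply: map_f.
Qed.

Lemma precedes_flatten_in (S T : eqType) (f : S -> seq T) (r : seq S) y a b :
  uniq (flatten (map f r)) -> b \in f y -> y \in r ->
  precedes (f y) a b -> precedes (flatten (map f r)) a b.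
Proof.
move=> u fb ry /(precedes_split fb)[s1 [s2 [es s1a s2b]]].
have [r1 [r2 er]] : exists r1 r2, r = r1 ++ y :: r2.
  by case/splitPr: ry => r1 r2; exists r1, r2.
move: u; rewrite er map_cat flatten_cat /= es -!catA => u.
rewrite catA; apply: precedes_cat; rewrite ?mem_cat ?s1a ?s2b ?orbT //.
by rewrite -catA.
Qed.

(** * The depth-first order *)

Section Dfs.
Variables (n : nat).
Implicit Types tau sigma : tree n.

Definition code tau (x : vx tau) : vertex := (lvl x, pos x).

Lemma code_inj tau : injective (@code tau).
Proof. by move=> x y [lxy pxy]; apply: vx_inj. Qed.

Lemma nat_mapE m (a b : 'I_m -> nat) (f : forall i, 'I_(a i) -> 'I_(b i)) i (x : 'I_(a i)) :
  nat_map f i x = f i x.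
Proof. by rewrite /nat_map valK /= valK. Qed.

Lemma on_vertex_code tau sigma (u : hom tau sigma) x :
  on_vertex u (code x) = code (hmap u x).
Proof. by case: x => k x; rewrite /on_vertex /code /= nat_mapE. Qed.

Definition children tau k p : seq nat :=
  [seq y <- iota 0 (nat_lev tau k) | nat_map (edge (tau := tau)) k y == p].

Lemma nat_lev_lo tau (j : 'I_n) : nat_lev tau j = lev tau (lo j).
Proof. by rewrite /nat_lev -[X in insub X]/(val (lo j)) valK. Qed.

Lemma childrenP tau (x : vx tau) k y : lvl x = k.+1 ->
  reflect (exists c : vx tau, [/\ lvl c = k, pos c = y & par c = x])
    (y \in children tau k (pos x)).
Proof.
move=> lx; have ltk : k < n by have := lvl_le x; rewrite lx.
pose j := Ordinal ltk; rewrite -[k]/(val j) in lx *.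
rewrite mem_filter mem_iota leq0n add0n nat_lev_lo /=.
apply: (iffP andP) => /= [[/eqP py lty]|[c [lc <- pc]]].
  pose c := vertex_at (Ordinal lty : 'I_(lev tau (lo j))).
  exists c; split=> //; rewrite par_lo; apply: vx_inj; first by rewrite lx.
  by rewrite -py -[y]/(val (Ordinal lty)) -[k]/(val j) nat_mapE.
case/vxP: c lc pc => [i c|c]; rewrite /lvl /=; last first.
  by move=> e; have := ltk; rewrite -e ltnn.
move=> e; have ei : i = j by apply: val_inj.
by rewrite -ei -e => <-; rewrite par_lo nat_mapE /pos /=.
Qed.

Lemma anc_lvl tau k (x : vx tau) : lvl x <= lvl (iter k (@par n tau) x).
Proof.
elim: k => //= k IHk; apply: leq_trans IHk _.
have := lvl_le (iter k (@par n tau) x).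
by rewrite leq_eqVlt => /orP[/eqP/par_ge->//|/lvl_lt->].
Qed.

Notation anc := (fconnect (@par n _)).

Lemma anc_le tau (x y : vx tau) : anc x y -> lvl x <= lvl y.
Proof. by move/iter_findex <-; apply: anc_lvl. Qed.

Lemma anc_iter_eq tau (x : vx tau) k : lvl (iter k (@par n tau) x) = lvl x ->
  iter k (@par n tau) x = x.
Proof.
case: k => [//|k]; rewrite iterSr => e.
have px : par x = x.
  apply: par_ge; apply/eqP; rewrite eqn_leq lvl_le leqNgt; apply/negP => /lvl_lt lx.
  by have := anc_lvl k (par x); rewrite e lx ltnn.
by rewrite px; elim: k {e} => //= k ->.
Qed.

Lemma anc_uniq tau (x y z : vx tau) : anc x y -> anc x z -> lvl y = lvl z -> y = z.
Proof.
move=> /iter_findex <- /iter_findex <-.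
move: (findex _ x y) (findex _ x z) => k l.
wlog le : k l / k <= l => [hw|].
  by case/orP: (leq_total k l) => le e; [apply: hw|apply/esym/hw => //; apply: esym].
by rewrite -(subnK le) iterD => e; apply/esym/anc_iter_eq.
Qed.

Lemma anc_child tau (x y : vx tau) : anc x y ->
  x = y \/ exists c, [/\ anc x c, par c = y & lvl y = (lvl c).+1].
Proof.
move/iter_findex; move: (findex _ x y) => k <- {y}; elim: k => [|k IHk]; first by left.
have := lvl_le (iter k (@par n tau) x); rewrite leq_eqVlt => /orP[/eqP/par_ge|/lvl_lt] e.
  by rewrite iterS e.
by right; exists (iter k (@par n tau) x); rewrite fconnect_iter.
Qed.

Lemma dfsS tau k p : dfs tau k.+1 p =
  (k.+1, p) :: flatten [seq dfs tau k y | y <- children tau k p].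
Proof. by []. Qed.

Lemma mem_dfs tau (x : vx tau) v : reflect (exists2 z, code z = v & anc z x)
  (v \in dfs tau (lvl x) (pos x)).
Proof.
move: {-1}(lvl x) (erefl (lvl x)) => k; elim: k x v => [|k IHk] x v lx.
  rewrite inE; apply: (iffP eqP) => [->|[z <- zx]].
    by exists x; [rewrite /code lx | apply: connect0].
  case: (anc_child zx) => [->|[c [_ _]]]; first by rewrite /code lx.
  by rewrite lx.
rewrite dfsS inE; apply: (iffP orP) => [[/eqP->|]|[z <- zx]].
- by exists x; [rewrite /code lx | apply: connect0].
- case/flattenP=> _ /mapP[y /(childrenP _ lx)[c [lc <- pc]] ->].
  case/IHk=> // z zv zc; exists z => //; apply: connect_trans zc _.
  by rewrite -pc fconnect1.
case: (anc_child zx) => [->|[c [zc pc]]]; first by rewrite /code lx eqxx; left.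
rewrite lx => -[lc]; right; apply/flattenP; exists (dfs tau k (pos c)).
  by apply: map_f; apply/(childrenP _ lx); exists c.
by apply/IHk => //; exists z.
Qed.

Lemma dfs_uniq tau (x : vx tau) : uniq (dfs tau (lvl x) (pos x)).
Proof.
move: {-1}(lvl x) (erefl (lvl x)) => k; elim: k x => [//|k IHk] x lx.
rewrite dfsS cons_uniq; apply/andP; split.
  apply/flattenP => -[_ /mapP[y /(childrenP _ lx)[c [lc <- pc]] ->]].
  rewrite -lc => /mem_dfs[z [ez _] /anc_le].
  by rewrite ez lc ltnn.
apply: uniq_flatten_map; first by rewrite filter_uniq // iota_uniq.
  by move=> y /(childrenP _ lx)[c [lc <- _]]; apply: IHk.
move=> y y' /(childrenP _ lx)[c [lc <- _]] /(childrenP _ lx)[c' [lc' <- _]] v.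
rewrite -{1}lc -lc' => /mem_dfs[z <- zc] /mem_dfs[z' /code_inj -> zc'].
by rewrite (anc_uniq zc zc') // lc lc'.
Qed.

Lemma precedes_children tau (x y p : vx tau) k : lvl p = k.+1 ->
  par x = p -> par y = p -> lvl x = k -> lvl y = k -> pos x < pos y ->
  precedes (children tau k (pos p)) (pos x) (pos y).
Proof.
move=> lp px py lx ly lt.
have cx : pos x \in children tau k (pos p) by apply/(childrenP _ lp); exists x.
have cy : pos y \in children tau k (pos p) by apply/(childrenP _ lp); exists y.
have srt : sorted ltn (children tau k (pos p)).
  by apply: sorted_filter; [apply: ltn_trans | apply: iota_ltn_sorted].
rewrite /precedes ltnNge; apply: contraL lt => le; rewrite -leqNgt.
move: le; rewrite leq_eqVlt => /orP[/eqP e|le].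
  by rewrite -(nth_index 0 cx) -(nth_index 0 cy) e.
apply: ltnW; exact: (sorted_ltn_index ltn_trans srt _ _ cy cx le).
Qed.

(** The order is decided in the subtree of the common parent and inherited by the subtree of each
    ancestor [q], finally the root. *)
Lemma precedes_dfs tau (x y q : vx tau) : par x = par y -> lvl x = lvl y ->
  lvl x < n -> pos x < pos y -> anc (par x) q ->
  precedes (dfs tau (lvl q) (pos q)) (code x) (code y).
Proof.
move=> pxy lxy ltx lt; have lp : lvl (par x) = (lvl x).+1 by rewrite lvl_lt.
have consE (v w : vertex) s : uniq (w :: s) -> v \in s -> forall v', v' \in s ->
    precedes (w :: s) v v' = precedes s v v'.
  move=> /andP[ws _] sv v' sv'.
  have ne z : z \in s -> (w == z) = false by apply: contraTF => /eqP <-.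
  by rewrite /precedes /= !ne.
move: {-1}(lvl q) (erefl (lvl q)) => k; elim: k q => [|k IHk] q lq pq.
  by have := anc_le pq; rewrite lq lp.
have uq := dfs_uniq q; rewrite lq dfsS in uq *.
have memS c z : par c = q -> lvl c = k -> anc z c ->
    code z \in flatten [seq dfs tau k y | y <- children tau k (pos q)].
  move=> pc lc zc; apply/flattenP; exists (dfs tau k (pos c)).
    by apply: map_f; apply/(childrenP _ lq); exists c.
  by rewrite -lc; apply/mem_dfs; exists z.
case: (anc_child pq) => [eq|[c [zc pc]]].
  rewrite -eq lp in lq; case: lq => lx.
  rewrite consE //; last first.
  - by apply: (memS y) => //; rewrite -?eq // -lxy.
  - exact: (memS x).
  have := uq; rewrite cons_uniq => /andP[_ uf].
  apply: (precedes_flatten (y := pos x) (z := pos y) uf).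
  - by rewrite -lx; apply/mem_dfs; exists x.
  - by rewrite -lx lxy; apply/mem_dfs; exists y.
  - by apply/childrenP; [rewrite -eq lp lx | exists y; rewrite -eq -lxy].
  by apply: precedes_children; rewrite -?eq ?lp ?lx // -lxy.
rewrite lq => -[lc].
have anc_par z : par z = par x -> anc z c.
  by move=> pz; apply: connect_trans zc; rewrite -pz fconnect1.
rewrite consE //; last first.
- exact: (memS c) (anc_par y (esym pxy)).
- exact: (memS c) (anc_par x erefl).
have := uq; rewrite cons_uniq => /andP[_ uf].
apply: (precedes_flatten_in (y := pos c) uf).
- by rewrite lc; apply/mem_dfs; exists y => //; apply: anc_par.
- by apply/(childrenP _ lq); exists c.
exact: IHk.
Qed.

End Dfs.

Import GRing.Theory.

Definition del (T : eqType) (c : T) (s : seq T) := [seq z <- s | z != c].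

Lemma mem_del (T : eqType) (c z : T) s : (z \in del c s) = (z != c) && (z \in s).
Proof. by rewrite mem_filter. Qed.

Lemma del_uniq (T : eqType) (c : T) s : uniq s -> uniq (del c s).
Proof. exact: filter_uniq. Qed.

Lemma delC (T : eqType) (c d : T) s : del c (del d s) = del d (del c s).
Proof. by rewrite /del -!filter_predI; apply: eq_filter => z /=; rewrite andbC. Qed.

Lemma perm_del (T : eqType) (c : T) s : uniq s -> c \in s -> perm_eq s (c :: del c s).
Proof.
move=> us sc; apply: uniq_perm => //.
  by rewrite /= mem_del eqxx del_uniq.
move=> z; rewrite inE mem_del; have [->|] := eqVneq z c; by rewrite ?sc.
Qed.

Lemma precedes_cons (T : eqType) (c a b : T) s : a != c -> b != c ->
  precedes (c :: s) a b = precedes s a b.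
Proof. by move=> ac bc; rewrite /precedes /= ![c == _]eq_sym (negPf ac) (negPf bc). Qed.

Section Symbols.
Variables (n : nat).
Implicit Types tau rho sigma : tree n.

(** The list [symbols] with typed vertices, on which [hmap] acts; [pick] inverts [code]. *)
Definition syms tau : seq (vx tau) :=
  pmap (fun v => [pick z : vx tau | code z == v]) (symbols tau).

Lemma root_exists tau : exists2 r : vx tau, lvl r = n & pos r = 0.
Proof.
have r : 'I_(lev tau ord_max) by rewrite lev_max; apply: ord0.
by exists (vertex_at r); rewrite // /pos /= root_eq0.
Qed.

Lemma anc_root tau (r x : vx tau) : lvl r = n -> fconnect (@par n tau) x r.
Proof.
move=> lr; have [k] := ubnP (n - lvl x); elim: k => // k IHk in x *.
have := lvl_le x; rewrite leq_eqVlt => /orP[/eqP lx _|lx le].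
  by rewrite (root_uniq lx lr) connect0.
apply: connect_trans (fconnect1 _ _) (IHk _ _).
by rewrite lvl_lt // -ltnS subnSK.
Qed.

Lemma dfs_root tau (r : vx tau) : lvl r = n -> pos r = 0 ->
  dfs tau (lvl r) (pos r) = code r :: symbols tau.
Proof.
move=> lr pr; have dfsE k p : dfs tau k p = (k, p) :: behead (dfs tau k p) by case: k.
by rewrite /symbols /code lr pr; apply: dfsE.
Qed.

Lemma symbols_uniq tau : uniq (symbols tau).
Proof.
have [r lr pr] := root_exists tau.
by have := dfs_uniq r; rewrite dfs_root // => /andP[].
Qed.

Lemma mem_symbols tau (x : vx tau) : (code x \in symbols tau) = (lvl x < n).
Proof.
have [r lr pr] := root_exists tau; have := dfs_uniq r.
have : code x \in dfs tau (lvl r) (pos r).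
  by apply/mem_dfs; exists x => //; apply: anc_root.
rewrite dfs_root // inE => xs /andP[rs _].
have [xr|xr] := eqVneq (code x) (code r).
  by rewrite xr (negPf rs); case: xr => -> _; rewrite lr ltnn.
rewrite (negPf xr) /= in xs; rewrite xs ltn_neqAle lvl_le andbT.
by apply/esym; apply: contra xr => /eqP lx; rewrite (root_uniq lx lr).
Qed.

Lemma symbolsP tau v : v \in symbols tau -> exists x : vx tau, code x = v.
Proof.
have [r lr pr] := root_exists tau => vs.
have /mem_dfs[z] : v \in dfs tau (lvl r) (pos r) by rewrite dfs_root // inE vs orbT.
by exists z.
Qed.

Lemma map_code_syms tau : map (@code n tau) (syms tau) = symbols tau.
Proof.
have : {in symbols tau, forall v, exists x : vx tau, code x = v} := @symbolsP tau.
rewrite /syms; elim: (symbols tau) => //= v s IHs h; case: pickP => [z /eqP ez|nz].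
  by rewrite /= ez IHs // => w sw; apply: h; rewrite inE sw orbT.
by have [x /eqP] := h v (mem_head _ _); rewrite nz.
Qed.

Lemma syms_uniq tau : uniq (syms tau).
Proof. by rewrite -(map_inj_uniq (@code_inj n tau)) map_code_syms symbols_uniq. Qed.

Lemma mem_syms tau (x : vx tau) : (x \in syms tau) = (lvl x < n).
Proof. by rewrite -(mem_map (@code_inj n tau)) map_code_syms mem_symbols. Qed.

Lemma precedes_syms tau (x y : vx tau) : sib x y -> x != y -> precedes (syms tau) x y.
Proof.
case/and3P=> /eqP lxy /eqP pxy le xy.
have lx : lvl x < n.
  rewrite ltn_neqAle lvl_le andbT; apply: contra xy => /eqP lx.
  by rewrite (root_uniq lx (etrans (esym lxy) lx)).
have lt : pos x < pos y.
  rewrite ltn_neqAle le andbT; apply: contra xy => /eqP e.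
  by apply/eqP/vx_inj.
have [r lr pr] := root_exists tau.
have := precedes_dfs pxy lxy lx lt (anc_root _ lr).
have ne z : lvl z < n -> code z != code r.
  by move=> lz; apply: contraTneq lz => -[-> _]; rewrite lr ltnn.
rewrite dfs_root // precedes_cons ?ne -?lxy // -map_code_syms.
by rewrite /precedes !index_map //; apply: code_inj.
Qed.

(** * The sign of a morphism of degree 1 *)

Section DegreeOne.
Variables (R : comPzRingType) (tau sigma : tree n) (u : hom tau sigma) (p q : vx tau).
Hypothesis pq : collides (hmap u) p q.

Lemma collides_lvl : lvl p = lvl q /\ lvl p < n.
Proof.
have [ne [e _]] := pq; have l : lvl p = lvl q by have := congr1 (@lvl n sigma) e.
split=> //; rewrite ltn_neqAle lvl_le andbT; apply: contra ne => /eqP lp.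
by rewrite (root_uniq lp (etrans (esym l) lp)).
Qed.

Lemma collides_par : par p = par q.
Proof.
have [ne [e uniq]] := pq; have [l lp] := collides_lvl.
apply/eqP/idPn => npq; have := uniq _ _ npq; rewrite !hmap_par e => /(_ erefl).
by case=> -[/(congr1 (@lvl n tau)) + _]; rewrite lvl_lt // -?l => /esym/n_Sn.
Qed.

Lemma collides_inj c : c = p \/ c = q -> {in [pred z | z != c] &, injective (hmap u)}.
Proof.
have [_ [_ uniq]] := pq => hc x y; rewrite !inE => xc yc e; apply/eqP/idPn => xy.
by case: hc (uniq _ _ xy e) => hc [] [ex ey]; rewrite ex ey hc eqxx in xc yc.
Qed.

Lemma perm_map_del c : c = p \/ c = q ->
  perm_eq (map (hmap u) (del c (syms tau))) (syms sigma).
Proof.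
move=> hc; have inj := collides_inj hc; apply: uniq_perm.
- rewrite map_inj_in_uniq ?del_uniq ?syms_uniq // => x y.
  by rewrite !mem_del => /andP[xc _] /andP[yc _]; apply: inj.
- exact: syms_uniq.
move=> y; rewrite mem_syms; apply/mapP/idP => [[x + ->]|ly].
  by rewrite mem_del mem_syms => /andP[].
have [x exy] := hmap_surj u y; have lx : lvl x < n by rewrite -(lvl_hmap u) exy.
have [ne [e _]] := pq.
have [xc|xc] := eqVneq x c; last by exists x; rewrite // mem_del mem_syms xc.
have [l lp] := collides_lvl.
case: hc => hc; [exists q|exists p]; rewrite ?mem_del ?mem_syms ?hc -?l //.
- by rewrite eq_sym ne.
- by rewrite -e -hc -xc.
- by rewrite ne.
by rewrite e -hc -xc.
Qed.

Hypothesis pq_prec : precedes (syms tau) p q.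

Lemma merged_collides : merged u = [:: (code p, code q)].
Proof.
have [ne [e uniq]] := pq; have [l lp] := collides_lvl.
have mergedE x y : lvl x < n -> lvl y < n ->
    precedes (symbols tau) (code x) (code y) &&
      (on_vertex u (code x) == on_vertex u (code y)) = (x == p) && (y == q).
  move=> lx ly; rewrite !on_vertex_code (inj_eq (@code_inj n sigma)).
  rewrite -map_code_syms /precedes !index_map; try exact: code_inj.
  rewrite -/(precedes _ _ _); apply/andP/andP => [[xy /eqP hxy]|[/eqP-> /eqP->]].
    have nxy : x != y by apply: contraTneq xy => ->; rewrite precedes_irr.
    case: (uniq _ _ nxy hxy) => -[ex ey]; first by rewrite ex ey !eqxx.
    by move: xy; rewrite ex ey (precedesN _ _ ne) ?pq_prec // mem_syms -?l.
  by rewrite pq_prec e eqxx.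
rewrite /merged (eq_in_filter (a2 := pred1 (code p, code q))).
  apply: filter_pred1_uniq.
    by apply: allpairs_uniq; rewrite ?symbols_uniq // => -[x y] [x' y'].
  by apply: allpairs_f; rewrite mem_symbols -?l.
move=> v /allpairsP[[a b] [sa sb ev]]; rewrite {v}ev; rewrite /= in sa sb.
have [x ex] := symbolsP sa; have [y ey] := symbolsP sb.
rewrite -{}ex -{}ey !mem_symbols in sa sb *.
apply: etrans (mergedE x y sa sb) _.
by rewrite -(inj_eq (@code_inj n tau)) -[y == q](inj_eq (@code_inj n tau)).
Qed.

Let rest := del q (del p (syms tau)).

Let sgnE : hom_sgn R u = ((-1) ^+ (parity (syms tau) [:: p, q & rest] (+)
  parity (map (hmap u) (p :: rest)) (syms sigma)))%R.
Proof.
have [l lp] := collides_lvl; have [ne _] := pq.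
rewrite /hom_sgn merged_collides signr_addb.
have -> : [seq v <- symbols tau | (v != code p) && (v != code q)] = map (@code n tau) rest.
  rewrite -map_code_syms filter_map /rest /del -filter_predI; congr map.
  by apply: eq_filter => z /=; rewrite !(inj_eq (@code_inj n tau)) andbC.
have pm : perm_eq (syms tau) [:: p, q & rest].
  apply: perm_trans (perm_del (syms_uniq tau) (c := p) _) _; first by rewrite mem_syms.
  by rewrite perm_cons perm_del ?del_uniq ?syms_uniq // mem_del mem_syms -l lp eq_sym ne.
congr (_ * _)%R; rewrite -[LHS]signr_odd; congr (_ ^+ nat_of_bool _)%R.
  rewrite -(parity_map (syms_uniq tau) pm (f := @code n tau)) ?map_code_syms //.
  by move=> x y _ _; apply: code_inj.
have -> : map (on_vertex u) (code p :: map (@code n tau) rest) =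
    map (@code n sigma) (map (hmap u) (p :: rest)).
  by rewrite -map_comp -[code p :: _]/(map (@code n tau) (p :: rest)) -map_comp;
    apply: eq_map => z /=; rewrite on_vertex_code.
rewrite -[odd _]/(parity _ _) -map_code_syms parity_map //.
- rewrite map_inj_in_uniq.
    by move: (syms_uniq tau); rewrite (perm_uniq pm) /= inE negb_or
      => /and3P[/andP[_ ->] _ ->].
  have inj := collides_inj (or_intror (erefl q)).
  have neq z : z \in p :: rest -> z != q.
    by rewrite inE => /orP[/eqP->//|]; rewrite mem_del => /andP[].
  by move=> x y /neq xq /neq yq; apply: inj.
- apply: perm_trans (perm_map_del (or_intror (erefl q))); apply: perm_map.
  rewrite /rest delC perm_sym perm_del ?del_uniq ?syms_uniq //.
  by rewrite mem_del mem_syms ne.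
by move=> x y _ _; apply: code_inj.
Qed.

(** Extracting [d] changes both parities by the same amount, since [hmap u] is injective away from
    [c]; only the extraction of [c] remains. *)
Let half c d : c != d -> c = p \/ c = q -> lvl c < n -> lvl d < n ->
  parity (syms tau) [:: c, d & del d (del c (syms tau))] (+)
    parity (map (hmap u) (d :: del d (del c (syms tau)))) (syms sigma) =
  parity (syms tau) (c :: del c (syms tau)) (+)
    parity (map (hmap u) (del c (syms tau))) (syms sigma).
Proof.
move=> cd hc lc ld; set L := syms tau; set r := del d (del c L).
have uL : uniq L := syms_uniq tau; have udc := del_uniq c uL.
have p1 : perm_eq L (c :: del c L) by rewrite perm_del // mem_syms.
have p2 : perm_eq (del c L) (d :: r).
  by rewrite perm_del // mem_del mem_syms ld eq_sym cd.
have p2' : perm_eq (d :: r) (del c L) by rewrite perm_sym.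
have p3 : perm_eq (map (hmap u) (d :: r)) (map (hmap u) (del c L)) by apply: perm_map.
rewrite (parity_trans (t := c :: del c L)) ?perm_cons // parity_cons ?mem_del ?eqxx //.
rewrite (parity_trans p3 (perm_map_del hc)) -[RHS]addbF -(addbb (parity (del c L) (d :: r))).
rewrite parity_map //; last first.
- have inj := collides_inj hc.
  by move=> x y; rewrite !(perm_mem p2') !mem_del => /andP[xc _] /andP[yc _]; apply: inj.
- by rewrite -(perm_uniq p2).
rewrite (parity_sym p2'); set x := parity _ _; set y := parity _ _; set z := parity _ _.
by case: x y z => [] [] [].
Qed.

(** Merging a pair amounts to deleting either of its symbols; deleting the right one costs a
    transposition. The free choice of [c] is what makes the signs along different composites
    comparable. *)
Lemma hom_sgn_del c : c = p \/ c = q ->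
  hom_sgn R u = ((-1) ^+ ((c == q) (+) parity (syms tau) (c :: del c (syms tau)) (+)
    parity (map (hmap u) (del c (syms tau))) (syms sigma)))%R.
Proof.
have [l lp] := collides_lvl; have [ne [e _]] := pq; have lq := lp; rewrite l in lq.
rewrite sgnE /rest => -[->|->]; congr (_ ^+ nat_of_bool _)%R.
  by rewrite (negPf ne) -(half (d := q)) //=; [rewrite e | left].
have ne' : q != p by rewrite eq_sym.
have u3 : uniq [:: q, p & del p (del q (syms tau))].
  by rewrite /= inE negb_or ne' !mem_del !eqxx /= andbF !del_uniq ?syms_uniq.
rewrite eqxx -addbA -(half (d := p)) //; last by right.
rewrite delC (parity_trans (t := [:: q, p & del p (del q (syms tau))])).
- by rewrite parity_swap // addbT addNb.
- apply: perm_trans (perm_del (syms_uniq tau) (c := q) _) _; first by rewrite mem_syms.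
  by rewrite perm_cons perm_del ?del_uniq ?syms_uniq // mem_del mem_syms lp ne.
by apply/permP => a /=; rewrite addnCA.
Qed.

Lemma hom_sgn_unit : (hom_sgn R u * hom_sgn R u = 1)%R.
Proof. by rewrite sgnE -signr_addb addbb. Qed.

End DegreeOne.
End Symbols.

(** * The signs of the factorizations of a degree 2 morphism *)

Section Diamond.
Variables (n : nat) (R : comPzRingType).
Implicit Types tau rho sigma : tree n.

Definition merging tau sigma (u : hom tau sigma) p q := collides (hmap u) p q /\ sib p q.

Lemma merging_exists tau sigma (u : hom tau sigma) : hom_deg u = 1 ->
  exists p q, merging u p q.
Proof.
case/hom_deg1P=> p [q pq]; have [l lp] := collides_lvl pq.
have [le|/ltnW le] := leqP (pos p) (pos q).
  by exists p, q; rewrite /merging /sib l (collides_par pq) !eqxx.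
exists q, p; split; last by rewrite /sib l (collides_par pq) !eqxx.
have [ne [e uniq]] := pq; split; first by rewrite eq_sym.
by split=> // x y xy /(uniq _ _ xy)[]; auto.
Qed.

Lemma merging_precedes tau sigma (u : hom tau sigma) p q : merging u p q ->
  precedes (syms tau) p q.
Proof. by case=> -[ne _] pq; apply: precedes_syms. Qed.

Lemma merging_order tau sigma (u : hom tau sigma) p q x y : merging u p q ->
  x != y -> hmap u x = hmap u y -> sib x y -> x = p /\ y = q.
Proof.
move=> [[ne [_ uniq]] pq] xy /(uniq _ _ xy)[//|[-> ->] qp].
by rewrite (sib_anti pq qp) eqxx in ne.
Qed.

(* Exponent of the sign of a composite w of two morphisms of degree 1 that first
   remove the symbol c, then the symbol d. *)
Definition removal tau sigma (w : hom tau sigma) c d : bool :=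
  parity (syms tau) [:: c, d & del d (del c (syms tau))] (+)
  parity (map (hmap w) (del d (del c (syms tau)))) (syms sigma).

Lemma removal_swap tau sigma (w : hom tau sigma) c d : c != d -> lvl c < n -> lvl d < n ->
  removal w d c = ~~ removal w c d.
Proof.
move=> cd lc ld; rewrite /removal delC; set r := del d _.
have u3 : uniq [:: d, c & r].
  rewrite /= inE negb_or eq_sym cd !mem_del !eqxx /= andbF.
  by rewrite !del_uniq ?syms_uniq.
rewrite (parity_trans (t := [:: c, d & r]) (r := [:: d, c & r])).
- rewrite parity_swap ?addbT ?addNb //.
  by move: u3; rewrite /= !inE !negb_or [d == c]eq_sym => /and3P[/andP[-> ->] -> ->].
- apply: perm_trans (perm_del (syms_uniq tau) (c := c) _) _; first by rewrite mem_syms.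
  by rewrite perm_cons perm_del ?del_uniq ?syms_uniq // mem_del mem_syms ld eq_sym cd.
by apply/permP => a /=; rewrite addnCA.
Qed.

(** The term [removal] sees only the composite and the deleted symbols, not the intermediate tree.
    The other two bits record whether each deleted symbol is the right one of its pair. *)
Lemma two_step_sgn tau rho sigma (s1 : hom tau rho) (s2 : hom rho sigma) p1 q1 p2 q2 c d :
  merging s1 p1 q1 -> merging s2 p2 q2 -> c = p1 \/ c = q1 -> d != c -> lvl d < n ->
  hmap s1 d = p2 \/ hmap s1 d = q2 ->
  (hom_sgn R s2 * hom_sgn R s1 =
    (-1) ^+ ((c == q1) (+) (hmap s1 d == q2) (+) removal (comp_hom s2 s1) c d))%R.
Proof.
move=> m1 m2 hc dc ld hd.
have [pq1 _] := m1; have [pq2 _] := m2.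
have lc : lvl c < n by have [l lp] := collides_lvl pq1; case: hc => ->; rewrite -?l.
rewrite (hom_sgn_del R pq1 (merging_precedes m1) hc).
rewrite (hom_sgn_del R pq2 (merging_precedes m2) hd) -signr_addb.
congr (_ ^+ nat_of_bool _)%R; rewrite /removal.
set L := syms tau; set M := syms rho; set e := hmap s1 d; set r := del d (del c L).
have uL : uniq L := syms_uniq tau; have uM : uniq M := syms_uniq rho.
have inj1 := collides_inj pq1 hc; have inj2 := collides_inj pq2 hd.
have pL : perm_eq L (c :: del c L) by rewrite perm_del // mem_syms.
have pcL : perm_eq (del c L) (d :: r) by rewrite perm_del ?del_uniq // mem_del mem_syms dc.
have pS : perm_eq (map (hmap s1) (del c L)) M := perm_map_del pq1 hc.
have pM : perm_eq M (e :: del e M) by rewrite perm_del // mem_syms.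
have pSr : perm_eq (map (hmap s1) (del c L)) (e :: map (hmap s1) r).
  by rewrite -[e :: _]/(map (hmap s1) (d :: r)) perm_map.
have pr : perm_eq (map (hmap s1) r) (del e M).
  rewrite -(perm_cons e); apply: perm_trans pM.
  by apply: perm_trans pS; rewrite perm_sym.
(* [e1], [e2] and [e3] compare all orders with those of [tau] and [sigma]; the order of the
   intermediate tree cancels. *)
have e1 : parity (map (hmap s1) (del c L)) M (+) parity M (e :: del e M) =
    parity (del c L) (d :: r) (+) parity (map (hmap s1) r) (del e M).
  rewrite -parity_trans // (parity_trans pSr) ?perm_cons // parity_cons //.
    rewrite -[e :: _]/(map (hmap s1) (d :: r)) parity_map ?del_uniq //.
    by move=> x y; rewrite !mem_del => /andP[xc _] /andP[yc _]; apply: inj1.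
  by rewrite (perm_mem pr) mem_del eqxx.
have e2 : parity (map (hmap s1) r) (del e M) (+) parity (map (hmap s2) (del e M)) (syms sigma)
    = parity (map (hmap (comp_hom s2 s1)) r) (syms sigma).
  have -> : map (hmap (comp_hom s2 s1)) r = map (hmap s2) (map (hmap s1) r).
    by rewrite -map_comp; apply: eq_map => z; rewrite /= hmap_comp.
  rewrite (parity_trans (perm_map (hmap s2) pr) (perm_map_del pq2 hd)) parity_map //.
    by rewrite (perm_uniq pr) del_uniq.
  move=> x y; rewrite !(perm_mem pr) !mem_del => /andP[xc _] /andP[yc _].
  exact: inj2.
have e3 : parity L [:: c, d & r] = parity L (c :: del c L) (+) parity (del c L) (d :: r).
  rewrite (parity_trans (s := L) (t := c :: del c L) (r := [:: c, d & r])) ?perm_cons //.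
  rewrite parity_cons //.
  by rewrite mem_del eqxx.
rewrite -e2 e3; move: e1.
case: (parity (map (hmap s1) (del c L)) M); case: (parity M (e :: del e M));
case: (parity (del c L) (d :: r)); case: (parity (map (hmap s1) r) (del e M));
case: (parity (map (hmap s2) (del e M)) (syms sigma));
case: (parity L (c :: del c L)); by case: (c == q1); case: (e == q2).
Qed.

Lemma merging_preimage tau sigma (u : hom tau sigma) p q y : merging u p q ->
  exists2 x, x != p & hmap u x = y.
Proof.
move=> [[ne [e _]] _]; have [x <-] := hmap_surj u y.
have [->|xp] := eqVneq x p; last by exists x.
by exists q; rewrite // eq_sym.
Qed.

Lemma merging_eq tau rho rho' (u : hom tau rho) (u' : hom tau rho') p q x y :
  merging u p q -> merging u' p q -> hmap u x = hmap u y -> hmap u' x = hmap u' y.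
Proof.
move=> [[_ [_ uniq]] _] [[_ [e' _]] _]; have [->//|xy] := eqVneq x y.
by case/(uniq _ _ xy)=> -[-> ->].
Qed.

(** Two quotients that merge the same pair can differ only in the order of the pair merged next, and
    [c], [d] certify that they agree on it. *)
Lemma merging_rel tau rho rho' sigma (u : hom tau rho) (u' : hom tau rho')
    (o : hom rho sigma) (o' : hom rho' sigma) x y p q c d :
  comp_hom o u = comp_hom o' u' -> merging u x y -> merging u' x y ->
  merging o p q -> hmap u c = p -> hmap u d = q -> sib (hmap u' c) (hmap u' d) ->
  subrel (rel_of u) (rel_of u').
Proof.
move=> ec mu mu' mo uc ud cd a b; rewrite /rel_of => ab.
have [/eqP lab /eqP pab le] := and3P ab; rewrite !lvl_hmap in lab.
have : sib (hmap u' a) (hmap u' b) || sib (hmap u' b) (hmap u' a).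
  rewrite /sib !lvl_hmap lab eqxx -!hmap_par (merging_eq mu mu' (x := par a) (y := par b)).
    by rewrite eqxx leq_total.
  by rewrite !hmap_par.
case/orP=> // ba.
have [e|nab] := eqVneq (hmap u a) (hmap u b).
  by rewrite (merging_eq mu mu' e) sib_refl.
have oab : hmap o (hmap u a) = hmap o (hmap u b).
  apply: sib_anti; first exact: sib_hmap.
  by rewrite -!hmap_comp ec !hmap_comp; apply: sib_hmap.
have [ea eb] := merging_order mo nab oab ab.
by rewrite (merging_eq mu mu' (etrans ea (esym uc))) (merging_eq mu mu' (etrans eb (esym ud))).
Qed.

(** If the left symbols [x1] and [x2] differ, both composites delete these two symbols, in opposite
    orders. Otherwise the inner factors merge the same pair and the intermediate trees order the
    next pair oppositely, so one deleted symbol is left in one tree and right in the other. *)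
Lemma diamond_sgn tau sigma (t1 t2 : factorization tau sigma) :
  composite t1 = composite t2 -> t1 != t2 ->
  hom_deg (inner t1) = 1 -> hom_deg (outer t1) = 1 ->
  hom_deg (inner t2) = 1 -> hom_deg (outer t2) = 1 ->
  (hom_sgn R (outer t1) * hom_sgn R (inner t1) =
   - (hom_sgn R (outer t2) * hom_sgn R (inner t2)))%R.
Proof.
move=> ec ne /merging_exists[x1 [y1 mi1]] /merging_exists[p1 [q1 mo1]].
move=> /merging_exists[x2 [y2 mi2]] /merging_exists[p2 [q2 mo2]].
set u1 := inner t1 in mi1 *; set o1 := outer t1 in mo1 *.
set u2 := inner t2 in mi2 *; set o2 := outer t2 in mo2 *.
have {}ec : comp_hom o1 u1 = comp_hom o2 u2 by [].
have oE x : hmap o1 (hmap u1 x) = hmap o2 (hmap u2 x) by rewrite -!hmap_comp ec.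
have lx1 : lvl x1 < n by have [] := collides_lvl mi1.1.
have lx2 : lvl x2 < n by have [] := collides_lvl mi2.1.
have npq1 : (p1 == q1) = false by have [[/negPf]] := mo1.
have npq2 : (p2 == q2) = false by have [[/negPf]] := mo2.
have nxy1 : (x1 == y1) = false by have [[/negPf]] := mi1.
have nxy2 : (x2 == y2) = false by have [[/negPf]] := mi2.
have [ex|nx] := eqVneq x1 x2; last first.
  have h1 : hmap u1 x2 = p1.
    have sib2 := mi2.2; have e2 : hmap u2 x2 = hmap u2 y2 by have [[_ []]] := mi2.
    have nu : hmap u1 x2 != hmap u1 y2.
      apply/negP => /eqP e; have [ex _] := merging_order mi1 (negbT nxy2) e sib2.
      by rewrite ex eqxx in nx.
    by have [] := merging_order mo1 nu (etrans (oE x2) (etrans (congr1 _ e2) (esym (oE y2)))) (sib_hmap u1 sib2).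
  have h2 : hmap u2 x1 = p2.
    have sib1 := mi1.2; have e1 : hmap u1 x1 = hmap u1 y1 by have [[_ []]] := mi1.
    have nu : hmap u2 x1 != hmap u2 y1.
      apply/negP => /eqP e; have [ex _] := merging_order mi2 (negbT nxy1) e sib1.
      by rewrite ex eqxx in nx.
    by have [] := merging_order mo2 nu (etrans (esym (oE x1)) (etrans (congr1 _ e1) (oE y1))) (sib_hmap u2 sib1).
  have nx' : x2 != x1 by rewrite eq_sym.
  rewrite (two_step_sgn mi1 mo1 (or_introl erefl) nx' lx2 (or_introl h1)).
  rewrite (two_step_sgn mi2 mo2 (or_introl erefl) nx lx1 (or_introl h2)).
  rewrite nxy1 nxy2 h1 h2 npq1 npq2 /= -ec (removal_swap _ nx) //.
  by case: removal; rewrite ?expr1 ?opprK.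
(* If [y1] and [y2] differed, the leftmost of them would lie between [x1] and the other, and
   monotonicity on fibers would merge it too. *)
have ey : y1 = y2.
  have [[ne1 [e1 uniq1]] sib1] := mi1; have [[ne2 [e2 uniq2]] sib2] := mi2.
  have [le|/ltnW le] := leqP (pos y1) (pos y2).
    have s12 : sib y1 y2.
      case/and3P: sib1 => /eqP l1 /eqP pp1 _; case/and3P: sib2 => /eqP l2 /eqP pp2 _.
      by rewrite /sib -l1 -pp1 ex l2 pp2 !eqxx.
    have e : hmap u2 x1 = hmap u2 y1.
      apply: sib_anti; first exact: sib_hmap.
      by rewrite ex e2; apply: sib_hmap.
    by have [] := merging_order mi2 ne1 e sib1.
  have s12 : sib y2 y1.
    case/and3P: sib1 => /eqP l1 /eqP pp1 _; case/and3P: sib2 => /eqP l2 /eqP pp2 _.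
    by rewrite /sib -l1 -pp1 ex l2 pp2 !eqxx.
  have e : hmap u1 x2 = hmap u1 y2.
    apply: sib_anti; first exact: sib_hmap.
    by rewrite -ex e1; apply: sib_hmap.
  by have [] := merging_order mi1 ne2 e sib2.
rewrite -ex -ey in mi2 nxy2; clear nxy2.
(* The representatives avoid [x1], so that they are symbols still present once [x1] is deleted. *)
have [c nc uc] := merging_preimage p1 mi1; have [d nd ud] := merging_preimage q1 mi1.
have ncd : hmap u2 c != hmap u2 d.
  apply/negP => /eqP e; case: mi2 => -[_ [_ uniq]] _.
  have cd : c != d by apply: contraFN npq1 => /eqP e'; rewrite -uc -ud e'.
  by case: (uniq _ _ cd e) => -[e1 e2]; rewrite ?e1 ?e2 eqxx in nc nd.
have ocd : hmap o2 (hmap u2 c) = hmap o2 (hmap u2 d).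
  by rewrite -!oE uc ud; have [[_ []]] := mo1.
have lc : lvl c < n by rewrite -(lvl_hmap u1) uc; have [] := collides_lvl mo1.1.
have [[_ [_ uniq]] sib2] := mo2.
case: (uniq _ _ ncd ocd) => -[ec2 ed2]; last first.
  rewrite (two_step_sgn mi1 mo1 (or_introl erefl) nc lc (or_introl uc)).
  rewrite (two_step_sgn mi2 mo2 (or_introl erefl) nc lc (or_intror ec2)).
  rewrite uc ec2 npq1 nxy1 eqxx -ec /=.
  by case: removal; rewrite ?expr1 ?opprK.
case/eqP: ne; apply: factorization_inj => // a b; apply/idP/idP.
  by apply: (merging_rel ec mi1 mi2 mo1 uc ud); rewrite ec2 ed2.
apply: (merging_rel (esym ec) mi2 mi1 mo2 ec2 ed2); rewrite uc ud.
by case: mo1.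
Qed.

End Diamond.

(** * Exactness from an acyclic matching *)

Section Matching.
Local Open Scope ring_scope.
Variables (R : comPzRingType) (T : finType) (eps : T -> T -> R).
Variables (upper : pred T) (m : T -> T) (phi : T -> nat).
Hypothesis m_upper : forall t, upper (m t) = ~~ upper t.
Hypothesis mK : involutive m.
Hypothesis eps_unit : forall t, upper t -> eps t (m t) * eps t (m t) = 1.
Hypothesis eps_phi : forall t t', upper t -> ~~ upper t' -> t' != m t ->
  eps t t' != 0 -> (phi t' < phi (m t))%N.

(** A differential in coordinates: [eps t t'] is the coefficient of [t'] in the boundary of [t]. *)
Definition mdiff (f : T -> R) (t' : T) : R := \sum_t eps t t' * f t.

Hypothesis mdiffK : forall f t, mdiff (mdiff f) t = 0.

(** From upper to lower elements the differential is triangular with respect to [phi], and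
    [eps_unit] makes its diagonal invertible. *)
Lemma mdiff_lower (f : T -> R) t' : {in [predC upper], f =1 fun=> 0} ->
  ~~ upper t' -> mdiff f t' = eps (m t') t' * f (m t') +
    \sum_(t | upper t && (t != m t') && (phi t' < phi (m t))%N) eps t t' * f t.
Proof.
move=> f0 t'D; rewrite /mdiff (bigD1 (m t')) //=; congr (_ + _).
rewrite big_mkcond [RHS]big_mkcond; apply: eq_bigr => t _.
have [/= tU|tD] := boolP (upper t); last first.
  by rewrite (f0 t) ?mulr0 ?if_same.
case: eqVneq => //= tm; case: ifP => // /negP nphi.
have [->|nz] := eqVneq (eps t t') 0; first by rewrite mul0r.
case: nphi; apply: eps_phi => //; apply: contra_neq tm => ->.
by rewrite mK.
Qed.

(** Back substitution, from large values of [phi] to small ones. *)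
Lemma mdiff_solve (g : T -> R) : exists2 f : T -> R,
  {in [predC upper], f =1 fun=> 0} & {in [predC upper], mdiff f =1 g}.
Proof.
(* [M] exceeds all values of [phi], so nothing is required at [j = 0] and everything at [j = M]. *)
pose M := (\max_t phi t).+1.
suff step j : exists2 f : T -> R, {in [predC upper], f =1 fun=> 0} &
    forall t, ~~ upper t -> (M - j <= phi t)%N -> mdiff f t = g t.
  by have [f f0 fg] := step M; exists f => // t tD; apply: fg => //; rewrite subnn.
elim: j => [|j [f f0 fg]].
  by exists (fun=> 0) => // t _; rewrite subn0 ltnNge (leq_bigmax t).
pose f' t := if upper t && (phi (m t) == (M - j.+1)%N) then
   eps t (m t) * (g (m t) - \sum_(t2 | upper t2 && (t2 != t) &&
      (phi (m t) < phi (m t2))%N) eps t2 (m t) * f t2)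
  else if upper t && (phi (m t) > M - j.+1)%N then f t else 0.
exists f' => [t|t tD]; first by rewrite inE /f' -topredE /= => /negPf->.
rewrite leq_eqVlt => /orP[/eqP e|lt].
  rewrite mdiff_lower //; last by move=> t2; rewrite inE /f' -topredE /= => /negPf->.
  have tU : upper (m t) by rewrite m_upper.
  rewrite {1}/f' tU mK e eqxx /= mulrA.
  have := eps_unit tU; rewrite mK => ->; rewrite mul1r.
  rewrite [X in _ + X](_ : _ = \sum_(t2 | upper t2 && (t2 != m t) &&
      (phi t < phi (m t2))%N) eps t2 t * f t2) ?subrK //.
  apply: eq_bigr => t2 /andP[/andP[t2U _] lt]; congr (_ * _).
  by rewrite /f' t2U e lt gtn_eqF.
(* For [M <= j] both [M - j] and [M - j.+1] are truncated to 0, and the threshold does not move. *)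
have [Mj|] := leqP M j.
  rewrite -fg //; last by rewrite (leq_trans _ lt) // (eqP Mj).
  rewrite !mdiff_lower //; last by move=> t2; rewrite inE /f' -topredE /= => /negPf->.
  congr (_ * _ + _); last (apply: eq_bigr => t2 /andP[/andP[t2U _] lt2];
    congr (_ * _)).
    by rewrite /f' m_upper tD mK lt gtn_eqF.
  by rewrite /f' t2U (ltn_trans lt) // gtn_eqF // (ltn_trans lt).
move=> jM; rewrite -fg //; last by rewrite (leq_trans _ lt) // subnSK.
rewrite !mdiff_lower //; last by move=> t2; rewrite inE /f' -topredE /= => /negPf->.
congr (_ * _ + _); last (apply: eq_bigr => t2 /andP[/andP[t2U _] lt2];
  congr (_ * _)).
  by rewrite /f' m_upper tD mK lt gtn_eqF.
by rewrite /f' t2U (ltn_trans lt) // gtn_eqF // (ltn_trans lt).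
Qed.

Lemma mdiff_inj (f : T -> R) : {in [predC upper], f =1 fun=> 0} ->
  {in [predC upper], mdiff f =1 fun=> 0} -> f =1 fun=> 0.
Proof.
move=> f0 df0 t; have [tU|tD] := boolP (upper t); last exact: f0.
have [j] := ubnP ((\max_t phi t) - phi (m t)); elim: j => // j IHj in t tU *.
rewrite ltnS => le; have /df0 : m t \in [predC upper] by change (~~ upper (m t)); rewrite m_upper tU.
rewrite mdiff_lower ?m_upper ?tU // mK big1 => [|t2 /andP[/andP[t2U _] lt]].
  by rewrite addr0 => /(congr1 ( *%R (eps t (m t)))); rewrite mulrA eps_unit // mul1r mulr0.
rewrite IHj ?mulr0 // (leq_trans _ le) // ltn_sub2l //.
by rewrite (leq_trans lt) // leq_bigmax.
Qed.

(** Solve for a boundary that agrees with [f] on lower elements. The difference is a cycle supported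
    on upper elements, and vanishes by [mdiff_inj]. *)
Lemma matching_exact (f : T -> R) : mdiff f =1 (fun=> 0) ->
  exists g, f =1 mdiff g.
Proof.
move=> df0; have [g g0 gf] := mdiff_solve f; exists g => t.
apply/eqP; rewrite -subr_eq0; apply/eqP.
apply: (mdiff_inj (f := fun t => f t - mdiff g t)) => {}t tD.
  by rewrite gf ?subrr.
rewrite -[RHS](subrr 0) -{1}(df0 t) -(mdiffK g t) /mdiff -sumrB.
by apply: eq_bigr => t2 _; rewrite mulrBr.
Qed.

End Matching.

(** * The Koszul complex *)

Section DegreeTwo.
Local Open Scope ring_scope.
Variables (n : nat) (R : comPzRingType).
Implicit Types tau rho sigma : tree n.

Lemma hom_degD tau rho sigma (u : hom rho sigma) (v : hom tau rho) :
  hom_deg (comp_hom u v) = (hom_deg u + hom_deg v)%N.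
Proof. by rewrite /hom_deg addnBAC ?hom_deg_le // subnKC ?hom_deg_le. Qed.

Lemma hom_deg0 tau sigma (u : hom tau sigma) : (hom_deg u == 0%N) = is_id u.
Proof.
apply/idP/idP => [|uid]; last first.
  by apply: (is_id_ind (P := fun s (u : hom tau s) => hom_deg u == 0%N) _ uid);
    rewrite /hom_deg subnn.
by apply: contraLR => /nonid_deg; rewrite /hom_deg subn_eq0 -ltnNge.
Qed.

(** The matching changes the inner degree by 1. It pairs each intermediate factorization with one of
    the two trivial ones [bot] and [top], so exactly two are intermediate, and [diamond_sgn] cancels
    them. *)
Lemma factor_comp_sum_pair rho sigma (r : hom rho sigma) : hom_deg r = 2%N ->
  \sum_(t : factorization rho sigma | [&& hom_deg (outer t) == 1%N,
      hom_deg (inner t) == 1%N & composite t == r])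
    hom_sgn R (outer t) * hom_sgn R (inner t) = 0.
Proof.
move=> r2; have lt : (deg sigma < deg rho)%N by rewrite -subn_gt0 -[X in (_ < X)%N]/(hom_deg r) r2.
have [up [m [phi [m_up mK m_comp m_cov _]]]] := factorization_matching lt.
pose bot := factor r (id_hom rho); pose top := factor (id_hom sigma) r.
have cbot : composite bot = r by rewrite /composite comp_homid.
have ctop : composite top = r by rewrite /composite comp_idhom.
have degD t : composite t = r -> (hom_deg (outer t) + hom_deg (inner t) = 2)%N.
  by move=> e; rewrite -hom_degD -r2 -e.
have cov_deg (t t' : factorization rho sigma) : covers t t' -> hom_deg (inner t) = (hom_deg (inner t')).+1.
  by case=> s [s1 _ e]; rewrite -e hom_degD s1.
have bot_deg : hom_deg (inner bot) = 0%N by rewrite /hom_deg subnn.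
have top_deg : hom_deg (inner top) = 2%N by rewrite -r2.
have step t : [\/ hom_deg (inner t) = (hom_deg (inner (m t))).+1
               | hom_deg (inner (m t)) = (hom_deg (inner t)).+1].
  have [/m_cov/cov_deg|] := boolP (up t); first by left.
  by rewrite -m_up => /m_cov/cov_deg; rewrite mK; right.
have m_bot : hom_deg (inner (m bot)) = 1%N.
  by case: (step bot); rewrite bot_deg.
have m_top : hom_deg (inner (m top)) = 1%N.
  case: (step top); rewrite top_deg => e3; first by case: e3.
  have := degD (m top); rewrite m_comp ctop e3 => /(_ erefl).
  by rewrite !addnS.
have botP t : composite t = r -> hom_deg (inner t) = 0%N -> t = bot.
  move=> e /eqP; rewrite hom_deg0 => ti; apply: factorization_inj; first by rewrite e cbot.
  exact: (is_id_ind (P := fun s (u : hom rho s) => rel_of u =2 rel_of (id_hom rho)) _ ti).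
have topP t : composite t = r -> hom_deg (inner t) = 2%N -> t = top.
  move=> e d2; apply: factorization_inj; first by rewrite e ctop.
  have := degD t e; rewrite d2 => /eqP; rewrite -[X in _ == X]add0n eqn_add2r hom_deg0 => to.
  rewrite -[inner top]/r -e /composite => x y.
  apply/esym; move: x y.
  apply: (is_id_ind (P := fun s (o : hom (tag t) s) =>
    rel_of (comp_hom o (inner t)) =2 rel_of (inner t)) _ to).
  by rewrite comp_idhom.
have mid t : [&& hom_deg (outer t) == 1%N, hom_deg (inner t) == 1%N & composite t == r]
    = (t == m bot) || (t == m top).
  have deg1 t' : composite t' = r -> hom_deg (inner t') = 1%N ->
      [&& hom_deg (outer t') == 1%N, hom_deg (inner t') == 1%N & composite t' == r].
    move=> e d1; rewrite d1 e !eqxx !andbT; have := degD t' e.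
    by rewrite d1 addn1 => -[->].
  apply/and3P/orP => [[_ /eqP d1 /eqP e]|[]/eqP->].
  - case: (step t); rewrite d1 => e'.
      left; rewrite -(botP (m t)) ?mK //; first by rewrite m_comp.
      by case: e'.
    by right; rewrite -(topP (m t)) ?mK // m_comp.
  - by apply/and3P; apply: deg1; rewrite ?m_comp.
  by apply/and3P; apply: deg1; rewrite ?m_comp.
have ne : m top != m bot.
  apply/negP => /eqP/(can_inj mK) e.
  by have := top_deg; rewrite e bot_deg.
rewrite (eq_bigl _ _ mid) (bigD1 (m bot)) ?eqxx //= (bigD1 (m top)) /=; last first.
  by rewrite eqxx orbT ne.
rewrite big1 => [|t /andP[/andP[/orP[]/eqP-> ]]]; rewrite ?eqxx //.
have /and3P[/eqP o1 /eqP i1 /eqP c1] := etrans (mid (m bot)) (introT orP (or_introl (eqxx _))).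
have /and3P[/eqP o2 /eqP i2 /eqP c2] := etrans (mid (m top)) (introT orP (or_intror (eqxx _))).
have ne' : m bot != m top by rewrite eq_sym.
rewrite addr0 (diamond_sgn R (etrans c1 (esym c2)) ne' i1 o1 i2 o2).
by rewrite addNr.
Qed.

(** Factorizations from [rho] run over the quotients of [rho], chains over those of [tau]. Composing
    with [v0] identifies the trees that actually occur. *)
Lemma factorization_sum tau rho sigma (v0 : hom tau rho)
    (P : forall rho', hom rho' sigma -> hom rho rho' -> bool)
    (G : forall rho', hom rho' sigma -> hom rho rho' -> R) :
  \sum_(rho' : quotient tau) \sum_(s : hom rho' sigma) \sum_(s' : hom rho rho' | P _ s s') G _ s s' =
  \sum_(t : factorization rho sigma | P _ (outer t) (inner t)) G _ (outer t) (inner t).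
Proof.
under eq_bigr do rewrite pair_big_dep.
rewrite (sig_big_dep xpredT (fun rho' : quotient tau => fun p : hom rho' sigma * hom rho rho' => P _ p.1 p.2)
  (fun (q : quotient tau) p => G _ p.1 p.2)) /=.
pose h (t : factorization rho sigma) :
    {rho' : quotient tau & (hom rho' sigma * hom rho rho')%type} :=
  Tagged (fun rho' : quotient tau => (hom rho' sigma * hom rho rho')%type)
    (i := quotient_of (comp_hom (inner t) v0)) (outer t, inner t).
rewrite (reindex h) //=.
exists (fun x => factor (tagged x).1 (tagged x).2) => [[[rho' q] [w v]] _|[[rho' q] [w v]] _].
  rewrite /h /factor /quotient_of /outer /inner /=.
  by rewrite (bool_irrelevance (is_quotient v) q).
rewrite /h /factor /quotient_of /outer /inner /=.
by rewrite (bool_irrelevance (is_quotient (comp_hom v v0)) q).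
Qed.

Lemma degree_two_sum tau rho sigma (v0 : hom tau rho) (r : hom rho sigma) :
  \sum_(rho' : quotient tau) \sum_(s : hom rho' sigma)
    \sum_(s' : hom rho rho' | [&& hom_deg s == 1%N, hom_deg s' == 1%N & comp_hom s s' == r])
    hom_sgn R s * hom_sgn R s' = 0.
Proof.
have [r2|r2] := eqVneq (hom_deg r) 2%N; last first.
  do 2!(apply: big1 => ? _); apply: big1 => s' /and3P[/eqP d1 /eqP d2 /eqP e].
  by case/eqP: r2; rewrite -e hom_degD d1 d2.
rewrite (factorization_sum v0
  (fun rho' s s' => [&& hom_deg s == 1%N, hom_deg s' == 1%N & comp_hom s s' == r])
  (fun rho' s s' => hom_sgn R s * hom_sgn R s')).
exact: factor_comp_sum_pair.
Qed.

End DegreeTwo.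

Lemma sum_pick (V : nmodType) (T : finType) (x0 : T) (P : pred T) (F : T -> V) :
  (\sum_(x | P x && (x0 == x)) F x = if P x0 then F x0 else 0)%R.
Proof.
rewrite big_mkcondl /= (bigD1 x0) //= big1 ?addr0 // => x /andP[/eqP->].
by rewrite eqxx.
Qed.

(** * Exactness of the twisted differential *)

Section KoszulExact.
Local Open Scope ring_scope.
Variables (n : nat) (R : comPzRingType) (tau sigma : tree n).
Local Notation fac := (factorization tau sigma).

Definition fact (q : quotient tau) (w : hom q sigma) (v : hom tau q) : fac :=
  Tagged (fun q : quotient tau => (hom q sigma * hom tau q)%type) (w, v).

(* In coordinates, the differential (w, v) |-> sum of sgn(s) (w s, v') over the
   factorizations v = s v' with deg s = 1. *)
Definition twist (f : fac -> R) (t : fac) : R :=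
  \sum_(q : quotient tau) \sum_(w : hom q sigma)
    \sum_(s : hom (tag t) q | (hom_deg s == 1%N) && (comp_hom w s == outer t))
      hom_sgn R s * f (fact w (comp_hom s (inner t))).

Definition incidence (t t' : fac) : R :=
  \sum_(s : hom (tag t') (tag t) | [&& hom_deg s == 1%N,
      comp_hom (outer t) s == outer t' & comp_hom s (inner t') == inner t]) hom_sgn R s.

Lemma fact_sum (F : fac -> R) :
  \sum_t F t = \sum_(q : quotient tau) \sum_(w : hom q sigma) \sum_(v : hom tau q) F (fact w v).
Proof.
under [RHS]eq_bigr do rewrite pair_big.
rewrite (sig_big_dep xpredT (fun q => xpredT) (fun (q : quotient tau) p => F (fact p.1 p.2))) /=.
by apply: eq_bigr => -[q [w v]] _.
Qed.

Lemma twistE f t' : twist f t' = mdiff incidence f t'.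
Proof.
rewrite /mdiff fact_sum; apply: eq_bigr => q _; apply: eq_bigr => w _.
under [RHS]eq_bigr do rewrite big_distrl /= big_mkcond.
rewrite exchange_big /= big_mkcond; apply: eq_bigr => s _.
rewrite -big_mkcond; under eq_bigl do rewrite /outer /inner /= andbA.
by rewrite sum_pick.
Qed.

(** Grouping the double sum by the composite [r] of the two degree 1 morphisms leaves a
    [degree_two_sum] as the coefficient of each term. *)
Lemma twistK f t : twist (twist f) t = 0.
Proof.
transitivity (\sum_(q : quotient tau) \sum_(w : hom q sigma)
  \sum_(r : hom (tag t) q | comp_hom w r == outer t) 
    (\sum_(q' : quotient tau) \sum_(s : hom q' q) \sum_(s' : hom (tag t) q' |
      [&& hom_deg s == 1%N, hom_deg s' == 1%N & comp_hom s s' == r])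
      hom_sgn R s * hom_sgn R s') * f (fact w (comp_hom r (inner t)))); last first.
  apply: big1 => q _; apply: big1 => w _; apply: big1 => r _.
  by rewrite (degree_two_sum R (inner t)) mul0r.
transitivity (\sum_(q : quotient tau) \sum_(w : hom q sigma) \sum_(q' : quotient tau)
  \sum_(s : hom q' q) \sum_(s' : hom (tag t) q' | [&& hom_deg s == 1%N, hom_deg s' == 1%N &
      comp_hom w (comp_hom s s') == outer t])
      hom_sgn R s * hom_sgn R s' * f (fact w (comp_hom (comp_hom s s') (inner t)))); last first.
  apply: eq_bigr => q _; apply: eq_bigr => w _.
  under [RHS]eq_bigr do rewrite big_distrl /=.
  rewrite exchange_big /=; apply: eq_bigr => q' _.
  under [RHS]eq_bigr do rewrite big_distrl /=.
  rewrite exchange_big /=; apply: eq_bigr => s _.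
  under [RHS]eq_bigr do rewrite big_distrl /=.
  rewrite (exchange_big_dep xpredT) //= big_mkcond; apply: eq_bigr => s' _.
  rewrite (eq_bigl (fun r => [&& comp_hom w r == outer t, hom_deg s == 1%N &
    hom_deg s' == 1%N] && (comp_hom s s' == r))); last first.
    by move=> r; rewrite -!andbA.
  by rewrite sum_pick; case: (hom_deg s == _); case: (hom_deg s' == _); case: (_ == outer t).
under [RHS]eq_bigr do rewrite exchange_big /=.
rewrite [RHS]exchange_big /=; apply: eq_bigr => q' _.
transitivity (\sum_(w' : hom q' sigma) \sum_(s' : hom (tag t) q')
  \sum_(q : quotient tau) \sum_(w : hom q sigma) \sum_(s : hom q' q)
    if ((hom_deg s' == 1%N) && (comp_hom w' s' == outer t)) &&
       ((hom_deg s == 1%N) && (comp_hom w s == w'))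
    then hom_sgn R s * hom_sgn R s' * f (fact w (comp_hom (comp_hom s s') (inner t))) else 0).
  apply: eq_bigr => w' _; rewrite big_mkcond; apply: eq_bigr => s' _.
  case: ifP => _; last by rewrite big1 // => q _; rewrite big1 // => w _; rewrite big1.
  rewrite /twist big_distrr /=; apply: eq_bigr => q _.
  rewrite big_distrr /=; apply: eq_bigr => w _.
  rewrite big_distrr /= big_mkcond /=; apply: eq_bigr => s _ /=.
  by case: ifP => // _; rewrite mulrA [hom_sgn R s' * _]mulrC comp_homA.
under [LHS]eq_bigr do rewrite exchange_big /=.
rewrite [LHS]exchange_big /=; apply: eq_bigr => q _.
under [LHS]eq_bigr do rewrite exchange_big /=.
rewrite [LHS]exchange_big /=; apply: eq_bigr => w _.
under [LHS]eq_bigr do rewrite exchange_big /=.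
rewrite [LHS]exchange_big /=; apply: eq_bigr => s _.
rewrite [LHS]exchange_big [RHS]big_mkcond; apply: eq_bigr => s' _ /=.
rewrite -big_mkcond.
rewrite (eq_bigl (fun w' => [&& hom_deg s == 1%N, hom_deg s' == 1%N &
    comp_hom w' s' == outer t] && (comp_hom w s == w'))); last first.
  by move=> w' /=; case: (hom_deg s == _); case: (hom_deg s' == _); case: (_ == outer t); case: (_ == w').
by rewrite sum_pick comp_homA.
Qed.

Hypothesis lt_deg : (deg sigma < deg tau)%N.

Lemma incidenceE t t' : incidence t t' != 0 -> covers t t'.
Proof.
rewrite /incidence; have [s /and3P[/eqP s1 /eqP s2 /eqP s3] _|no] := pickP (fun s : hom (tag t') (tag t) =>
  [&& hom_deg s == 1%N, comp_hom (outer t) s == outer t' & comp_hom s (inner t') == inner t]).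
  by exists s.
by rewrite big_pred0 ?eqxx.
Qed.

Lemma incidence_unit t t' : covers t t' -> incidence t t' * incidence t t' = 1.
Proof.
case=> s [s1 s2 s3]; rewrite /incidence (big_pred1 s) => [|s0].
  have [p [q m]] := merging_exists s1.
  exact: (hom_sgn_unit R m.1 (merging_precedes m)).
apply/and3P/eqP => [[_ _ /eqP s3']|->]; last by rewrite s1 s2 s3.
by apply: (comp_hom_inj (v := inner t')); rewrite s3 s3'.
Qed.

Lemma twist_exact f : twist f =1 (fun=> 0) -> exists g, f =1 twist g.
Proof.
have [up [m [phi [m_up mK m_comp m_cov m_phi]]]] := factorization_matching lt_deg.
move=> f0.
have e_unit t : up t -> incidence t (m t) * incidence t (m t) = 1.
  by move/m_cov/incidence_unit.
have e_phi t t' : up t -> ~~ up t' -> t' != m t -> incidence t t' != 0 ->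
    (phi t' < phi (m t))%N.
  by move=> ut ut' ne /incidenceE; apply: m_phi.
have dK h t : mdiff incidence (mdiff incidence h) t = 0.
  rewrite -(twistK h t) twistE /mdiff; apply: eq_bigr => t2 _.
  by rewrite twistE.
have df0 : mdiff incidence f =1 fun=> 0 by move=> t; rewrite -twistE.
have [g fg] := matching_exact m_up mK e_unit e_phi dK df0.
by exists g => t; rewrite twistE.
Qed.

End KoszulExact.

(** * The bar complex *)

Section BarComplex.
Local Open Scope ring_scope.

Section Coordinates.
Variables (R : comPzRingType) (T : finType).

Definition coord (x : free R T) (t : T) : R := (x : {ffun T -> R}) t.

Lemma coordP (x y : free R T) : coord x =1 coord y -> x = y.
Proof. by move=> e; apply/ffunP => t; apply: e. Qed.

Lemma coordD x y t : coord (x + y) t = coord x t + coord y t.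
Proof. by rewrite /coord ffunE. Qed.

Lemma coordN x t : coord (- x) t = - coord x t.
Proof. by rewrite /coord ffunE. Qed.

Lemma coordZ a x t : coord (a *: x) t = a * coord x t.
Proof. by rewrite /coord ffunE. Qed.

Lemma coord0 t : coord 0 t = 0.
Proof. by rewrite /coord ffunE. Qed.

Lemma coord_gen s t : coord (gen s) t = (t == s)%:R.
Proof. by rewrite /coord ffunE. Qed.

Lemma coord_sum I (r : seq I) (P : pred I) (F : I -> free R T) t :
  coord (\sum_(i <- r | P i) F i) t = \sum_(i <- r | P i) coord (F i) t.
Proof. by elim/big_rec2: _ => [|i y x _ <-]; rewrite ?coord0 ?coordD. Qed.

Definition of_coord (f : T -> R) : free R T := [ffun t => f t].

Lemma of_coordE f t : coord (of_coord f) t = f t.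
Proof. by rewrite /coord ffunE. Qed.

End Coordinates.

Lemma coord_lin_ext (R : comPzRingType) (S T : finType) (f : S -> free R T) x t :
  coord (lin_ext f x) t = \sum_s coord x s * coord (f s) t.
Proof. by rewrite coord_sum; apply: eq_bigr => s _; rewrite coordZ. Qed.

Section Bar.
Variables (n : nat) (R : comPzRingType) (tau : tree n).

Definition ccons d (sigma : tree n) (q : quotient tau) (u : nonid q sigma) (c : chain d tau q) :
  chain d.+1 tau sigma :=
  Tagged (fun rho : quotient tau => (nonid rho sigma * chain d tau rho)%type) (u, c).

(* Plain [==] at type chain d.+1 elaborates to the equality of the underlying sigma type. *)
Definition chain_eq d sigma (c c' : chain d tau sigma) : bool :=
  @eq_op (chain d tau sigma) c c'.

Lemma chain_eq_ccons d sigma (q : quotient tau) (u u' : nonid q sigma) (c c' : chain d tau q) :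
  chain_eq (ccons u c) (ccons u' c') = (u == u') && (chain_eq c c').
Proof. by rewrite /chain_eq /ccons -[LHS]/(Tagged _ _ == Tagged _ _) eq_Tagged. Qed.

Lemma chain_eq_tag d sigma (q q' : quotient tau) (u : nonid q sigma) (u' : nonid q' sigma)
    (c : chain d tau q) (c' : chain d tau q') :
  q' != q -> chain_eq (ccons u c) (ccons u' c') = false.
Proof.
move=> qq; apply/negP => /eqP /(congr1 (fun x : {rho : quotient tau & (nonid rho sigma * chain d tau rho)%type} => tag x)) /= e.
by rewrite e eqxx in qq.
Qed.

Lemma chain_sum d sigma (F : chain d.+1 tau sigma -> R) :
  \sum_t F t = \sum_(q : quotient tau) \sum_(u : nonid q sigma) \sum_(c : chain d tau q) F (ccons u c).
Proof.
under [RHS]eq_bigr do rewrite pair_big.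
rewrite (sig_big_dep xpredT (fun q => xpredT)
  (fun (q : quotient tau) (p : nonid q sigma * chain d tau q) => F (ccons p.1 p.2))) /=.
by apply: eq_bigr => -[q [u c]] _.
Qed.

Definition tail_coeff d sigma (z : bar_mod R tau sigma d.+1) (q : quotient tau) (u : nonid q sigma) :
  bar_mod R tau q d := of_coord (fun c => coord z (ccons u c)).

Lemma bar_diff0 sigma z : bar_diff R tau sigma 0 z = 0.
Proof. exact: lin_ext_eq0. Qed.

Lemma coord_bar_diff_gen d sigma (t : chain d.+2 tau sigma) (e : chain d.+1 tau sigma) :
  coord (bar_diff_gen R t) e = \sum_(i < d.+1) (-1) ^+ i.+1 * (chain_eq e (chain_face i t))%:R.
Proof.
rewrite /bar_diff_gen coord_sum; apply: eq_bigr => i _.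
by apply: etrans (coordZ _ _ _) _; congr (_ * _); apply: coord_gen.
Qed.

Lemma chain_face0 d sigma (t : chain d.+2 tau sigma) : chain_face 0 t = chain_merge t.
Proof. by case: d t. Qed.

Lemma chain_faceS d sigma i (q : quotient tau) (u : nonid q sigma) (c : chain d.+2 tau q) :
  chain_face i.+1 (ccons u c) = ccons u (chain_face i c).
Proof. by []. Qed.

(** Face 0 merges the first two morphisms and gives the double sum. The others act on the tail,
    where their index drops by one; hence the first sign. *)
Lemma coord_bar_diff d sigma (z : bar_mod R tau sigma d.+2) (q : quotient tau)
    (u : nonid q sigma) (c : chain d tau q) :
  coord (bar_diff R tau sigma d.+1 z) (ccons u c) =
  - coord (bar_diff R tau q d (tail_coeff z u)) c
  - \sum_(q' : quotient tau) \sum_(u1 : nonid q' sigma)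
      \sum_(u2 : nonid q q' | nonid_comp u1 u2 == u) coord z (ccons u1 (ccons u2 c)).
Proof.
rewrite [LHS]coord_lin_ext.
have genE t : coord (bar_diff_gen R t) (ccons u c) =
    - (chain_eq (ccons u c) (chain_merge t))%:R +
    \sum_(i < d) (-1) ^+ i * (chain_eq (ccons u c) (chain_face i.+1 t))%:R.
  rewrite coord_bar_diff_gen big_ord_recl expr1 mulN1r.
  rewrite chain_face0; congr (_ + _); apply: eq_bigr => i _.
  by rewrite lift0 exprS exprS !mulN1r opprK.
transitivity (\sum_(t : chain d.+2 tau sigma) coord z t *
      (\sum_(i < d) (-1) ^+ i * (chain_eq (ccons u c) (chain_face i.+1 t))%:R) -
    \sum_(t : chain d.+2 tau sigma) coord z t * (chain_eq (ccons u c) (chain_merge t))%:R).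
  by rewrite -sumrB; apply: eq_bigr => t _; rewrite genE mulrDr mulrN addrC.
congr (_ - _).
  rewrite chain_sum (bigD1 q) //= [X in _ + X]big1 ?addr0 => [|q1 qq]; last first.
    apply: big1 => u1 _; apply: big1 => c1 _; rewrite big1 ?mulr0 // => i _.
    case: d z u c c1 i {genE} => [|d] z u c c1 i; first by case: i.
    by rewrite chain_faceS chain_eq_tag ?mulr0.
  rewrite (bigD1 u) //= [X in _ + X]big1 ?addr0 => [|u1 uu]; last first.
    apply: big1 => c1 _; rewrite big1 ?mulr0 // => i _.
    case: d z u uu c c1 i {genE} => [|d] z u uu c c1 i; first by case: i.
    rewrite chain_faceS chain_eq_ccons.
    by rewrite eq_sym (negPf uu) mulr0.
  case: d z u c {genE} => [|d] z u c.
    by rewrite bar_diff0 coord0 oppr0 big1 // => c1 _; rewrite big_ord0 mulr0.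
  rewrite coord_lin_ext -sumrN; apply: eq_bigr => c1 _.
  rewrite of_coordE -mulrN; congr (_ * _); rewrite coord_sum -sumrN.
  apply: eq_bigr => i _; rewrite coordZ coord_gen exprS mulN1r mulNr opprK.
  by rewrite chain_faceS chain_eq_ccons eqxx.
rewrite chain_sum; apply: eq_bigr => q1 _; apply: eq_bigr => u1 _.
rewrite chain_sum (bigD1 q) //= [X in _ + X]big1 ?addr0 => [|q2 qq]; last first.
  apply: big1 => u2 _; apply: big1 => c2 _.
  by rewrite -/(ccons _ _) chain_eq_tag // mulr0.
rewrite [RHS]big_mkcond; apply: eq_bigr => u2 _.
rewrite (bigD1 c) //= [X in _ + X]big1 ?addr0 => [|c2 cc].
  rewrite -/(ccons _ _) chain_eq_ccons /chain_eq eqxx andbT eq_sym.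
  by case: eqP; rewrite ?mulr1 ?mulr0.
rewrite -/(ccons _ _) chain_eq_ccons.
by rewrite /chain_eq eq_sym [c == _]eq_sym (negPf cc) andbF mulr0.
Qed.

End Bar.

Section Spread.
Variables (n : nat) (R : comPzRingType) (tau : tree n).

(* The image under iota of the sum of the k u {u}. *)
Definition spread d (sigma : tree n) (k : hom tau sigma -> R) : bar_mod R tau sigma d :=
  of_coord (fun c : chain d tau sigma =>
    if chain_deg1 c then chain_sgn R c * k (chain_comp c) else 0).

Lemma coord_spread d sigma (k : hom tau sigma -> R) (c : chain d tau sigma) :
  coord (spread d k) c = if chain_deg1 c then chain_sgn R c * k (chain_comp c) else 0.
Proof. exact: of_coordE. Qed.

Lemma coord_spread_cons d sigma (k : hom tau sigma -> R) (q : quotient tau)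
    (u : nonid q sigma) (c : chain d tau q) :
  coord (spread d.+1 k) (ccons u c) =
  if hom_deg (val u) == 1%N then
    hom_sgn R (val u) * coord (spread d (fun v => k (comp_hom (val u) v))) c
  else 0.
Proof.
rewrite !coord_spread.
have -> : chain_deg1 (ccons u c) = (hom_deg (val u) == 1%N) && chain_deg1 c by [].
have -> : chain_sgn R (ccons u c) = hom_sgn R (val u) * chain_sgn R c by [].
have -> : chain_comp (ccons u c) = comp_hom (val u) (chain_comp c) by [].
by case: (_ == _) => //; case: chain_deg1; rewrite ?mulr0 // mulrA.
Qed.

Lemma spread_ext d sigma (k k' : hom tau sigma -> R) : k =1 k' -> spread d k = spread d k'.
Proof. by move=> e; apply: coordP => c; rewrite !coord_spread e. Qed.

Lemma spread0 d sigma : spread d (fun _ : hom tau sigma => 0) = 0.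
Proof. by apply: coordP => c; rewrite coord_spread mulr0 if_same coord0. Qed.

Lemma coord_head d sigma (z : bar_mod R tau sigma d.+1) (q : quotient tau) (u : nonid q sigma) c :
  coord (tail_coeff z u) c = coord z (ccons u c).
Proof. exact: of_coordE. Qed.

Lemma coord_bar_diff_head d sigma (z : bar_mod R tau sigma d.+2) (q : quotient tau)
    (u : nonid q sigma) (c : chain d tau q) :
  coord (bar_diff R tau sigma d.+1 z) (ccons u c) =
  - coord (bar_diff R tau q d (tail_coeff z u)) c
  - \sum_(q' : quotient tau) \sum_(u1 : nonid q' sigma)
      \sum_(u2 : nonid q q' | nonid_comp u1 u2 == u) coord (tail_coeff z u1) (ccons u2 c).
Proof.
rewrite coord_bar_diff; congr (_ - _); apply: eq_bigr => q' _; apply: eq_bigr => u1 _.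
by apply: eq_bigr => u2 _; apply: esym; apply: coord_head.
Qed.

Lemma headP d sigma (z z' : bar_mod R tau sigma d.+1) :
  (forall (q : quotient tau) (u : nonid q sigma), tail_coeff z u = tail_coeff z' u) -> z = z'.
Proof.
move=> e; apply: coordP => -[q [u c]].
by rewrite -/(ccons u c) -!coord_head e.
Qed.

Lemma hom_deg_nonid (rho sigma : tree n) (u : nonid rho sigma) : (0 < hom_deg (val u))%N.
Proof. by rewrite lt0n hom_deg0 (valP u). Qed.

Lemma nonid_comp_deg (rho rho' sigma : tree n) (u1 : nonid rho' sigma) (u2 : nonid rho rho') u :
  nonid_comp u1 u2 == u -> (hom_deg (val u) = hom_deg (val u1) + hom_deg (val u2))%N.
Proof. by move/eqP <-; rewrite /= hom_degD. Qed.

Lemma sum_nonid (rho sigma : tree n) (F : hom rho sigma -> R) (P : pred (hom rho sigma)) :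
  (forall u, P u -> is_id u -> F u = 0) ->
  \sum_(u : hom rho sigma | P u) F u = \sum_(u : nonid rho sigma | P (val u)) F (val u).
Proof.
move=> F0; rewrite (bigID (fun u => is_id u)) /= big1 ?add0r => [|u /andP[]]; last exact: F0.
rewrite (reindex_omap (val : nonid rho sigma -> _) insub) => [|u /andP[_ nid]]; last by rewrite insubT.
apply: eq_bigl => u; have -> : insub (val u) == Some u by apply/eqP; exact: valK.
have nu : is_id (val u) = false := negbTE (valP u).
by rewrite nu !andbT.
Qed.

Lemma degree_two_nonid_sum (q : quotient tau) sigma (u : nonid q sigma) (v0 : hom tau q) :
  \sum_(q' : quotient tau) \sum_(u1 : nonid q' sigma) \sum_(u2 : nonid q q' | nonid_comp u1 u2 == u)
    (if (hom_deg (val u1) == 1%N) && (hom_deg (val u2) == 1%N)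
     then hom_sgn R (val u1) * hom_sgn R (val u2) else 0) = 0.
Proof.
rewrite -[RHS](degree_two_sum R v0 (val u)); apply: eq_bigr => q' _.
rewrite (sum_nonid (P := xpredT)) => [|s _ sid]; last first.
  by rewrite big_pred0 // => s'; move: sid; rewrite -hom_deg0 => /eqP ->.
apply: eq_bigr => u1 _; rewrite sum_nonid => [|s' /and3P[_ /eqP s1 _]]; last first.
  by rewrite -hom_deg0 s1.
rewrite big_mkcond [RHS]big_mkcond; apply: eq_bigr => u2 _.
rewrite -(inj_eq val_inj) /=; case: (comp_hom _ _ == _); last by rewrite !andbF.
by rewrite andbT.
Qed.

(** The tail contributes nothing by induction, and the merging of the first two morphisms cancels by
    the identity in degree 2. *)
Lemma bar_diff_spread d sigma (k : hom tau sigma -> R) : bar_diff R tau sigma d (spread d.+1 k) = 0.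
Proof.
elim: d sigma k => [|d IHd] sigma k; first exact: bar_diff0.
apply: coordP => -[q [u c]]; rewrite -/(ccons u c) coord_bar_diff coord0.
have -> : tail_coeff (spread d.+2 k) u = (if hom_deg (val u) == 1%N then hom_sgn R (val u) else 0) *:
    spread d.+1 (fun v => k (comp_hom (val u) v)).
  apply: coordP => c'; rewrite coord_head coord_spread_cons coordZ.
  by case: ifP => // _; rewrite mul0r.
rewrite linearZ /= IHd coordZ coord0 mulr0 oppr0 sub0r; apply/eqP; rewrite oppr_eq0; apply/eqP.
pose K := coord (spread d (fun v => k (comp_hom (val u) v))) c.
rewrite -[RHS](mul0r K) -[X in X * _](degree_two_nonid_sum u (chain_comp c)).
rewrite mulr_suml; apply: eq_bigr => q' _; rewrite mulr_suml; apply: eq_bigr => u1 _.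
rewrite mulr_suml; apply: eq_bigr => u2 /eqP e.
rewrite (coord_spread_cons k u1 (ccons u2 c)); case: ifP => _; last by rewrite mul0r.
rewrite coord_spread_cons; case: ifP => _; last by rewrite mulr0 mul0r.
rewrite mulrA; congr (_ * coord _ _); apply: spread_ext => v.
by rewrite comp_homA -e.
Qed.

(** On families of Koszul elements indexed by the first morphism, the merging face is the twisted
    differential. [f] must vanish on identities because chains do not contain them. *)
Lemma sum_spread sigma (f : factorization tau sigma -> R) (q : quotient tau)
    (u : nonid q sigma) d (c : chain d tau q) :
  (forall t, is_id (outer t) -> f t = 0) ->
  \sum_(q' : quotient tau) \sum_(u1 : nonid q' sigma) \sum_(u2 : nonid q q' | nonid_comp u1 u2 == u)
    coord (spread d.+1 (fun v => f (fact (val u1) v))) (ccons u2 c) =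
  coord (spread d (fun v => twist f (fact (val u) v))) c.
Proof.
move=> f0; rewrite coord_spread.
pose S := if chain_deg1 c then chain_sgn R c else 0.
transitivity (S * twist f (fact (val u) (chain_comp c))); last first.
  by rewrite /S; case: ifP => // _; rewrite mul0r.
rewrite /twist mulr_sumr; apply: eq_bigr => q' _; rewrite mulr_sumr.
rewrite (sum_nonid (P := xpredT)) => [|w _ wid]; last first.
  by rewrite big1 ?mulr0 // => s _; rewrite f0 ?mulr0.
apply: eq_bigr => u1 _; rewrite mulr_sumr sum_nonid => [|s /andP[/eqP s1 _]]; last first.
  by rewrite -hom_deg0 s1.
rewrite big_mkcond [RHS]big_mkcond; apply: eq_bigr => u2 _.
rewrite coord_spread_cons coord_spread /S -(inj_eq val_inj).
rewrite -[val (nonid_comp _ _)]/(comp_hom (val u1) (val u2)) -[outer _]/(val u).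
case: (_ == val u); last by rewrite andbF.
rewrite andbT; case: ifP => // _; case: ifP => _; last by rewrite mulr0 mul0r.
by rewrite mulrCA mulrA.
Qed.

Lemma chain_bound d sigma (c : chain d tau sigma) : (d + deg sigma <= deg tau)%N.
Proof.
elim: d sigma c => [|d IHd] sigma; first by case=> u _; apply: hom_deg_le u.
case=> q [u c]; apply: leq_trans (IHd q c); rewrite addSn -addnS leq_add2l.
exact: nonid_deg (valP u).
Qed.

Lemma bar_mod_eq0 d sigma (z : bar_mod R tau sigma d) : (deg tau < d + deg sigma)%N -> z = 0.
Proof. by move=> lt; apply: coordP => c; have := chain_bound c; rewrite leqNgt lt. Qed.

Definition build d sigma (h : forall q : quotient tau, nonid q sigma -> bar_mod R tau q d) :
  bar_mod R tau sigma d.+1 :=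
  of_coord (fun t : chain d.+1 tau sigma => let: existT q (u, c) := t in coord (h q u) c).

Lemma head_build d sigma (h : forall q : quotient tau, nonid q sigma -> bar_mod R tau q d)
  (q : quotient tau) (u : nonid q sigma) : tail_coeff (build h) u = h q u.
Proof. by apply: coordP => c; rewrite coord_head of_coordE. Qed.

End Spread.

(** * The homology of the bar construction by induction on the degree *)

Section BarHomology.
Variables (n : nat) (R : comPzRingType) (tau : tree n).

Definition bar_cycle d (sigma : tree n) (z : bar_mod R tau sigma d) : Prop :=
  @cycle R (bar R tau sigma) d z.

Lemma hom_deg_sub (q sigma : tree n) (u : hom q sigma) : (deg sigma + hom_deg u = deg q)%N.
Proof. by rewrite /hom_deg subnKC ?hom_deg_le. Qed.

Lemma quotient_deg (q : quotient tau) : (deg q <= deg tau)%N.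
Proof. by have /existsP[v _] := valP q; apply: hom_deg_le v. Qed.

(** In the coordinates at [u], merging involves only first morphisms of smaller degree, where [z]
    vanishes; what is left is the boundary of the tail. *)
Lemma head_cycle d sigma (z : bar_mod R tau sigma d.+1) (q : quotient tau) (u : nonid q sigma) :
  bar_cycle z ->
  (forall (q' : quotient tau) (u1 : nonid q' sigma),
     (hom_deg (val u1) < hom_deg (val u))%N -> tail_coeff z u1 = 0) ->
  bar_cycle (tail_coeff z u).
Proof.
case: d z => [//|d] z cz low.
have := congr1 (fun x => coord x) (cz : bar_diff R tau sigma d.+1 z = 0) => dz.
apply: coordP => c; have := congr1 (fun f => f (ccons u c)) dz.
rewrite coord_bar_diff_head !coord0 big1 => [|q' _].
  by rewrite subr0 => /eqP; rewrite oppr_eq0 => /eqP.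
apply: big1 => u1 _; apply: big1 => u2 e.
rewrite low ?coord0 // (nonid_comp_deg e).
by rewrite -[X in (X < _)%N]addn0 ltn_add2l hom_deg_nonid.
Qed.

Lemma bar_diff_build d sigma (f : factorization tau sigma -> R) :
  (forall t, is_id (outer t) -> f t = 0) ->
  bar_diff R tau sigma d.+1
    (build (fun q u => - spread d.+1 (fun v : hom tau q => f (fact (val u) v)))) =
  build (fun q u => spread d (fun v : hom tau q => twist f (fact (val u) v))).
Proof.
move=> f0; apply: headP => q u; rewrite head_build; apply: coordP => c.
rewrite coord_head coord_bar_diff_head head_build.
rewrite linearN /= bar_diff_spread oppr0 coord0 oppr0 sub0r -sum_spread // -sumrN.
apply: eq_bigr => q' _; rewrite -sumrN; apply: eq_bigr => u1 _.
rewrite -sumrN; apply: eq_bigr => u2 _.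
by rewrite head_build coordN opprK.
Qed.

(** [twist] raises the degree of the outer factor by 1, so homogeneous components can be treated
    separately. *)
Lemma twist_degree sigma (f : factorization tau sigma -> R) p t :
  hom_deg (outer t) = p.+1 ->
  twist f t = twist (fun t' => if hom_deg (outer t') == p then f t' else 0) t.
Proof.
move=> tp; apply: eq_bigr => q _; apply: eq_bigr => w _; apply: eq_bigr => s /andP[/eqP s1 /eqP e].
suff -> : hom_deg (outer (fact w (comp_hom s (inner t)))) == p by [].
by have := hom_degD w s; rewrite e tp s1 addn1 => -[->].
Qed.

Lemma twist_degree0 sigma (f : factorization tau sigma -> R) p t :
  hom_deg (outer t) <> p.+1 ->
  twist (fun t' => if hom_deg (outer t') == p then f t' else 0) t = 0.
Proof.
move=> tp; apply: big1 => q _; apply: big1 => w _; apply: big1 => s /andP[/eqP s1 /eqP e].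
case: eqP; rewrite ?mulr0 // => /= wp; case: tp.
have := hom_degD w s; rewrite e s1 addn1 => ->; congr _.+1.
exact: wp.
Qed.

Lemma twist_id sigma (f : factorization tau sigma -> R) (q : quotient tau) (u : hom q sigma) v :
  (forall t, ~~ is_id (outer t) -> f t = 0) -> hom_deg u = 1%N ->
  twist f (fact u v) = hom_sgn R u * f (factor (id_hom sigma) (comp_hom u v)).
Proof.
move=> f0 u1; pose q0 := quotient_of (comp_hom u v).
have vanish (q1 : quotient tau) (w : hom q1 sigma) : ~~ is_id w ->
    \sum_(s : hom q q1 | (hom_deg s == 1%N) && (comp_hom w s == u))
      hom_sgn R s * f (fact w (comp_hom s v)) = 0.
  by move=> nw; apply: big1 => s _; rewrite f0 ?mulr0.
rewrite /twist (bigD1 q0) //= [X in _ + X]big1 ?addr0 => [|q1 ne]; last first.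
  apply: big1 => w _; apply: vanish; apply: contra ne => /eqP e.
  apply/eqP; apply: val_inj; apply: esym.
  exact: (congr1 tag e).
rewrite (bigD1 (id_hom sigma : hom q0 sigma)) //= [X in _ + X]big1 ?addr0 => [|w ne]; last first.
  apply: (vanish q0 w); apply: contra ne; rewrite /is_id => e.
  by move: e; rewrite eq_Tagged.
rewrite (eq_bigl (fun s => s == u)) => [|s].
  by rewrite big_pred1_eq.
rewrite -[outer _]/u comp_idhom; case: (s =P u) => [->|_]; last by rewrite andbF.
by rewrite u1 eqxx.
Qed.

(** The homology is concentrated in the top degree, where there are no boundaries and the cycles are
    the images of Koszul elements. Quantifying over [D] with an equation avoids casts between the
    modules [bar_mod] of equal degrees. *)
Definition koszul_at sigma := forall D, (deg tau - deg sigma)%N = D ->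
  [/\ forall d (z : bar_mod R tau sigma d), (d < D)%N -> bar_cycle z ->
        exists e, bar_diff R tau sigma d e = z,
      forall z : bar_mod R tau sigma D, bar_cycle z -> exists k, z = spread D k &
      forall k : hom tau sigma -> R, spread D k = 0 -> k =1 fun=> 0].

Section Step.
Variables (sigma : tree n) (D : nat).
Hypothesis sigmaD : (deg tau - deg sigma)%N = D.+1.
Hypothesis IH : forall (q : quotient tau), nonid q sigma -> koszul_at q.

Let lt_deg : (deg sigma < deg tau)%N. Proof. by rewrite -subn_gt0 sigmaD. Qed.

Let degq (q : quotient tau) (u : nonid q sigma) : (deg tau - deg q)%N = (D.+1 - hom_deg (val u))%N.
Proof. by rewrite -(hom_deg_sub (val u)) subnDA sigmaD. Qed.

(** Filter by the degree of the first morphism. After a first morphism of degree below [D.+1 - d], a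
    tail of length [d] is below its top degree, so it bounds by induction and can be removed without
    disturbing smaller degrees. *)
Lemma bar_reduce d (z : bar_mod R tau sigma d.+1) p : bar_cycle z -> (p <= D.+1 - d)%N ->
  exists e, forall (q : quotient tau) (u : nonid q sigma), (hom_deg (val u) < p)%N ->
    tail_coeff (z - bar_diff R tau sigma d.+1 e) u = 0.
Proof.
move=> cz; elim: p => [|p IHp] lep; first by exists 0.
have [e He] := IHp (ltnW lep).
have cz' : bar_cycle (z - bar_diff R tau sigma d.+1 e).
  change (bar_diff R tau sigma d (z - bar_diff R tau sigma d.+1 e) = 0).
  by rewrite linearB /= bar_diffK subr0; apply: cz.
set z' := z - _ in He cz'.
have ex_e (q : quotient tau) (u : nonid q sigma) : exists eu : bar_mod R tau q d.+1,
    hom_deg (val u) = p -> bar_diff R tau q d eu = tail_coeff z' u.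
  have [up|nup] := eqVneq (hom_deg (val u)) p; last by exists 0 => e'; rewrite e' eqxx in nup.
  have [bnd _ _] := IH u (degq u).
  have hc : bar_cycle (tail_coeff z' u).
    by apply: head_cycle cz' _ => q' u1; rewrite up; apply: He.
  have lt : (d < D.+1 - hom_deg (val u))%N by rewrite up ltn_subRL addnC -ltn_subRL.
  by have [eu <-] := bnd d _ lt hc; exists eu.
have {}ex_e (q : quotient tau) : exists eu : nonid q sigma -> bar_mod R tau q d.+1,
    forall u, hom_deg (val u) = p -> bar_diff R tau q d (eu u) = tail_coeff z' u.
  exact: (fin_all_exists (ex_e q)).
have [eu euP] := fin_all_exists ex_e.
(* The minus sign offsets that of the tail term in [coord_bar_diff_head]. *)
pose e' := build (fun q u => if hom_deg (val u) == p then - eu q u else 0).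
exists (e + e') => q u; rewrite ltnS leq_eqVlt => le.
have -> : z - bar_diff R tau sigma d.+1 (e + e') = z' - bar_diff R tau sigma d.+1 e'.
  by rewrite linearD opprD addrA.
apply: coordP => c; rewrite coord0 coord_head coordD coordN -coord_head coord_head coord_bar_diff_head.
rewrite head_build big1 => [|q' _].
  rewrite subr0 opprK; case: eqP le => [up _|_ lt].
    by rewrite linearN coordN euP // coord_head subrr.
  by rewrite linear0 coord0 addr0 -coord_head He ?coord0.
apply: big1 => u1 _; apply: big1 => u2 e2; rewrite head_build.
case: eqP => [u1p|_]; last by rewrite coord0.
have := nonid_comp_deg e2; rewrite u1p => up; have := hom_deg_nonid u2.
by case/orP: le => [/eqP|]; rewrite up ?ltnNge ?leq_addr // -[RHS]addn0 => /addnI ->.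
Qed.

(** After a first morphism of degree [D.+1 - d] the tail is in its top degree, hence a [spread];
    after one of larger degree there is no tail of length [d]. Collecting the coefficients gives
    [f], and injectivity of [spread] at the next degree turns the cycle condition into
    [twist f = 0]. *)
Lemma bar_cocycle d (z : bar_mod R tau sigma d.+1) : (d <= D)%N -> bar_cycle z ->
  (forall (q : quotient tau) (u : nonid q sigma), (hom_deg (val u) < D.+1 - d)%N -> tail_coeff z u = 0) ->
  exists f : factorization tau sigma -> R,
  [/\ forall t, hom_deg (outer t) != (D.+1 - d)%N -> f t = 0, twist f =1 fun=> 0 &
      z = build (fun q u => spread d (fun v : hom tau q => f (fact (val u) v)))].
Proof.
set p := (D.+1 - d)%N => le_d cz low.
have p_gt0 : (0 < p)%N by rewrite subn_gt0 ltnS.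
have eD : D.+1 = (d + p)%N by rewrite subnKC // leqW.
have etau : deg tau = (deg sigma + (d + p))%N by rewrite -eD -sigmaD subnKC // ltnW.
(* Indexing by all [w], identities included, allows [f] to be defined on every factorization. *)
have ex_k (q : quotient tau) (w : hom q sigma) : exists k : hom tau q -> R,
    hom_deg w = p -> forall u : nonid q sigma, val u = w -> tail_coeff z u = spread d k.
  have [wp|nwp] := eqVneq (hom_deg w) p; last by exists (fun=> 0) => e; rewrite e eqxx in nwp.
  have nw : ~~ is_id w by rewrite -hom_deg0 wp -lt0n.
  pose u : nonid q sigma := exist _ w nw.
  have du : (deg tau - deg q = d)%N by rewrite (degq u) /= wp eD addnK.
  have [_ top _] := IH u du.
  have hc : bar_cycle (tail_coeff z u) by apply: head_cycle cz _ => q' u1; rewrite /= wp; apply: low.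
  have [k ek] := top _ hc; exists k => _ u' eu'.
  by have -> : u' = u by apply: val_inj.
have {}ex_k (q : quotient tau) : exists k : hom q sigma -> hom tau q -> R, forall w,
    hom_deg w = p -> forall u : nonid q sigma, val u = w -> tail_coeff z u = spread d (k w).
  exact: (fin_all_exists (ex_k q)).
have [k kP] := fin_all_exists ex_k.
pose f (t : factorization tau sigma) : R :=
  if hom_deg (outer t) == p then k (tag t) (outer t) (inner t) else 0.
have zE : z = build (fun q u => spread d (fun v : hom tau q => f (fact (val u) v))).
  apply: headP => q u; rewrite head_build.
  have [up|nup] := eqVneq (hom_deg (val u)) p.
    rewrite (kP q (val u) up u erefl); apply: spread_ext => v.
    by rewrite /f -[outer _]/(val u) up eqxx.
  rewrite (spread_ext _ (k' := fun=> 0)) => [|v]; last first.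
    by rewrite /f -[outer _]/(val u) (negPf nup).
  rewrite spread0; move: nup; rewrite neq_ltn => /orP[/low//|gt].
  apply: bar_mod_eq0; rewrite -(hom_deg_sub (val u)).
  by rewrite etau addnCA !ltn_add2l.
have f0 t : is_id (outer t) -> f t = 0.
  by rewrite -hom_deg0 /f => /eqP ->; rewrite eq_sym -leqn0 leqNgt p_gt0.
exists f; split=> [t|t|//]; first by rewrite /f => /negPf->.
have [tp|ntp] := eqVneq (hom_deg (outer t)) p.+1; last first.
  rewrite -[RHS](@twist_degree0 _ f p t); last exact/eqP.
  apply: eq_bigr => q _; apply: eq_bigr => w _; apply: eq_bigr => s _; congr (_ * _).
  by rewrite /f; case: ifP.
case: t tp => q [w v] /= tp.
have nw : ~~ is_id w by rewrite -hom_deg0 tp.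
pose u : nonid q sigma := exist _ w nw.
have dq : (d + deg q = (deg tau).+1)%N.
  rewrite -(hom_deg_sub w) -[hom_deg w]/(hom_deg (outer (Tagged _ (w, v)))) tp.
  by rewrite etau addnCA !addnS.
(* For [d = 0] the quotient [q] would have larger degree than [tau]. *)
case: d @p z le_d cz low p_gt0 eD etau ex_k k kP f zE f0 tp dq => [|d] p z le_d cz low p_gt0 eD etau _ k kP f zE f0 tp dq.
  by have := quotient_deg q; rewrite -ltnS -dq ltnn.
have dq' : (deg tau - deg q = d)%N.
  by apply/eqP; rewrite -(eqn_add2r (deg q)) subnK ?quotient_deg // -eqSS -dq addSn.
have [_ _ inj] := IH u dq'.
apply: (inj (fun v => twist f (fact w v))); apply: coordP => c.
rewrite -[w]/(val u) -sum_spread // coord0.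
have hz (q1 : quotient tau) (u1 : nonid q1 sigma) :
    tail_coeff z u1 = spread d.+1 (fun v : hom tau q1 => f (fact (val u1) v)).
  by rewrite {1}zE head_build.
have dz : coord (bar_diff R tau sigma d.+1 z) (ccons u c) = 0.
  by rewrite [bar_diff _ _ _ _ _]cz coord0.
move: dz; rewrite coord_bar_diff_head hz bar_diff_spread coord0 oppr0 sub0r.
move/eqP; rewrite oppr_eq0 => /eqP dz; rewrite -[RHS]dz.
by apply: eq_bigr => q' _; apply: eq_bigr => u1 _; apply: eq_bigr => u2 _; rewrite hz.
Qed.

(** The reduced cycle is given by some [f] with [twist f = 0]. Exactness writes [f] as a twist, and
    [bar_diff_build] turns the primitive into a bounding element. *)
Lemma bar_acyclic d (z : bar_mod R tau sigma d) : (d < D.+1)%N -> bar_cycle z ->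
  exists e, bar_diff R tau sigma d e = z.
Proof.
case: d z => [|d] z ltd cz.
  exists 0; rewrite linear0; apply: coordP => -[u uid].
  have /eqP u0 : hom_deg u == 0%N by rewrite hom_deg0.
  by have := sigmaD; rewrite -[LHS]/(hom_deg u) u0.
have le_d : (d <= D)%N by rewrite ltnW // -ltnS.
have [e He] := bar_reduce cz (leqnn (D.+1 - d)).
set z' := z - _ in He.
have cz' : bar_cycle z'.
  change (bar_diff R tau sigma d (z - bar_diff R tau sigma d.+1 e) = 0).
  by rewrite linearB /= bar_diffK subr0; apply: cz.
have [f [f0 df ez]] := bar_cocycle le_d cz' He.
have [g fg] := twist_exact lt_deg df.
(* Below the top degree the outer degree of [f] is at least 2, so the primitive [g'] has positive
   outer degree and defines genuine chains. *)
have [p ep] : exists p, (D.+1 - d)%N = p.+2.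
  by exists (D - d.+1)%N; rewrite subSn // subnSK.
rewrite ep in f0.
pose g' t := if hom_deg (outer t) == p.+1 then g t else 0.
have g'f : twist g' =1 f.
  move=> t; have [tp|ntp] := eqVneq (hom_deg (outer t)) p.+2.
    by rewrite fg (twist_degree g tp).
  by rewrite f0 // twist_degree0 //; apply/eqP.
exists (e + build (fun q u => - spread d.+1 (fun v : hom tau q => g' (fact (val u) v)))).
rewrite linearD bar_diff_build => [|t]; last first.
  by rewrite -hom_deg0 /g' => /eqP ->.
rewrite -[RHS](subrK (bar_diff R tau sigma d.+1 e)) addrC; congr (_ + _).
rewrite -/z' ez; apply: headP => q u; rewrite !head_build.
exact: spread_ext.
Qed.

(** In the top degree [f] has outer degree 1, and its primitive lives on factorizations with
    identity outer factor: it is a function of a morphism from [tau] to [sigma]. *)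
Lemma bar_top (z : bar_mod R tau sigma D.+1) : bar_cycle z -> exists k, z = spread D.+1 k.
Proof.
move=> cz; have [f [f0 df ez]] : exists f : factorization tau sigma -> R,
    [/\ forall t, hom_deg (outer t) != (D.+1 - D)%N -> f t = 0, twist f =1 fun=> 0 &
      z = build (fun q u => spread D (fun v : hom tau q => f (fact (val u) v)))].
  apply: bar_cocycle => // q u; rewrite subSnn ltnNge => /negP[]; exact: hom_deg_nonid.
rewrite subSnn in f0; have [g fg] := twist_exact lt_deg df.
pose g' t := if hom_deg (outer t) == 0%N then g t else 0.
exists (fun v => g' (factor (id_hom sigma) v)).
rewrite ez; apply: headP => q u; rewrite head_build; apply: coordP => c.
rewrite coord_head coord_spread_cons; case: eqP => [u1|nu1].
  rewrite -coordZ; congr (coord _ _).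
  apply: coordP => c'; rewrite coordZ !coord_spread; case: ifP; rewrite ?mulr0 // => _.
  rewrite mulrCA; congr (_ * _); rewrite fg (twist_degree _ (p := 0)) //.
  rewrite twist_id // => t; rewrite -hom_deg0 => /negPf nt.
  by rewrite nt.
rewrite (spread_ext _ (k' := fun=> 0)) ?spread0 ?coord0 // => v.
by rewrite f0 //; apply/eqP.
Qed.

(** Placed on identity outer factors, [k] becomes a cycle for [twist], by injectivity for the tails.
    By exactness it is a twist, and twists vanish on identity outer factors. *)
Lemma spread_inj (k : hom tau sigma -> R) : spread D.+1 k = 0 -> k =1 fun=> 0.
Proof.
move=> k0; pose f (t : factorization tau sigma) :=
  if hom_deg (outer t) == 0%N then k (composite t) else 0.
have f0 t : ~~ is_id (outer t) -> f t = 0 by rewrite -hom_deg0 /f => /negPf->.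
have df : twist f =1 fun=> 0.
  move=> t; have [t1|nt1] := eqVneq (hom_deg (outer t)) 1%N; last first.
    by rewrite -[RHS](@twist_degree0 _ (fun t => k (composite t)) 0 t) //; apply/eqP.
  case: t t1 => q [w v] /= w1.
  have nw : ~~ is_id w by rewrite -hom_deg0 w1.
  pose u : nonid q sigma := exist _ w nw.
  have dq : (deg tau - deg q = D)%N by rewrite (degq u) /= w1 subSS subn0.
  have [_ _ inj] := IH u dq.
  rewrite (@twist_id sigma f q w v f0 w1) {1}/f /= /hom_deg subnn eqxx.
  rewrite /composite /= comp_idhom.
  rewrite (inj (fun v => k (comp_hom w v))) ?mulr0 //; apply: coordP => c.
  have := congr1 (fun x => coord x (ccons u c)) k0.
  rewrite /= coord_spread_cons w1 coord0 /= => e.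
  have [p [q' m]] := merging_exists w1.
  rewrite coord0 -[LHS]mul1r -(hom_sgn_unit R m.1 (merging_precedes m)) -mulrA e.
  by rewrite mulr0.
have [g fg] := twist_exact lt_deg df; move=> v.
have -> : k v = f (factor (id_hom sigma) v).
  by rewrite /f /hom_deg subnn eqxx /composite comp_idhom.
rewrite fg; apply: big1 => q _; apply: big1 => w _; apply: big1 => s /andP[/eqP s1 /eqP e].
by have := hom_degD w s; rewrite e s1 addn1 /hom_deg subnn.
Qed.

End Step.

Lemma koszul_property sigma : koszul_at sigma.
Proof.
move=> D; have [m] := ubnP D; elim: m => // m IHm in D sigma *; rewrite ltnS => leD eD.
case: D leD eD => [|D] leD eD.
  split=> // [z _|k k0 v].
    exists (fun v => if insub v is Some c then coord z c else 0).
    by apply: coordP => c; rewrite coord_spread mul1r [chain_comp c]/(val c) valK.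
  have vid : is_id v by rewrite -hom_deg0 /hom_deg eD.
  have : coord (spread 0 k) (exist _ v vid : chain 0 tau sigma) = 0 by rewrite k0 coord0.
  by rewrite coord_spread [LHS]mul1r.
have IH (q : quotient tau) (u : nonid q sigma) : koszul_at q.
  move=> E eE; apply: IHm => //; apply: leq_trans leD.
  rewrite -eE -eD ltn_sub2l //; last exact: nonid_deg (valP u).
  by rewrite -subn_gt0 eD.
by split; [apply: bar_acyclic | apply: bar_top | apply: spread_inj].
Qed.

Lemma chain_deg1_deg d sigma (c : chain d tau sigma) :
  chain_deg1 c -> hom_deg (chain_comp c) = d.
Proof.
elim: d sigma c => [|d IHd] sigma; first by case=> u uid _; apply/eqP; rewrite hom_deg0.
case=> q [u c] /andP[/eqP u1 /IHd c1].
by rewrite -[chain_comp _]/(comp_hom (val u) (chain_comp c)) hom_degD u1 c1.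
Qed.

Lemma incl_spread d sigma (x : koszul_mod R tau sigma d) :
  incl R tau sigma d x = spread d (fun v => if insub v is Some u then coord x u else 0).
Proof.
apply: coordP => c; rewrite coord_spread [LHS]coord_lin_ext.
have genE u : coord (incl_gen R u) c =
    if (chain_comp c == val u) && chain_deg1 c then chain_sgn R c else 0.
  rewrite /incl_gen coord_sum big_mkcond.
  transitivity (\sum_(c' : chain d tau sigma) if c' == c then
      (if (chain_comp c == val u) && chain_deg1 c then chain_sgn R c else 0) else 0).
    apply: eq_bigr => c' _; have [->|ne] := eqVneq c' c; case: ifP => // _;
      by rewrite coordZ coord_gen ?eqxx ?mulr1 // eq_sym (negPf ne) mulr0.
  by rewrite -big_mkcond big_pred1_eq.
under eq_bigr do rewrite genE.
case: (boolP (chain_deg1 c)) => c1; last by rewrite big1 // => u _; rewrite andbF mulr0.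
have cd : hom_deg (chain_comp c) == d by rewrite chain_deg1_deg.
rewrite insubT (bigD1 (Sub (chain_comp c) cd)) //= big1 ?addr0 => [|u ne].
  by rewrite eqxx mulrC.
by rewrite andbT eq_sym -(inj_eq val_inj) /= in ne *; rewrite (negPf ne) mulr0.
Qed.

End BarHomology.

Lemma incl_weak_equivalence (R : comPzRingType) (n : nat) (tau sigma : tree n) :
  @weak_equivalence R (koszul R tau sigma) (bar R tau sigma) (@incl R n tau sigma).
Proof.
split=> [d x|d].
  change (incl R tau sigma d 0 = bar_diff R tau sigma d (incl R tau sigma d.+1 x)).
  by rewrite linear0 incl_spread bar_diff_spread.
have Kcycle (x : koszul R tau sigma d) : cycle x by case: (d) x.
have [low _ _] := koszul_property R (erefl (deg tau - deg sigma)%N).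
split=> [x y _ _ [w xy]|z cz].
  exists 0; change (x - y = 0 :> koszul_mod R tau sigma d).
  change (incl R tau sigma d x - incl R tau sigma d y = bar_diff R tau sigma d w) in xy.
  apply: coordP => u; rewrite coord0.
  have [_ _ inj] := koszul_property R (eqP (valP u)).
  (* There are no chains longer than the degree of [u], so homologous images are equal. *)
  have w0 : w = 0.
    apply: bar_mod_eq0; rewrite addSn -(eqP (valP u)) subnK //.
    exact: hom_deg_le (val u).
  rewrite w0 linear0 -linearB incl_spread in xy.
  by have := inj _ xy (val u); rewrite valK.
have [lt|] := ltnP d (deg tau - deg sigma).
  have [e ez] := low d z lt cz; exists 0 => //; exists (- e).
  change (incl R tau sigma d 0 - z = bar_diff R tau sigma d (- e)).
  by rewrite linear0 sub0r linearN ez.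
rewrite leq_eqVlt => /orP[/eqP eD|lt].
  have [_ top _] := koszul_property R eD; have [k zk] := top z cz.
  exists (of_coord (fun u => k (val u))) => //; exists 0.
  change (incl R tau sigma d (of_coord (fun u => k (val u))) - z = bar_diff R tau sigma d 0).
  rewrite linear0 zk incl_spread; apply/eqP; rewrite subr_eq0; apply/eqP.
  apply: coordP => c; rewrite !coord_spread; case: ifP => // c1.
  have cd : hom_deg (chain_comp c) == d by rewrite chain_deg1_deg.
  by rewrite insubT of_coordE.
have z0 : z = 0 by apply: bar_mod_eq0; rewrite addnC -(ltn_predK lt) addnS ltnS -leq_subLR -ltnS (ltn_predK lt).
exists 0 => //; exists 0.
change (incl R tau sigma d 0 - z = bar_diff R tau sigma d 0).
by rewrite z0 linear0 linear0; apply: subr0.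
Qed.

End BarComplex.

Theorem mainTheorem1 (R : comPzRingType) (n : nat) (n_gt0 : 0 < n)
  (tau sigma : tree n) :
  @weak_equivalence R (koszul R tau sigma) (bar R tau sigma)
    (@incl R n tau sigma).
Proof. exact: incl_weak_equivalence. Qed.
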